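(* Let $p$ be a prime, $m\in\mathbb{N}_0=\mathbb{N}\cup\{0\}$ and let $k\geq 2$ be an even integer. If $f(z)\in\mathcal{P}_k(p^m)$, then $$\sum_{r\in R(p^m)} v_r(f) < \begin{cases} 1 & \text{if } p^m=1,\\ 4 & \text{if } p^m=4,\\ p^{[(m-1)/2]}\left(p^{(m-1)-2[(m-1)/2]}+1\right) & \text{if } p^m\neq 1 \text{ or } 4.\end{cases}$$
   Context: Let $z$ be in the complex upper half-plane and $q=e^{2\pi i z}$. For an even integer $k\geq 2$, the Eisenstein series is normalized as $E_k(z)=-\frac{B_k}{2k}+\sum_{n\geq1}\sigma_{k-1}(n)q^n$, where $B_k$ is the $k$-th Bernoulli number and $\sigma_{k-1}(n)=\sum_{0<d\mid n}d^{k-1}$. For a positive integer $N$ define the $\mathbb{Q}$-vector spaces $\mathcal{E}_2(N)=\langle E_2(z)-dE_2(dz) : 1<d\mid N\rangle_{\mathbb{Q}}$ and, for $k\geq 4$ even, $\mathcal{E}_k(N)=\langle E_k(dz): 1\leq d\mid N\rangle_{\mathbb{Q}}$; these are subspaces of the space of modular forms of weight $k$ for $\Gamma_0(N)$. Define $\mathcal{O}_k(N)=\bigcup_{1<d\mid N}\big(\mathcal{E}_k(N/d)\cup\{f(dz): f(z)\in\mathcal{E}_k(N/d)\}\big)$ and $\mathcal{P}_k(N)=\mathcal{E}_k(N)\setminus\mathcal{O}_k(N)$. $R(N)$ denotes a complete set of inequivalent cusps of $\Gamma_0(N)$, and for a cusp $r$, $v_r(f)$ denotes the order of vanishing of $f$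 at $r$ (measured in the local uniformizer at $r$ for $\Gamma_0(N)$). $[x]$ denotes the integer part of $x$. *)

(* Defs.v *)
From HB Require Import structures.
From mathcomp Require Import all_boot all_order all_algebra.
From mathcomp Require Import complex.
From mathcomp Require Import all_classical all_reals all_analysis.

Set Implicit Arguments.
Unset Strict Implicit.
Unset Printing Implicit Defensive.

Import Order.TTheory GRing.Theory Num.Theory.
Import numFieldNormedType.Exports.

Local Open Scope classical_set_scope.
Local Open Scope ring_scope.

(* [:: B_0; ...; B_(n-1)], from \sum_(j <= n) 'C(n+1, j) B_j = [n = 0]. *)
Fixpoint bernoulli_seq (n : nat) : seq rat :=
  if n is n'.+1 then
    let s := bernoulli_seq n' in
    rcons s (((n' == 0%N)%:R - \sum_(j < n') 'C(n'.+1, j)%:R * s`_j) / n'.+1%:R)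
  else [::].

Definition bernoulli_number (n : nat) : rat := (bernoulli_seq n.+1)`_n.

Definition sigma (j n : nat) : nat := (\sum_(d <- divisors n) d ^ j)%N.

(* Functions on the upper half-plane are total functions R[i] -> R[i] of which
   only the restriction to this set matters. *)
Definition upper_half_plane (R : realType) : set R[i] :=
  [set z | 0 < complex.Im z].

Definition cexp (R : realType) (z : R[i]) : R[i] :=
  (expR (complex.Re z))%:C%C * (cos (complex.Im z) +i* sin (complex.Im z))%C.

(* e^(2 pi i z) *)
Definition nome (R : realType) (z : R[i]) : R[i] :=
  cexp ((2 * pi)%:C%C * 'i%C * z).

Definition eisenstein (R : realType) (k : nat) (z : R[i]) : R[i] :=
  - ratr (bernoulli_number k / (2 * k)%:R)
  + limn (series (fun n : nat => (sigma k.-1 n.+1)%:R * nome z ^+ n.+1)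
          : nat -> R[i]^o).

Definition rat_span (R : realType) (s : seq nat) (g : nat -> R[i] -> R[i]) :
    set (R[i] -> R[i]) :=
  [set f | exists c : nat -> rat, forall z, upper_half_plane z ->
     f z = \sum_(d <- s) ratr (c d) * g d z].

Definition eis_space (R : realType) (k N : nat) : set (R[i] -> R[i]) :=
  if k == 2%N then
    rat_span [seq d <- divisors N | (1 < d)%N]
      (fun d z => eisenstein 2 z - d%:R * eisenstein 2 (d%:R * z))
  else rat_span (divisors N) (fun d z => eisenstein k (d%:R * z)).

Definition old_eis (R : realType) (k N : nat) : set (R[i] -> R[i]) :=
  [set f | exists d : nat, [/\ (1 < d)%N, (d %| N)%N &
     eis_space k (N %/ d) f \/
     exists2 g, eis_space k (N %/ d) g &
       forall z, upper_half_plane z -> f z = g (d%:R * z)]].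

Definition prim_eis (R : realType) (k N : nat) : set (R[i] -> R[i]) :=
  @eis_space R k N `\` @old_eis R k N.

Definition SL2Z : set 'M[int]_2 := [set g | \det g = 1].

Definition Gamma0 (N : nat) : set 'M[int]_2 :=
  [set g | SL2Z g /\ (N%:Z %| g 1%R 0%R)%Z].

(* P^1(Q), with None as the point at infinity. *)
Definition cusp : Type := option rat.

Definition cusp_act (g : 'M[int]_2) (r : cusp) : cusp :=
  match r with
  | None => if g 1 0 == 0 then None else Some ((g 0 0)%:~R / (g 1 0)%:~R)
  | Some x =>
      if (g 1 0)%:~R * x + (g 1 1)%:~R == 0 then None
      else Some (((g 0 0)%:~R * x + (g 0 1)%:~R) /
                 ((g 1 0)%:~R * x + (g 1 1)%:~R))
  end.

Definition cusp_equiv (N : nat) (r s : cusp) : Prop :=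
  exists2 g, Gamma0 N g & cusp_act g r = s.

(* The entries of rs form a complete set of inequivalent cusps of Gamma0 N. *)
Definition cusp_representatives (N : nat) (rs : seq cusp) : Prop :=
  [/\ uniq rs,
      forall r s, r \in rs -> s \in rs -> cusp_equiv N r s -> r = s &
      forall r, exists2 s, s \in rs & cusp_equiv N r s].

Definition translation (h : nat) : 'M[int]_2 := 1%:M + h%:Z *: delta_mx 0 1.

(* h is the width of the cusp g(oo) for Gamma0 N; since - 1 lies in Gamma0 N,
   no sign needs to be allowed in front of the translation. *)
Definition cusp_width (N : nat) (g : 'M[int]_2) (h : nat) : Prop :=
  let stab j := (0 < j)%N /\ Gamma0 N (g *m translation j *m invmx g) in
  stab h /\ forall j, stab j -> (h <= j)%N.

(* The weight k action (f|_k g)(z) = (c z + d)^-k f((a z + b) / (c z + d)). *)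
Definition slash (R : realType) (k : nat) (f : R[i] -> R[i]) (g : 'M[int]_2)
    (z : R[i]) : R[i] :=
  let j := (g 1 0)%:~R * z + (g 1 1)%:~R in
  j ^- k * f (((g 0 0)%:~R * z + (g 0 1)%:~R) / j).

(* f|_k g = \sum_n a_n q_h^n on the upper half-plane, where q_h(z) =
   e^(2 pi i z / h) and h is the width of the cusp g(oo). *)
Definition cusp_expansion (R : realType) (N k : nat) (f : R[i] -> R[i])
    (g : 'M[int]_2) (a : nat -> R[i]) : Prop :=
  exists2 h, cusp_width N g h &
    forall z, upper_half_plane z ->
      (series (fun n : nat => a n * nome (z / h%:R) ^+ n) : nat -> R[i]^o)
        @ \oo --> (slash k f g z : R[i]^o).

(* Order of vanishing at the cusp r = g(oo): the least n with a_n != 0, which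
   does not depend on g. It is +oo when f vanishes identically and also when f
   has no expansion at r. *)
Definition cusp_order (R : realType) (N k : nat) (f : R[i] -> R[i]) (r : cusp) :
    \bar R :=
  ereal_inf [set n%:R%:E | n in [set n : nat | exists g a,
    [/\ SL2Z g, cusp_act g None = r, cusp_expansion N k f g a & a n != 0]]].

Definition order_bound (p m : nat) : nat :=
  (if p ^ m == 1 then 1
   else if p ^ m == 4 then 4
   else p ^ ((m - 1) %/ 2) * (p ^ ((m - 1) - 2 * ((m - 1) %/ 2)) + 1))%N.

(* Main.v *)
Require Import Defs.
From HB Require Import structures.
From mathcomp Require Import all_boot all_order all_algebra.
From mathcomp Require Import complex.
From mathcomp Require Import all_classical all_reals all_analysis.
From mathcomp Require Import ring lra zify.

Set Implicit Arguments.
Unset Strict Implicit.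
Unset Printing Implicit Defensive.

Import Order.TTheory GRing.Theory Num.Theory.
Import numFieldNormedType.Exports.

Local Open Scope classical_set_scope.
Local Open Scope ring_scope.

(** Write f = \sum_i c_i E_k(p^i z) with c_0 and c_m nonzero, since f is neither
    of level p^(m-1) nor of the form g(p z) with g of level p^(m-1). If the
    denominator of a cusp g(oo) has gcd p^e with p^m, then factoring
    diag(p^i, 1) g = g_i [A, B; 0, D] with g_i in SL2(Z) gives
      f|g = \sum_i c_i p^(-k max(i - e, 0)) E_k((A_i z + B_i) / D_i),
    and the coefficient of the local uniformizer is c_m times a unit if 2e < m,
    is c_0 if 2e > m, and is c_0 + c_m p^(-k e) xi, with xi a primitive p^e-th
    root of unity, if 2e = m. Hence every order of vanishing is at most 1 unless
    p^m = 4. The constant terms for e = m and e = m - 1 differ by a nonzero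
    multiple of c_m, so some order is 0, and the bound is the number of cusps.
    When p^m = 4 the coefficients of 1, q, q^2 at the cusp 1/2 are compared.

    Modularity of the q-series E_k is proved from scratch. Lipschitz' formula
    follows by letting M grow in the distribution relation
    H(z) = M^(-k) \sum_(j mod M) H((z + j) / M), where H(z) = \sum_r r^(k-1) q^r;
    its k = 1 case is the partial fraction expansion of the cotangent, which also
    identifies the constant term -B_k/2k with a zeta value. Then E_k(-1/z) is
    compared with E_k(z) by interchanging a double sum, absolutely convergent for
    k >= 4; for k = 2 the defect is computed with a telescoping series. *)

(** Since [cusp_order] is an infimum, an order is bounded by exhibiting one expansion with one
    nonzero coefficient; the estimate rests on the coefficients of index 0 and 1, and of index 2
    when p^m = 4. The middle case 2e = m is settled by rationality: c_0 + c_m p^(-k e) xi = 0 makes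
    xi a rational root of unity, hence 1 or -1, while xi has exact order p^e with e >= 1; so p^e =
    2. For p^m = 4 there are three cusps. Either each order is at most 1, or (c_0, c_1, c_2) is
    proportional to (1, -2, 2^k), and then the orders are at most 2 at the cusp 1/2 and at most 0 at
    the other two; both totals are below 4. In weight 2 each E_2(p^i z) transforms with a defect
    proportional to p^(-i). The generators E_2(z) - d E_2(d z) impose the relation \sum_i c_i p^(-i)
    = 0, which removes the defect from f. *)

(** * Real-valued modulus and limits in [R[i]] *)

Section ComplexModulus.
Context {R : realType}.
Implicit Types x y z : R[i].

(** The norm of [R[i]] is itself an element of [R[i]]; comparison of series and [lra] need it in
    [R]. *)
Definition cabs (z : R[i]) : R := complex.Re `|z|.

Lemma normC_cabs z : `|z| = (cabs z)%:C%C.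
Proof. by rewrite /cabs normc_def. Qed.

Lemma real_complex_inj (a b : R) : (a%:C)%C = (b%:C)%C -> a = b.
Proof. exact: complexI. Qed.

Lemma cabs_def z : cabs z = Num.sqrt (complex.Re z ^+ 2 + complex.Im z ^+ 2).
Proof. by rewrite /cabs normc_def. Qed.

Lemma cabs_ge0 z : 0 <= cabs z.
Proof. by rewrite cabs_def sqrtr_ge0. Qed.

Lemma cabs0 : cabs 0 = 0.
Proof. by apply: real_complex_inj; rewrite -normC_cabs normr0. Qed.

Lemma cabs1 : cabs 1 = 1.
Proof. by apply: real_complex_inj; rewrite -normC_cabs normr1. Qed.

Lemma cabs_eq0 z : (cabs z == 0) = (z == 0).
Proof.
rewrite -[RHS]normr_eq0 normC_cabs; apply/eqP/eqP => [->//|].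
exact: real_complex_inj.
Qed.

Lemma cabs_gt0 z : (0 < cabs z) = (z != 0).
Proof. by rewrite lt_def cabs_ge0 andbT cabs_eq0. Qed.

Lemma cabsM x y : cabs (x * y) = cabs x * cabs y.
Proof. by apply: real_complex_inj; rewrite rmorphM -!normC_cabs normrM. Qed.

Lemma cabsV x : cabs x^-1 = (cabs x)^-1.
Proof. by apply: real_complex_inj; rewrite fmorphV -!normC_cabs normfV. Qed.

Lemma cabsX x n : cabs (x ^+ n) = cabs x ^+ n.
Proof. by apply: real_complex_inj; rewrite rmorphXn -!normC_cabs normrX. Qed.

Lemma cabsN x : cabs (- x) = cabs x.
Proof. by rewrite /cabs normrN. Qed.

Lemma cabsB x y : cabs (x - y) = cabs (y - x).
Proof. by rewrite -cabsN opprB. Qed.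

Lemma ler_cabsD x y : cabs (x + y) <= cabs x + cabs y.
Proof. by rewrite -lecR rmorphD -!normC_cabs ler_normD. Qed.

Lemma cabs_real (a : R) : cabs (a%:C)%C = `|a|.
Proof. by rewrite cabs_def /= expr0n addr0 sqrtr_sqr. Qed.

Lemma cabs_nat n : cabs n%:R = n%:R.
Proof. by rewrite -(rmorph_nat (real_complex R)) cabs_real normr_nat. Qed.

Lemma ler_Re_cabs z : `|complex.Re z| <= cabs z.
Proof. by rewrite cabs_def -sqrtr_sqr ler_wsqrtr// lerDl sqr_ge0. Qed.

Lemma ler_Im_cabs z : `|complex.Im z| <= cabs z.
Proof. by rewrite cabs_def -sqrtr_sqr ler_wsqrtr// lerDr sqr_ge0. Qed.

Lemma ler_cabs_ReIm z : cabs z <= `|complex.Re z| + `|complex.Im z|.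
Proof.
rewrite cabs_def -(ler_pXn2r (n := 2))// ?nnegrE ?sqrtr_ge0 ?addr_ge0//.
rewrite sqr_sqrtr ?addr_ge0 ?sqr_ge0// sqrrD !real_normK ?num_real//.
by rewrite lerD2r lerDl mulrn_wge0// mulr_ge0.
Qed.

Lemma ler_cabs_sum n (F : nat -> R[i]) :
  cabs (\sum_(0 <= i < n) F i) <= \sum_(0 <= i < n) cabs (F i).
Proof.
elim: n => [|n IH]; first by rewrite !big_geq// cabs0.
by rewrite !big_nat_recr//= (le_trans (ler_cabsD _ _))// lerD2r.
Qed.

Lemma lerB_cabs x y : cabs x - cabs y <= cabs (x - y).
Proof. by rewrite lerBlDr (le_trans _ (ler_cabsD _ _))// subrK. Qed.

(* A one-constructor inductive, so that unification never unfolds the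
   neighbourhood filters behind a limit. *)
Variant ccvg (u : nat -> R[i]) (l : R[i]) : Prop :=
  CCvg of (u : nat -> R[i]^o) @ \oo --> (l : R[i]^o).

Lemma ccvgE u l : ccvg u l -> (u : nat -> R[i]^o) @ \oo --> (l : R[i]^o).
Proof. by case. Qed.

Lemma ccvg_cabsP (u : nat -> R[i]) (l : R[i]) :
  ccvg u l <->
  (fun n => cabs (l - u n)) @ \oo --> (0 : R).
Proof.
split => [[/cvgrPdist_lt h]|/cvgrPdist_lt h].
  apply/cvgrPdist_lt => e e0.
  have /h : (0 : R[i]) < (e%:C)%C by rewrite ltcR.
  apply: filterS => n; rewrite normC_cabs ltcR sub0r normrN.
  by rewrite ger0_norm ?cabs_ge0.
split; apply/cvgrPdist_lt => e; rewrite ltcE => /andP[/eqP e1 e2].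
have /h := e2; apply: filterS => n; rewrite sub0r normrN ger0_norm ?cabs_ge0//.
by rewrite normC_cabs ltcE /= e1 eqxx.
Qed.

Lemma ccvg_ReIm (u : nat -> R[i]) (l : R[i]) :
  (fun n => complex.Re (u n)) @ \oo --> complex.Re l ->
  (fun n => complex.Im (u n)) @ \oo --> complex.Im l ->
  ccvg u l.
Proof.
move=> /cvgrPdist_lt h1 /cvgrPdist_lt h2; apply/ccvg_cabsP/cvgrPdist_lt => e e0.
have e20 : 0 < e / 2 by lra.
near=> n; rewrite sub0r normrN ger0_norm ?cabs_ge0//.
apply: (le_lt_trans (ler_cabs_ReIm _)).
rewrite (splitr e) ltrD// !raddfB /=.
  by near: n; exact: h1.
by near: n; exact: h2.
Unshelve. all: by end_near. Qed.

Lemma ccvg_Re (u : nat -> R[i]) (l : R[i]) :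
  ccvg u l ->
  (fun n => complex.Re (u n)) @ \oo --> complex.Re l.
Proof.
move/ccvg_cabsP/cvgrPdist_lt => h; apply/cvgrPdist_lt => e /h.
apply: filterS => n; rewrite sub0r normrN ger0_norm ?cabs_ge0//.
by apply: le_lt_trans; rewrite -raddfB ler_Re_cabs.
Qed.

Lemma ccvg_unique (u : nat -> R[i]) (l l' : R[i]) :
  ccvg u l ->
  ccvg u l' -> l = l'.
Proof. by move=> [h] [h']; exact: (cvg_unique (@norm_hausdorff _ R[i]^o) h h'). Qed.

Lemma ccvg_real (u : nat -> R) (l : R) : u @ \oo --> l ->
  ccvg (fun n => (u n)%:C%C) (l%:C)%C.
Proof. by move=> h; apply: ccvg_ReIm => //=; exact: cvg_cst. Qed.

Lemma ccvg_subseq (u : nat -> R[i]) (l : R[i]) (phi : nat -> nat) :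
  (forall n, (n <= phi n)%N) ->
  ccvg u l ->
  ccvg (fun n => u (phi n)) l.
Proof.
move=> hphi [h]; split; apply: cvg_comp h => A [N _ hN]; exists N => //= n /= Nn.
by apply: hN => /=; exact: leq_trans Nn (hphi n).
Qed.

Lemma ccvg_norm_le (u : nat -> R[i]) (l : R[i]) (B : R) :
  (forall n, cabs (u n) <= B) ->
  ccvg u l -> cabs l <= B.
Proof.
move=> hB /ccvg_cabsP/cvgrPdist_lt h; apply/ler_addgt0Pr => e /h [N _ /(_ N)].
rewrite sub0r normrN ger0_norm ?cabs_ge0// => /(_ (leqnn _)) hN.
have := lerB_cabs l (u N); have := hB N; lra.
Qed.

Lemma ccvg_cst l : ccvg (fun=> l) l.
Proof. by split; exact: cvg_cst. Qed.

Lemma ccvgD u v l l' : ccvg u l -> ccvg v l' -> ccvg (fun n => u n + v n) (l + l').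
Proof. by move=> [h] [h']; split; exact: (cvgD h h'). Qed.

Lemma ccvgB u v l l' : ccvg u l -> ccvg v l' -> ccvg (fun n => u n - v n) (l - l').
Proof. by move=> [h] [h']; split; exact: (cvgB h h'). Qed.

Lemma ccvgM u v l l' : ccvg u l -> ccvg v l' -> ccvg (fun n => u n * v n) (l * l').
Proof. by move=> [h] [h']; split; exact: (cvgM h h'). Qed.

Lemma ccvgV u l : l != 0 -> ccvg u l -> ccvg (fun n => (u n)^-1) l^-1.
Proof. by move=> l0 [h]; split; exact: (cvgV l0 h). Qed.

Lemma ccvgX u l k : ccvg u l -> ccvg (fun n => u n ^+ k) (l ^+ k).
Proof.
move=> h; elim: k => [|k IH]; first exact: ccvg_cst.
rewrite exprS (_ : (fun n => _) = fun n => u n * u n ^+ k); first exact: ccvgM.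
by apply/funext => n; rewrite exprS.
Qed.

Lemma ccvg_sum (I : Type) (r : seq I) (F : I -> nat -> R[i]) (L : I -> R[i]) :
  (forall i, ccvg (F i) (L i)) ->
  ccvg (fun n => \sum_(i <- r) F i n) (\sum_(i <- r) L i).
Proof.
move=> h; elim: r => [|i r IH].
  rewrite big_nil (_ : (fun n => _) = fun=> 0); first exact: ccvg_cst.
  by apply/funext => n; rewrite big_nil.
rewrite big_cons (_ : (fun n => _) = fun n => F i n + \sum_(i <- r) F i n).
  exact: ccvgD.
by apply/funext => n; rewrite big_cons.
Qed.

Lemma ccvg_shiftS u l : ccvg (fun n => u n.+1) l <-> ccvg u l.
Proof.
by split=> -[h]; split; move: h; rewrite (@cvg_shiftS R[i]^o).
Qed.

Lemma ccvg_eventually (u v : nat -> R[i]) l N :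
  (forall n, (N <= n)%N -> u n = v n) -> ccvg u l -> ccvg v l.
Proof.
move=> h [h']; split; move: h'; rewrite -(@cvg_shiftn N R[i]^o u) -(@cvg_shiftn N R[i]^o v).
by rewrite (_ : (fun n => u _) = fun n => v (n + N)%N)//; apply/funext => n; rewrite h// leq_addl.
Qed.

End ComplexModulus.

(** * Series in [R[i]]: algebra, dominated convergence, interchange of sums *)

Section ComplexSeries.
Context {R : realType}.
Implicit Types (a b : nat -> R[i]) (s t : R[i]).

Definition csum a s : Prop :=
  ccvg (series a) s.

Lemma csum_unique a s t : csum a s -> csum a t -> s = t.
Proof. exact: ccvg_unique. Qed.

Lemma csum_lim a s : csum a s -> limn (series a : nat -> R[i]^o) = s.
Proof. by case=> h; exact: (cvg_lim (@norm_hausdorff _ R[i]^o) h). Qed.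

Lemma csumD a b s t : csum a s -> csum b t -> csum (fun n => a n + b n) (s + t).
Proof.
move=> ha hb; rewrite /csum.
have -> : series (fun n => a n + b n) = fun n => series a n + series b n.
  by apply/funext => n; rewrite /series/= big_split.
exact: ccvgD.
Qed.

Lemma csumZ (c : R[i]) a s : csum a s -> csum (fun n => c * a n) (c * s).
Proof.
move=> ha; rewrite /csum.
have -> : series (fun n => c * a n) = fun n => c * series a n.
  by apply/funext => n; rewrite /series/= mulr_sumr.
exact: (ccvgM (ccvg_cst c) ha).
Qed.

Lemma csumN a s : csum a s -> csum (fun n => - a n) (- s).
Proof.
move=> /(csumZ (-1)); rewrite mulN1r; congr csum.
by apply/funext => n; rewrite mulN1r.
Qed.

Lemma eq_csum a b s : a =1 b -> csum a s -> csum b s.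
Proof. by move=> /funext ->. Qed.

Lemma csum0 : csum (fun=> 0) 0.
Proof.
rewrite /csum (_ : series _ = fun=> 0); first exact: ccvg_cst.
by apply/funext => n; rewrite /series/= big1.
Qed.

Lemma csum_big (I : eqType) (r : seq I) (F : I -> nat -> R[i]) (S : I -> R[i]) :
  (forall i, i \in r -> csum (F i) (S i)) ->
  csum (fun n => \sum_(i <- r) F i n) (\sum_(i <- r) S i).
Proof.
elim: r => [|i r IH] h.
  rewrite big_nil; apply: eq_csum csum0 => n; by rewrite big_nil.
rewrite big_cons; apply: (@eq_csum (fun n => F i n + \sum_(i <- r) F i n)).
  by move=> n; rewrite big_cons.
apply: csumD; first by apply: h; rewrite mem_head.
by apply: IH => j jr; apply: h; rewrite in_cons jr orbT.
Qed.

Lemma csum_recl a s : csum (fun n => a n.+1) s -> csum a (a 0%N + s).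
Proof.
move=> ha; apply/ccvg_shiftS.
have -> : (fun n => series a n.+1) = fun n => a 0%N + series (fun n => a n.+1) n.
  apply/funext => n; rewrite /series/= big_nat_recl//.
apply: ccvgD => //; exact: ccvg_cst.
Qed.

Lemma csum_behead a s : csum a s -> csum (fun n => a n.+1) (s - a 0%N).
Proof.
move=> ha; rewrite /csum.
have -> : series (fun n => a n.+1) = fun n => series a n.+1 - a 0%N.
  by apply/funext => n; rewrite /series/= big_nat_recl// addrAC subrr add0r.
apply: ccvgB; last exact: ccvg_cst.
by apply/ccvg_shiftS.
Qed.

Lemma csum_finite a n : (forall i, (n <= i)%N -> a i = 0) ->
  csum a (\sum_(0 <= i < n) a i).
Proof.
move=> h; apply: (@ccvg_eventually _ (fun=> \sum_(0 <= i < n) a i) _ _ n) => [i ni|]; last exact: ccvg_cst.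
apply/esym; rewrite /series /= (big_cat_nat _ (n := n))//=.
rewrite [X in _ + X](_ : _ = 0) ?addr0//.
by rewrite big_nat_cond big1// => j /andP[/andP[/h]].
Qed.

Lemma csum_abs_cvg a (b : nat -> R) : (forall n, cabs (a n) <= b n) ->
  cvgn (series b) -> exists s, csum a s.
Proof.
move=> hab hb.
have hR : cvgn (series (fun n => complex.Re (a n))).
  apply: normed_cvg; apply: series_le_cvg hb => n //=.
    by apply: le_trans (hab n); exact: cabs_ge0.
  exact: le_trans (ler_Re_cabs _) (hab n).
have hI : cvgn (series (fun n => complex.Im (a n))).
  apply: normed_cvg; apply: series_le_cvg hb => n //=.
    by apply: le_trans (hab n); exact: cabs_ge0.
  exact: le_trans (ler_Im_cabs _) (hab n).
exists (limn (series (fun n => complex.Re (a n))) +i*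
        limn (series (fun n => complex.Im (a n))))%C.
apply: ccvg_ReIm => /=.
  rewrite (_ : (fun n => _) = series (fun n => complex.Re (a n)))//.
  by apply/funext => n; rewrite /series/= raddf_sum.
rewrite (_ : (fun n => _) = series (fun n => complex.Im (a n)))//.
by apply/funext => n; rewrite /series/= raddf_sum.
Qed.

Lemma csum_real (b : nat -> R) (l : R) : series b @ \oo --> l ->
  csum (fun n => (b n)%:C%C) (l%:C)%C.
Proof.
move=> /ccvg_real; congr ccvg.
by apply/funext => n; rewrite /series/= raddf_sum.
Qed.

(** Dominated convergence for series. Past a common [N] the tails of all the [u M] and of [v] are at
    most e/4, by the majorant [b]; the finite part before [N] converges termwise. *)
Lemma tannery (u : nat -> nat -> R[i]) (v : nat -> R[i]) (b : nat -> R)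
    (S : nat -> R[i]) (s : R[i]) :
  (forall M, csum (u M) (S M)) -> csum v s ->
  (forall d, ccvg (fun M => u M d) (v d)) ->
  (forall M d, cabs (u M d) <= b d) -> cvgn (series b) ->
  ccvg S s.
Proof.
move=> hS hs huv hub hb; apply/ccvg_cabsP/cvgrPdist_lt => e e0.
have e4 : 0 < e / 4 by lra.
have hv d : cabs (v d) <= b d by apply: ccvg_norm_le (huv d).
have [N hN] : exists N, limn (series b) - series b N < e / 4.
  have /cvgrPdist_lt/(_ _ e4) [N _ /(_ N (leqnn _)) hN] := hb.
  by exists N; apply: le_lt_trans hN; exact: ler_norm.
have tail (a : nat -> R[i]) t : (forall d, cabs (a d) <= b d) -> csum a t ->
    cabs (t - series a N) <= e / 4.
  move=> ha hat; apply: le_trans (ltW hN).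
  have : ccvg (fun n => series a (n + N)%N - series a N) (t - series a N).
    by apply: ccvgB; [exact: (ccvg_subseq (leq_addr N) hat)|exact: ccvg_cst].
  apply: ccvg_norm_le => n.
  rewrite sub_series_geq ?leq_addl//.
  have -> : limn (series b) - series b N =
      (limn (series b) - series b (n + N)) + (series b (n + N) - series b N).
    by rewrite addrA subrK.
  rewrite [X in _ <= _ + X]sub_series_geq ?leq_addl//.
  rewrite -[leLHS]add0r lerD//.
    rewrite subr_ge0; apply: nondecreasing_cvgn_le => //.
    apply/nondecreasing_seqP => i; rewrite /series/= big_nat_recr//= lerDl.
    by apply: le_trans (ha i); exact: cabs_ge0.
  rewrite (big_addn 0) [leRHS](big_addn 0).
  apply: (le_trans (ler_cabs_sum _ _)); exact: ler_sum.
have /ccvg_cabsP/cvgrPdist_lt/(_ _ e4) hfin :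
    ccvg (fun M => series (u M) N) (series v N).
  elim: {hN tail} N => [|N IH].
    rewrite (_ : (fun M => _) = fun=> 0); last first.
      by apply/funext => M; rewrite /series/= big_geq.
    by rewrite /series/= big_geq//; exact: ccvg_cst.
  rewrite (_ : (fun M => _) = fun M => series (u M) N + u M N); last first.
    by apply/funext => M; rewrite /series/= big_nat_recr.
  by rewrite /series/= big_nat_recr//=; apply: ccvgD.
apply: filterS hfin => M; rewrite !sub0r !normrN !ger0_norm ?cabs_ge0// => hM.
have -> : s - S M = (s - series v N) + ((series v N - series (u M) N) +
   (series (u M) N - S M)) by ring.
have h1 := tail _ _ hv hs; have h2 := tail _ _ (hub M) (hS M).
rewrite cabsB in h2.
have := ler_cabsD (s - series v N) ((series v N - series (u M) N) +
   (series (u M) N - S M)).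
have := ler_cabsD (series v N - series (u M) N) (series (u M) N - S M).
lra.
Qed.

(** The [M]-th partial sum of the column sums is the sum over [d] of the truncated rows
    [series (a d) M]. These tend to [Srow d] and are dominated by [b d], so [tannery] applies. *)
Lemma csum_swap (a : nat -> nat -> R[i]) (b : nat -> R)
    (Srow Scol : nat -> R[i]) (s : R[i]) :
  (forall d, csum (a d) (Srow d)) -> (forall n, csum (a^~ n) (Scol n)) ->
  csum Srow s ->
  (forall d M, cabs (series (a d) M) <= b d) -> cvgn (series b) ->
  csum Scol s.
Proof.
move=> hrow hcol hs hb cb.
apply: (@tannery (fun M d => series (a d) M) Srow b (series Scol)) => //.
move=> M; rewrite [X in csum _ X]/series /=.
apply: (@eq_csum (fun d => \sum_(n <- index_iota 0 M) a d n)) => //.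
exact: csum_big.
Qed.

End ComplexSeries.

(** * The function q = e^(2 pi i z) and the size of 1 - q near z = 0 *)

Section ComplexExponential.
Context {R : realType}.
Implicit Types (x y z w : R[i]).

Lemma cexpD x y : cexp (x + y) = cexp x * cexp y :> R[i].
Proof.
case: x y => [a b] [c d]; rewrite /cexp /= expRD cosD sinD.
by apply/eqP; rewrite eq_complex /=; apply/andP; split; apply/eqP; ring.
Qed.

Lemma cexp0 : cexp 0 = 1 :> R[i].
Proof.
rewrite /cexp /= expR0 cos0 sin0.
by apply/eqP; rewrite eq_complex /=; apply/andP; split; apply/eqP; ring.
Qed.

Lemma cabs_cexp z : cabs (cexp z) = expR (complex.Re z).
Proof.
rewrite cabsM cabs_real ger0_norm ?expR_ge0// [cabs _]cabs_def /=.
by rewrite cos2Dsin2 sqrtr1 mulr1.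
Qed.

Lemma nomeD x y : nome (x + y) = nome x * nome y :> R[i].
Proof. by rewrite /nome mulrDr cexpD. Qed.

Lemma nome0 : nome 0 = 1 :> R[i].
Proof. by rewrite /nome mulr0 cexp0. Qed.

Lemma nome_real (t : R) :
  nome ((t%:C)%C) = (cos (2 * pi * t) +i* sin (2 * pi * t))%C.
Proof.
rewrite /nome /cexp /=; apply/eqP; rewrite eq_complex /=.
by apply/andP; split; apply/eqP; rewrite !(mul0r, mulr0, subr0, addr0, oppr0, mulr1, add0r, expR0, mul1r).
Qed.

Lemma nomeE (a b : R) : nome (a +i* b)%C =
  ((expR (- (2 * pi * b)) * cos (2 * pi * a)) +i*
   (expR (- (2 * pi * b)) * sin (2 * pi * a)))%C.
Proof.
rewrite /nome (_ : _ * _ = ((- (2 * pi * b)) +i* (2 * pi * a))%C).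
  by rewrite /cexp; apply/eqP; rewrite eq_complex /=; apply/andP; split; apply/eqP; ring.
by apply/eqP; rewrite eq_complex /=; apply/andP; split; apply/eqP; ring.
Qed.

Lemma nome1 : nome 1 = 1 :> R[i].
Proof.
have := nome_real 1; rewrite (_ : (1%:C)%C = 1)// => ->.
by rewrite mulr1 [2 * _]mulr_natl cos2pi sin2pi.
Qed.

Lemma nomeMn n z : nome (n%:R * z) = nome z ^+ n.
Proof.
elim: n => [|n IH]; first by rewrite mul0r nome0.
by rewrite -natr1 mulrDl mul1r nomeD IH exprSr.
Qed.

Lemma nome_nat n : nome n%:R = 1 :> R[i].
Proof. by rewrite -[n%:R]mulr1 nomeMn nome1 expr1n. Qed.

Lemma nomeN_nat n : nome (- n%:R) = 1 :> R[i].
Proof. by rewrite -[LHS]mul1r -{1}(nome_nat n) -nomeD subrr nome0. Qed.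

Lemma nome_int (n : int) : nome n%:~R = 1 :> R[i].
Proof. by case: n => n; rewrite ?NegzE ?mulrNz ?nomeN_nat// nome_nat. Qed.

Lemma cabs_nome z : cabs (nome z) = expR (- (2 * pi * complex.Im z)).
Proof.
by rewrite cabs_cexp; case: z => a b /=; congr expR; ring.
Qed.

Lemma nome_neq0 z : nome z != 0.
Proof. by rewrite -cabs_gt0 cabs_nome expR_gt0. Qed.

Lemma cabs_nome_lt1 z : upper_half_plane z -> cabs (nome z) < 1.
Proof.
move=> z0; rewrite cabs_nome expR_lt1 oppr_lt0.
by rewrite mulr_gt0// mulr_gt0// pi_gt0.
Qed.

Lemma nome_upper_neq1 z : upper_half_plane z -> nome z != 1.
Proof.
by move=> /cabs_nome_lt1; apply: contraTneq => ->; rewrite cabs1 ltxx.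
Qed.

Lemma is_derive_seq (phi : R -> R) (d : R) : is_derive (0 : R) 1 phi d ->
  (fun M : nat => M.+1%:R * (phi (M.+1%:R^-1) - phi 0)) @ \oo --> d.
Proof.
move=> hd; have := @ex_derive _ _ _ _ _ _ _ hd.
rewrite /derivable => h.
have {h} : h^-1 *: (phi (h *: 1 + 0) - phi 0) @[h --> (0 : R)^'] --> d.
  by rewrite -(@derive_val _ _ _ _ _ _ _ hd).
move=> h.
have hM : (fun M : nat => (M.+1%:R : R)^-1) @ \oo --> (0 : R)^'.
  move=> A [e /= e0 hA].
  have /cvgrPdist_lt/(_ _ e0) := @cvg_harmonic R.
  apply: filterS => n /= hn; apply: hA => //=.
have := cvg_comp _ _ hM h; apply: cvg_trans; apply: near_eq_cvg.
by apply: nearW => n /=; rewrite addr0 invrK /GRing.scale /= mulr1.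
Qed.

(** The derivative at t = 0 of e^(2 pi i w t), sampled at t = 1/(M + 1) and computed on real and
    imaginary parts. It turns the pole of 1/(1 - q)^(s+1) into a power of w when [cotsum] is
    rescaled. *)
Lemma ccvg_nome_slope w :
  ccvg (fun M : nat => M.+1%:R * (1 - nome (w / M.+1%:R)))
       (- ((2 * pi)%:C%C * 'i%C * w)).
Proof.
pose a : R := - (2 * pi * complex.Im w); pose b : R := 2 * pi * complex.Re w.
have -> : - ((2 * pi)%:C%C * 'i%C * w) = ((- a) +i* (- b))%C.
  rewrite /a /b; case: w a b => x y a b /=; apply/eqP; rewrite eq_complex /=.
  by apply/andP; split; apply/eqP; ring.
have E M : M.+1%:R * (1 - nome (w / M.+1%:R)) =
   ((- (M.+1%:R * (expR (a * M.+1%:R^-1) * cos (b * M.+1%:R^-1) -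
       expR (a * 0) * cos (b * 0)))) +i*
    (- (M.+1%:R * (expR (a * M.+1%:R^-1) * sin (b * M.+1%:R^-1) -
       expR (a * 0) * sin (b * 0)))))%C :> R[i].
  have -> : (M.+1%:R : R[i])^-1 = ((M.+1%:R^-1 : R)%:C)%C.
    by rewrite fmorphV rmorph_nat.
  rewrite -(rmorph_nat (real_complex R)) !mulr0 expR0 cos0 sin0.
  have -> : nome (w * ((M.+1%:R^-1 : R)%:C)%C) =
      cexp ((a * M.+1%:R^-1) +i* (b * M.+1%:R^-1))%C.
    rewrite /nome /a /b; case: w a b => x y a b; congr cexp.
    by apply/eqP; rewrite eq_complex /=; apply/andP; split; apply/eqP; ring.
  rewrite /cexp /=.
  by apply/eqP; rewrite eq_complex /=; apply/andP; split; apply/eqP; ring.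
have -> : (fun M : nat => M.+1%:R * (1 - nome (w / M.+1%:R))) = _ :=
   funext E.
apply: ccvg_ReIm => /=; apply: cvgN.
  apply: (@is_derive_seq (fun t => expR (a * t) * cos (b * t))).
  apply: is_derive_eq; rewrite !(mulr0, expR0, cos0, sin0, mul1r, mulr1).
  by rewrite /GRing.scale /= !(mulr0, oppr0, mul0r, mulr1, mul1r, add0r, addr0).
apply: (@is_derive_seq (fun t => expR (a * t) * sin (b * t))).
apply: is_derive_eq; rewrite !(mulr0, expR0, cos0, sin0, mul1r, mulr1).
by rewrite /GRing.scale /= !(mulr0, oppr0, mul0r, mulr1, mul1r, add0r, addr0).
Qed.

Lemma ccvg_nome_div w : ccvg (fun M : nat => nome (w / M.+1%:R)) 1.
Proof.
have h : ccvg (fun M : nat => 1 - ((M.+1%:R^-1 : R)%:C)%C * (M.+1%:R * (1 - nome (w / M.+1%:R))))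
   (1 - ((0 : R)%:C)%C * (- ((2 * pi)%:C%C * 'i%C * w))).
  apply: ccvgB; first exact: ccvg_cst.
  apply: ccvgM; last exact: ccvg_nome_slope.
  by apply: ccvg_real; exact: cvg_harmonic.
move: h; rewrite mul0r subr0; congr ccvg; apply/funext => M.
rewrite fmorphV rmorph_nat mulrA mulVf ?pnatr_eq0// mul1r.
by rewrite opprB addrC subrK.
Qed.

Lemma sin_ge_mulcos (u : R) : 0 <= u -> u <= pi -> u * cos u <= sin u.
Proof.
rewrite le_eqVlt => /predU1P[<- _|u0 upi]; first by rewrite mul0r sin0.
have [|c /= cu] := @MVT R sin cos 0 u u0 (fun t _ => is_derive_sin t).
  by apply: continuous_subspaceT; exact: continuous_sin.
rewrite sin0 !subr0 => ->; rewrite mulrC ler_pM2r//.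
move: cu; rewrite in_itv /= => /andP[c0 cu].
by rewrite ltW// ltr_cos// in_itv /= ?(ltW u0)// (ltW c0)/= (le_trans (ltW cu)).
Qed.

(* On the strip |x| <= 3/4 the only zero of 1 - e^(2 pi i x) is x = 0. *)
Lemma sqr_sin_pi_ge (x : R) : `|x| <= 3 / 4 ->
  (pi * x * cos (3 * pi / 8) ^+ 2) ^+ 2 <= sin (pi * x) ^+ 2.
Proof.
wlog x0 : x / 0 <= x => [h hx|].
  have [/h|x0] := leP 0 x; first exact.
  have := h (- x); rewrite normrN oppr_ge0 => /(_ (ltW x0) hx).
  by rewrite mulrN sinN mulNr !sqrrN.
rewrite ger0_norm// => hx.
have pi0 := @pi_gt0 R.
set c := cos (3 * pi / 8).
have c0 : 0 < c by rewrite cos_gt0_pihalf//; apply/andP; split; lra.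
have hc : c <= cos (pi * x / 2).
  move: hx; rewrite le_eqVlt => /predU1P[->|hx].
    by rewrite (_ : pi * (3 / 4) / 2 = 3 * pi / 8)//; lra.
  rewrite ltW// ltr_cos.
  - by nra.
  - by rewrite in_itv /=; apply/andP; split; nra.
  - by rewrite in_itv /=; apply/andP; split; nra.
have hs : pi * x / 2 * cos (pi * x / 2) <= sin (pi * x / 2).
  by apply: sin_ge_mulcos; nra.
(* The angle is halved because [u * cos u] is negative for u between pi/2 and 3 pi/4, whereas
   [pi * x / 2] stays below [3 * pi / 8], where the cosine is at least [c]. *)
have -> : pi * x = (pi * x / 2) *+ 2 by rewrite mulr2n; lra.
rewrite sin_mulr2n; move: hs hc.
set s := sin _; set k := cos (pi * x / 2); set t := pi * x / 2 => hs hc.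
have t0 : 0 <= t by rewrite /t; nra.
rewrite ler_pXn2r// ?nnegrE.
- apply: (@le_trans _ _ (t *+ 2 * k ^+ 2)).
    by rewrite ler_wpM2l ?mulrn_wge0// ler_pXn2r ?nnegrE// ltW// (lt_le_trans c0).
  have : t * k * k <= s * k by rewrite ler_wpM2r// ltW// (lt_le_trans c0).
  by rewrite expr2 !mulr2n mulrA; lra.
- by rewrite mulr_ge0 ?mulrn_wge0// sqr_ge0.
- rewrite mulrn_wge0// mulr_ge0//; first by rewrite ltW// (lt_le_trans c0).
  by apply: le_trans hs; rewrite mulr_ge0// ltW// (lt_le_trans c0).
Qed.

(** With r = |q|, the square of |1 - q| is (1 - r)^2 + 4 r sin(pi x)^2; the first term controls y
    and the second x. The width 3/4 suits (z + n)/(2K + 1) with |n| <= K and 2 |Re z| <= K, as 3K/2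
    <= 3/4 (2K + 1). *)
Lemma cabs_1Bnome_ge (Y : R) : exists2 c : R, 0 < c &
  forall w, upper_half_plane w -> complex.Im w <= Y ->
    `|complex.Re w| <= 3 / 4 -> c * cabs w <= cabs (1 - nome w).
Proof.
have pi0 := @pi_gt0 R.
set c0 := cos (3 * pi / 8 : R).
have c00 : 0 < c0 by rewrite cos_gt0_pihalf//; apply/andP; split; lra.
have c01 : c0 <= 1 by exact: cos_le1.
pose rho := expR (- (2 * pi * `|Y|)).
have rho0 : 0 < rho by rewrite expR_gt0.
have rho1 : rho <= 1 by rewrite expR_le1 oppr_le0 mulr_ge0// mulr_ge0// ltW.
have C0 : 0 < 2 * pi * rho * c0 ^+ 2 by rewrite mulr_gt0 ?exprn_gt0// !mulr_gt0.
exists (2 * pi * rho * c0 ^+ 2) => //.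
case=> x y; rewrite /upper_half_plane /= => y0 yY hx.
rewrite -(ler_pXn2r (n := 2))// ?nnegrE ?cabs_ge0//; last first.
  by rewrite mulr_ge0 ?cabs_ge0// ltW.
rewrite exprMn nomeE !cabs_def !sqr_sqrtr ?addr_ge0 ?sqr_ge0//=.
set r := expR _; rewrite -[2 * pi * x]mulrA [2 * (pi * x)]mulr_natl.
rewrite sub0r sin_mulr2n cos_mulr2n.
have hr : rho <= r.
  by rewrite ler_expR lerN2 ler_wpM2l ?mulr_ge0 ?(ltW pi0)// (le_trans yY)// ler_norm.
have hr1 : 2 * pi * y * r <= 1 - r.
  have := expR_ge1Dx (2 * pi * y).
  have : r * expR (2 * pi * y) = 1 by rewrite /r expRN mulVf// gt_eqF// expR_gt0.
  have : 0 < r by rewrite expR_gt0.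
  set E := expR _; set v := 2 * pi * y => r0 rE hE.
  have : r * (1 + v) <= r * E by rewrite ler_pM2l.
  lra.
have := sqr_sin_pi_ge hx; rewrite -/c0.
have := cos2Dsin2 (pi * x); set C := cos _; set S := sin _ => CS hS.
have -> : (1 - r * (C ^+ 2 *+ 2 - 1)) ^+ 2 + (- (r * ((C * S) *+ 2))) ^+ 2 =
   (1 - r) ^+ 2 + 4 * r * S ^+ 2.
  have -> : C ^+ 2 = 1 - S ^+ 2 by rewrite -CS addrK.
  rewrite sqrrN exprMn -[(C * S) *+ 2]mulr_natl !exprMn.
  have -> : C ^+ 2 = 1 - S ^+ 2 by rewrite -CS addrK.
  ring.
have hy : (2 * pi * y * rho) ^+ 2 <= (1 - r) ^+ 2.
  rewrite ler_pXn2r ?nnegrE// ?mulr_ge0 ?(ltW pi0) ?(ltW y0) ?(ltW rho0)//.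
    apply: le_trans hr1.
    by rewrite ler_wpM2l// ?mulr_ge0 ?(ltW pi0) ?(ltW y0).
  by apply: le_trans hr1; rewrite ?mulr_ge0 ?(ltW pi0) ?(ltW y0) ?expR_ge0.
have c4 : (c0 ^+ 2) ^+ 2 <= 1 by rewrite -exprM exprn_ile1// ltW.
have hyc : (2 * pi * rho * c0 ^+ 2) ^+ 2 * y ^+ 2 <= (1 - r) ^+ 2.
  apply: le_trans hy.
  have -> : (2 * pi * rho * c0 ^+ 2) ^+ 2 * y ^+ 2 = (2 * pi * y * rho) ^+ 2 * (c0 ^+ 2) ^+ 2 by ring.
  by rewrite ler_piMr// sqr_ge0.
have hxc : (2 * pi * rho * c0 ^+ 2) ^+ 2 * x ^+ 2 <= 4 * r * S ^+ 2.
  have -> : (2 * pi * rho * c0 ^+ 2) ^+ 2 * x ^+ 2 =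
     4 * rho ^+ 2 * (pi * x * c0 ^+ 2) ^+ 2 by ring.
  have hr2 : rho ^+ 2 <= r by rewrite expr2 (le_trans _ hr)// ler_piMr// ltW.
  have h4 : 4 * rho ^+ 2 <= 4 * r by lra.
  by apply: ler_pM h4 hS; [rewrite mulr_ge0// sqr_ge0|exact: sqr_ge0].
by rewrite mulrDr addrC lerD.
Qed.

End ComplexExponential.

(** * The power series \sum_r r^s q^r, and roots of unity *)

Section SeriesComplements.
Context {R : realType}.
Implicit Types (a u : nat -> R[i]) (s l q z : R[i]).

Lemma ccvg_comp_oo u l (phi : nat -> nat) :
  (forall B, exists N, forall n, (N <= n)%N -> (B <= phi n)%N) ->
  ccvg u l -> ccvg (fun n => u (phi n)) l.
Proof.
move=> hphi [h]; split; apply: cvg_comp h => A [B _ hB].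
have [N hN] := hphi B; exists N => //= n /= Nn.
by apply: hB => /=; exact: hN.
Qed.

Lemma ccvg_bounded u l : ccvg u l ->
  exists2 B : R, 0 < B & forall n, cabs (u n) <= B.
Proof.
move=> /ccvg_cabsP h.
have /cvg_seq_bounded [M [_ hM]] : cvgn (fun n => cabs (l - u n)) by apply/cvg_ex; exists 0.
pose B := `|M| + 1.
have MB : M < B by rewrite /B (le_lt_trans (ler_norm _))// ltrDl.
exists (B + cabs l) => [|n].
  by rewrite ltr_pwDl ?cabs_ge0// /B ltr_wpDl.
have := hM _ MB n I; rewrite /= ger0_norm ?cabs_ge0// => h1.
have := lerB_cabs (u n) l; rewrite cabsB; lra.
Qed.

Lemma ccvg0_cabs_le u (b : nat -> R) : (forall n, cabs (u n) <= b n) ->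
  b @ \oo --> (0 : R) -> ccvg u 0.
Proof.
move=> hub hb; apply/ccvg_cabsP.
apply: (@squeeze_cvgr _ _ _ _ (fun=> 0) b); [|exact: cvg_cst|exact: hb].
by apply: nearW => n; rewrite sub0r cabsN cabs_ge0 hub.
Qed.

(** The index on the right is the ceiling of N / M, the number of multiples of M below N. *)
Lemma series_multiples (V : zmodType) (a : nat -> V) M N : (0 < M)%N ->
  (forall n, ~~ (M %| n)%N -> a n = 0) ->
  series a N = series (fun n => a (M * n)%N) ((N + M.-1) %/ M)%N.
Proof.
move=> M0 ha; elim: N => [|N IH].
  by rewrite add0n divn_small ?prednK// /series/= !big_geq.
rewrite [LHS]/series /= big_nat_recr//= -[X in X + _]/(series a N) IH.
rewrite addSn divnS// -addnS prednK// dvdn_addl//.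
have [/dvdnP[t ->]|/ha->] := boolP (M %| N)%N; last by rewrite addr0 add0n.
rewrite divnMDl// divn_small ?prednK// addn0 add1n.
by rewrite [RHS]/series/= big_nat_recr//= mulnC.
Qed.

Lemma csum_multiples a s M : (0 < M)%N ->
  (forall n, ~~ (M %| n)%N -> a n = 0) ->
  csum a s <-> csum (fun n => a (M * n)%N) s.
Proof.
move=> M0 ha; split => h.
  have := @ccvg_subseq _ _ _ (fun n => M * n)%N (fun n => leq_pmull n M0) h.
  rewrite /csum; congr ccvg; apply/funext => n; rewrite (@series_multiples _ _ M)//.
  by rewrite mulnC divnMDl// divn_small ?prednK// addn0.
have := @ccvg_comp_oo _ _ (fun N => (N + M.-1) %/ M)%N _ h.
rewrite /csum => h'; have {h'} := h' _; rewrite (_ : (fun n => _) = series a).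
  apply => B; exists (M * B)%N => n Bn; rewrite leq_divRL// mulnC.
  by rewrite (leq_trans Bn)// leq_addr.
by apply/funext => n; rewrite [RHS](@series_multiples _ _ M).
Qed.

Lemma csum_stretch a s M : (0 < M)%N -> csum a s ->
  csum (fun n => if (M %| n)%N then a (n %/ M)%N else 0) s.
Proof.
move=> M0 h; apply/(@csum_multiples _ _ M) => //.
  by move=> n /negbTE ->.
apply: eq_csum h => n; by rewrite dvdn_mulr// mulKn.
Qed.

(** After multiplication by (1 - y)^s the left side is one term of the binomial expansion of (y + (1
    - y))^(n+s) = 1. *)
Lemma bin_geometric (y : R) (n s : nat) : 0 <= y -> y < 1 ->
  'C(n + s, s)%:R * y ^+ n <= (1 - y) ^- s.
Proof.
move=> y0 y1; rewrite -[leRHS]mul1r ler_pdivlMr ?exprn_gt0 ?subr_gt0//.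
have := exprDn y (1 - y) (n + s); rewrite addrC subrK expr1n => h1.
rewrite [leRHS]h1.
have sn : (s < (n + s).+1)%N by rewrite ltnS leq_addl.
rewrite (bigD1 (Ordinal sn))//= addnK -[leLHS]addr0 lerD//.
  by rewrite -mulrA mulr_natl.
apply: sumr_ge0 => i _; rewrite mulrn_wge0// mulr_ge0// exprn_ge0//.
by rewrite subr_ge0 ltW.
Qed.

Lemma exp_le_fact_bin (n s : nat) : (n ^ s <= s`! * 'C(n + s, s))%N.
Proof.
rewrite mulnC bin_ffact; elim: s => [|s IH]; first by rewrite ffactn0.
by rewrite addnS ffactSS expnS leq_mul// -addnS leq_addr.
Qed.

(** With y the square root of x, x^n = y^n y^n: one factor absorbs n^s, the other gives the
    geometric decay. *)
Lemma pow_geometric_bound (s : nat) (x : R) : 0 <= x -> x < 1 ->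
  exists K y : R, [/\ 0 <= K, 0 <= y, y < 1 &
    forall n, n%:R ^+ s * x ^+ n <= K * y ^+ n].
Proof.
move=> x0 x1; pose y := Num.sqrt x.
have y0 : 0 <= y by exact: sqrtr_ge0.
have yy : x = y ^+ 2 by rewrite sqr_sqrtr.
have y1 : y < 1.
  by rewrite -(ltr_pXn2r (n := 2))// ?nnegrE// -yy expr1n.
exists (s`!%:R * (1 - y) ^- s), y; split => //.
  by rewrite mulr_ge0// invr_ge0 exprn_ge0// subr_ge0 ltW.
move=> n; rewrite yy -exprM mulnC exprM expr2 mulrA.
rewrite ler_wpM2r ?exprn_ge0//.
apply: (@le_trans _ _ (s`!%:R * ('C(n + s, s)%:R * y ^+ n))).
  rewrite mulrA ler_wpM2r ?exprn_ge0// -natrX -natrM ler_nat.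
  exact: exp_le_fact_bin.
by rewrite ler_wpM2l// bin_geometric.
Qed.

Lemma is_cvg_series_pow_geometric (s : nat) (x : R) : 0 <= x -> x < 1 ->
  cvgn (series (fun n => n%:R ^+ s * x ^+ n)).
Proof.
move=> x0 x1; have [K [y [K0 y0 y1 h]]] := pow_geometric_bound s x0 x1.
apply: (@series_le_cvg _ _ (geometric K y)) => //= [n|n|].
- by rewrite mulr_ge0 ?exprn_ge0.
- by rewrite mulr_ge0 ?exprn_ge0.
- by apply: is_cvg_geometric_series; rewrite ger0_norm.
Qed.

(** By Pascal's rule, multiplying a partial sum for j + 1 by 1 - q gives the partial sum for j minus
    the boundary term ['C(N + j, j.+1)%:R * q ^+ N], which tends to 0. *)
Lemma csum_bin_geometric q j : cabs q < 1 ->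
  csum (fun r => 'C(r + j, j)%:R * q ^+ r) ((1 - q) ^- j.+1).
Proof.
move=> q1.
have q1' : 1 - q != 0.
  by rewrite subr_eq0; apply: contraTneq q1 => <-; rewrite cabs1 ltxx.
have key (i : nat) : ccvg (fun N => 'C(N + i, i)%:R * q ^+ N) 0.
  pose y := Num.sqrt (cabs q).
  have y0 : 0 <= y by exact: sqrtr_ge0.
  have yy : cabs q = y ^+ 2 by rewrite sqr_sqrtr// cabs_ge0.
  have y1 : y < 1.
    by rewrite -(ltr_pXn2r (n := 2))// ?nnegrE// -yy expr1n.
  apply: (@ccvg0_cabs_le _ (geometric ((1 - y) ^- i) y)) => [n|]; last first.
    by apply: cvg_geometric; rewrite ger0_norm.
  rewrite cabsM cabs_nat cabsX yy -exprM mulnC exprM expr2 mulrA /=.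
  by rewrite ler_wpM2r ?exprn_ge0// bin_geometric.
elim: j => [|j IH].
  have h : ccvg (fun N => (1 - q)^-1 * (1 - 'C(N + 0, 0)%:R * q ^+ N))
      ((1 - q)^-1 * (1 - 0)).
    by apply: ccvgM; [exact: ccvg_cst|apply: ccvgB => //; exact: ccvg_cst].
  move: h; rewrite subr0 mulr1 expr1; congr ccvg; apply/funext => N.
  apply: (mulfI q1'); rewrite mulrA divff// mul1r bin0 mul1r.
  rewrite /series/= big_mkord -[LHS]opprB subrX1 -mulNr opprB; congr (_ * _).
  by apply: eq_bigr => i _; rewrite bin0 mul1r.
have h : ccvg (fun N => (1 - q)^-1 * (series (fun r => 'C(r + j, j)%:R * q ^+ r) N -
      'C(N + j, j.+1)%:R * q ^+ N)) ((1 - q)^-1 * ((1 - q) ^- j.+1 - 0)).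
  apply: ccvgM; first exact: ccvg_cst.
  apply: ccvgB => //; apply/ccvg_shiftS.
  have h1 : ccvg (fun N => q * ('C(N + j.+1, j.+1)%:R * q ^+ N)) (q * 0).
    by apply: ccvgM => //; exact: ccvg_cst.
  move: h1; rewrite mulr0; congr ccvg; apply/funext => N.
  by rewrite addSnnS exprS mulrCA.
move: h; rewrite subr0 -invfM -exprS; congr ccvg; apply/funext => N.
apply: (mulfI q1'); rewrite mulrA divff// mul1r.
elim: N => [|N IHN].
  by rewrite /series/= !big_geq// mulr0 add0n bin_small// mul0r subr0.
have e1 : 'C(N.+1 + j, j.+1) = ('C(N + j, j.+1) + 'C(N + j, j))%N.
  by rewrite addSn binS.
have e2 : 'C(N + j.+1, j.+1) = ('C(N + j, j.+1) + 'C(N + j, j))%N.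
  by rewrite addnS binS.
move: IHN; rewrite /series/= !big_nat_recr//= e1 e2 mulrDr => <-.
by rewrite natrD exprS; ring.
Qed.

(** The coefficients obey the recursion coming from r C(r+j, j) = (j+1) C(r+j+1, j+1) - (j+1) C(r+j,
    j). *)
Lemma expn_bin_basis (s : nat) : exists2 a : nat -> R[i], a s = s`!%:R &
  forall r : nat, r%:R ^+ s = \sum_(0 <= j < s.+1) a j * 'C(r + j, j)%:R.
Proof.
elim: s => [|s [a as_ ha]].
  by exists (fun=> 1) => // r; rewrite big_nat1 bin0 mulr1.
exists (fun j => (if j is j'.+1 then j%:R * a j' else 0) -
                 (if (j <= s)%N then j.+1%:R * a j else 0)).
  by rewrite ltnn subr0 as_ factS natrM.
move=> r; rewrite exprS ha mulr_sumr.
under [RHS]eq_bigr do rewrite mulrBl.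
rewrite sumrB [X in X - _]big_nat_recl//=.
rewrite [X in _ - X]big_nat_recr//= ltnn !mul0r add0r addr0.
rewrite -sumrB !big_nat; apply: eq_bigr => j /=; rewrite ltnS => ->.
have h : (j.+1 * 'C(r + j.+1, j.+1) = (r + j.+1) * 'C(r + j, j))%N.
  by rewrite -mul_bin_diag addnS.
have {}h : j.+1%:R * 'C(r + j.+1, j.+1)%:R = (r%:R + j.+1%:R) * 'C(r + j, j)%:R :> R[i].
  by rewrite -natrD -!natrM h.
rewrite mulrAC h; ring.
Qed.

(** The polylogarithm of order -s; for s = 0 the term r = 0 adds 1, as [0 ^+ 0 = 1]. *)
Definition powsum (s : nat) (q : R[i]) : R[i] :=
  limn (series (fun r : nat => r%:R ^+ s * q ^+ r) : nat -> R[i]^o).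

Lemma csum_powsum (s : nat) q : cabs q < 1 ->
  csum (fun r : nat => r%:R ^+ s * q ^+ r) (powsum s q).
Proof.
move=> q1; have [|t ht] := @csum_abs_cvg R (fun r : nat => r%:R ^+ s * q ^+ r) _ _
   (@is_cvg_series_pow_geometric s _ (cabs_ge0 q) q1).
  by move=> n; rewrite cabsM !cabsX cabs_nat.
by rewrite /powsum (csum_lim ht).
Qed.

(** The point is the pole at q = 1: it has order s + 1 and leading coefficient s!, the value of P at
    0. *)
Lemma powsum_rational (s : nat) : exists2 P : {poly R[i]}, P.[0] = s`!%:R &
  forall q, cabs q < 1 -> powsum s q = P.[1 - q] / (1 - q) ^+ s.+1.
Proof.
have [a as_ ha] := expn_bin_basis s.
exists (\sum_(0 <= j < s.+1) a j *: 'X^(s - j)) => [|q q1].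
  rewrite horner_sum big_nat_recr//= hornerZ hornerXn subnn expr0 mulr1 as_.
  rewrite big_nat big1 ?add0r// => j js; rewrite hornerZ hornerXn.
  by rewrite expr0n subn_eq0 leqNgt (andP js).2 mulr0.
have q1' : 1 - q != 0.
  by rewrite subr_eq0; apply: contraTneq q1 => <-; rewrite cabs1 ltxx.
apply: (csum_unique (csum_powsum s q1)).
have : csum (fun r : nat => \sum_(j <- index_iota 0 s.+1) a j * ('C(r + j, j)%:R * q ^+ r))
    (\sum_(j <- index_iota 0 s.+1) a j * (1 - q) ^- j.+1).
  by apply: csum_big => j _; apply: csumZ; exact: csum_bin_geometric.
have -> : \sum_(0 <= j < s.+1) a j * (1 - q) ^- j.+1 =
    (\sum_(0 <= j < s.+1) a j *: 'X^(s - j)).[1 - q] / (1 - q) ^+ s.+1.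
  rewrite horner_sum mulr_suml !big_nat; apply: eq_bigr => j; rewrite ltnS => /= js.
  rewrite hornerZ hornerXn -mulrA; congr (_ * _).
  rewrite -[in RHS](subnK (js : (j <= s)%N)) -addnS exprD invfM mulrA subnK//.
  by rewrite divff ?mul1r// expf_neq0.
apply: eq_csum => r; rewrite ha mulr_suml; apply: eq_bigr => j _.
by rewrite mulrA.
Qed.

Lemma ccvg_horner (P : {poly R[i]}) u l : ccvg u l ->
  ccvg (fun n => P.[u n]) P.[l].
Proof.
move=> h; rewrite horner_coef (_ : (fun n => _) =
   fun n => \sum_(i < size P) P`_i * u n ^+ i); last first.
  by apply/funext => n; rewrite horner_coef.
apply: ccvg_sum => i; apply: ccvgM; [exact: ccvg_cst|exact: ccvgX].
Qed.

Lemma cabs_horner_bounded (P : {poly R[i]}) (B : R) : exists2 C : R, 0 < C &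
  forall x, cabs x <= B -> cabs P.[x] <= C.
Proof.
exists (\sum_(0 <= i < size P) cabs P`_i * `|B| ^+ i + 1).
  by rewrite ltr_wpDl// sumr_ge0// => i _; rewrite mulr_ge0 ?cabs_ge0// exprn_ge0.
move=> x xB; rewrite horner_coef -(big_mkord xpredT (fun i => P`_i * x ^+ i)).
apply: (le_trans (ler_cabs_sum _ _)); rewrite -[leLHS]addr0 lerD//.
apply: ler_sum => i _; rewrite cabsM cabsX ler_wpM2l ?cabs_ge0//.
by rewrite lerXn2r ?nnegrE ?cabs_ge0// (le_trans xB)// ler_norm.
Qed.

Lemma nome_real_neq1 (t : R) : 0 < t -> t < 1 -> nome ((t%:C)%C) != 1.
Proof.
move=> t0 t1; rewrite nome_real; apply/eqP => -[+ _].
rewrite -[2 * pi * t]mulrA [2 * (pi * t)]mulr_natl cos_mulr2n cos2sin2.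
have : 0 < sin (pi * t).
  apply: sin_gt0_pi; rewrite mulr_gt0 ?pi_gt0//=.
  by rewrite -[ltRHS]mulr1 ltr_pM2l// pi_gt0.
by set S := sin _ => S0; rewrite mulr2n; have := exprn_gt0 2 S0; lra.
Qed.

Lemma nome_frac_eq1 (n d : nat) : (0 < d)%N ->
  (nome (n%:R / d%:R) == 1 :> R[i]) = (d %| n)%N.
Proof.
move=> d0; have d0' : d%:R != 0 :> R[i] by rewrite pnatr_eq0 -lt0n.
rewrite {1}(divn_eq n d) natrD natrM mulrDl mulfK// nomeD nome_nat mul1r.
rewrite /dvdn; case: posnP => [->|h]; first by rewrite mul0r nome0 eqxx.
apply/negbTE.
have -> : (n %% d)%:R / d%:R = (((n %% d)%:R / d%:R : R)%:C)%C.
  by rewrite rmorphM fmorphV !rmorph_nat.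
apply: nome_real_neq1; first by rewrite divr_gt0// ltr0n.
by rewrite ltr_pdivrMr ?ltr0n// mul1r ltr_nat ltn_mod.
Qed.

(** Residues run over the symmetric range from -K to K, so that n and -n can be paired in the
    limit. *)
Lemma sum_roots_of_unity (K r : nat) : let M := K.*2.+1 in
  \sum_(j < M) nome ((j%:R - K%:R) / M%:R) ^+ r =
  (if (M %| r)%N then M%:R else 0) :> R[i].
Proof.
move=> M; have M0 : M%:R != 0 :> R[i] by rewrite pnatr_eq0.
have E j : nome ((j%:R - K%:R) / M%:R) ^+ r =
    nome (- (K%:R * r%:R / M%:R)) * nome (r%:R / M%:R) ^+ j :> R[i].
  rewrite -!nomeMn -nomeD; congr nome; ring.
case: ifPn => [Mr|Mr].
  rewrite (eq_bigr (fun=> 1)) ?sumr_const ?card_ord// => j _.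
  have /dvdnP[t ->] := Mr.
  rewrite -nomeMn natrM (_ : _ * (_ / _) = (t * j)%:R - (t * K)%:R); last first.
    by rewrite !natrM; field.
  by rewrite nomeD nome_nat nomeN_nat mulr1.
under eq_bigr do rewrite E.
rewrite -mulr_sumr.
have : nome (r%:R / M%:R) ^+ M - 1 = 0 :> R[i].
  by rewrite -nomeMn mulrC divfK// nome_nat subrr.
rewrite subrX1 => /eqP; rewrite mulf_eq0 subr_eq0 nome_frac_eq1// (negbTE Mr) /=.
by move=> /eqP ->; rewrite mulr0.
Qed.

Lemma upperD_int z (n : int) : upper_half_plane z -> upper_half_plane (z + n%:~R).
Proof.
rewrite /upper_half_plane /= raddfD /= -(rmorph_int (real_complex R)) /=.
by rewrite addr0.
Qed.

Lemma upper_real_scale z (t : R) : 0 < t -> upper_half_plane z ->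
  upper_half_plane (z * (t%:C)%C).
Proof. by case: z => a b t0; rewrite /upper_half_plane /= mulr0 add0r => b0; rewrite mulr_gt0. Qed.

Lemma upper_divn z (n : nat) : (0 < n)%N -> upper_half_plane z ->
  upper_half_plane (z / n%:R).
Proof.
move=> n0; rewrite -(rmorph_nat (real_complex R)) -fmorphV.
by apply: upper_real_scale; rewrite invr_gt0 ltr0n.
Qed.

Lemma upper_mulnl z (n : nat) : (0 < n)%N -> upper_half_plane z ->
  upper_half_plane (n%:R * z).
Proof.
move=> n0; rewrite mulrC -(rmorph_nat (real_complex R)).
by apply: upper_real_scale; rewrite ltr0n.
Qed.

Lemma upper_neq0 z : upper_half_plane z -> z != 0.
Proof. by apply: contraTneq => ->; rewrite /upper_half_plane /= ltxx. Qed.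

End SeriesComplements.

(** * Lipschitz' formula by the distribution relation *)

Section Lipschitz.
Context {R : realType}.
Implicit Types (x w z : R[i]) (s : nat).

Lemma is_cvg_series_inv_sqr : cvgn (series (fun j : nat => (j.+1%:R ^- 2 : R))).
Proof.
have h0 n : 0 < n.+1%:R :> R by rewrite ltr0n.
apply: nondecreasing_is_cvgn.
  by apply/nondecreasing_seqP => n; rewrite /series/= big_nat_recr//= lerDl invr_ge0 sqr_ge0.
exists 2 => _ [n _ <-].
suff : series (fun j : nat => (j.+1%:R ^- 2 : R)) n <= 2 - 2 / n.+1%:R.
  have : 0 < 2 / n.+1%:R :> R by rewrite divr_gt0.
  by set t := 2 / _; lra.
elim: n => [|n IH]; first by rewrite /series/= big_geq// divr1 subrr.
rewrite /series/= big_nat_recr//= -[X in X + _]/(series _ n).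
have h : n.+1%:R ^- 2 <= 2 / n.+1%:R - 2 / n.+2%:R :> R.
  rewrite -(subr_ge0 (_ ^- 2)).
  have -> : 2 / n.+1%:R - 2 / n.+2%:R - n.+1%:R ^- 2 =
      n%:R / (n.+1%:R ^+ 2 * n.+2%:R) :> R.
    have := h0 n; have := h0 n.+1; rewrite -![n.+2%:R]natr1 -![n.+1%:R]natr1 => h1 h2.
    by field; apply/andP; split; rewrite gt_eqF.
  by rewrite divr_ge0// mulr_ge0// sqr_ge0.
by apply: le_trans (lerD IH h) _; rewrite addrA subrK.
Qed.

Lemma is_cvg_series_cmul_inv_sqr (c : R) :
  cvgn (series (fun j : nat => c * (j.+1%:R ^- 2))).
Proof. by apply: is_cvg_seriesZ; exact: is_cvg_series_inv_sqr. Qed.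

(** The imaginary part of a z + b controls |a|, and then |b| <= |a z + b| + |a| |z| controls |b|. *)
Lemma cabs_lattice_ge z : upper_half_plane z -> exists2 c : R, 0 < c &
  forall a b : R, c * (`|a| + `|b|) <= cabs ((a%:C)%C * z + (b%:C)%C).
Proof.
rewrite /upper_half_plane /= => z0.
pose d := 1 + (cabs z + 1) / complex.Im z.
have d0 : 0 < d.
  by rewrite /d addr_gt0// divr_gt0// ltr_wpDl// cabs_ge0.
exists d^-1; first by rewrite invr_gt0.
move=> a b; rewrite mulrC ler_pdivrMr//.
set t := cabs (_ + _).
have h1 : `|a| * complex.Im z <= t.
  apply: le_trans (ler_Im_cabs _); rewrite raddfD /= addr0.
  by case: z z0 {d d0 t} => x y /= y0; rewrite mul0r addr0 normrM (gtr0_norm y0).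
have h2 : `|b| - `|a| * cabs z <= t.
  have := lerB_cabs (b%:C)%C (- ((a%:C)%C * z)).
  by rewrite opprK cabsN cabsM !cabs_real addrC [_%:C%C + _]addrC; rewrite addrC.
have h3 : `|a| * (cabs z + 1) <= t * ((cabs z + 1) / complex.Im z).
  by rewrite mulrA ler_pdivlMr// mulrAC ler_wpM2r// addr_ge0// cabs_ge0.
by rewrite /d mulrDr mulr1; lra.
Qed.

Definition twopii : R[i] := (2 * pi)%:C%C * 'i%C.

Lemma twopii_neq0 : twopii != 0.
Proof.
rewrite mulf_neq0//; last by rewrite eq_complex /= oner_eq0 andbF.
by rewrite eq_complex /= eqxx andbT mulf_neq0// gt_eqF// pi_gt0.
Qed.

(** On the upper half-plane this is (i/2) cot(pi z) for s = 0, the shift by 1/2 making it odd, and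
    its s-th derivative under (2 pi i)^-1 d/dz in general. *)
Definition cotsum s z : R[i] := powsum s (nome z) - (s == 0%N)%:R / 2.

(** The polar part of [cotsum s] at 0, and after translation at every integer. *)
Definition pole s x : R[i] := s`!%:R / (- (twopii * x)) ^+ s.+1.

(** Summing over the M translates keeps only the exponents r = M t, where r^s supplies M^s and the
    sum of roots of unity one more M. For s = 0 the constant 1/2 occurs M times and is divided by
    M. *)
Lemma cotsum_distribution s z K : upper_half_plane z ->
  cotsum s z = (K.*2.+1)%:R ^- s.+1 *
    \sum_(j < K.*2.+1) cotsum s ((z + (j%:R - K%:R)) / (K.*2.+1)%:R).
Proof.
move=> z0; set M := K.*2.+1.
have M0 : M%:R != 0 :> R[i] by rewrite pnatr_eq0.
pose w (j : nat) := (z + (j%:R - K%:R)) / M%:R.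
have w0 j : upper_half_plane (w j).
  apply: upper_divn => //.
  have -> : j%:R - K%:R = (j%:Z - K%:Z)%:~R :> R[i] by rewrite rmorphB.
  exact: upperD_int.
have Hsum : csum (fun r : nat => \sum_(j <- index_iota 0 M) r%:R ^+ s * nome (w j) ^+ r)
    (\sum_(j <- index_iota 0 M) powsum s (nome (w j))).
  by apply: csum_big => j _; apply: csum_powsum; exact: cabs_nome_lt1.
have E r : \sum_(j <- index_iota 0 M) r%:R ^+ s * nome (w j) ^+ r =
    r%:R ^+ s * nome (z / M%:R) ^+ r * (if (M %| r)%N then M%:R else 0).
  rewrite -sum_roots_of_unity mulr_sumr big_mkord; apply: eq_bigr => j _.
  by rewrite -mulrA -exprMn -nomeD /w mulrDl.
have {}Hsum := eq_csum E Hsum.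
have {}Hsum : csum (fun r => M%:R ^+ s.+1 * (r%:R ^+ s * nome z ^+ r))
    (\sum_(j <- index_iota 0 M) powsum s (nome (w j))).
  have /(@csum_multiples _ _ _ M isT) := Hsum.
  move=> /(_ _)/[dup] h _; apply: eq_csum (h _) => [r|r /negbTE ->]; last by rewrite mulr0.
  rewrite dvdn_mulr// natrM exprMn exprM -nomeMn mulrC [M%:R * _]mulrC divfK//.
  by rewrite exprS; ring.
have {Hsum}h := csum_unique Hsum (csumZ _ (csum_powsum s (cabs_nome_lt1 z0))).
rewrite /cotsum sumrB sumr_const card_ord -(big_mkord xpredT (fun j => powsum s (nome (w j)))).
rewrite h mulrBr mulKf ?expf_neq0//; congr (_ - _).
case: s {E h} => [|s]; last by rewrite mul0r mul0rn mulr0.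
by rewrite expr1 -(mulr_natl (_ / 2)) mulKf.
Qed.

Lemma sum_symmetric (F : R[i] -> R[i]) K :
  \sum_(j < K.*2.+1) F (j%:R - K%:R) =
  F 0 + \sum_(0 <= j < K) (F j.+1%:R + F (- j.+1%:R)).
Proof.
elim: K => [|K IH]; first by rewrite big_ord1 big_geq// subrr addr0.
rewrite doubleS big_ord_recl big_ord_recr /= [in RHS]big_nat_recr//=.
rewrite [RHS]addrA -IH.
under eq_bigr => j _.
  have -> : (bump 0 j)%:R - K.+1%:R = j%:R - K%:R :> R[i].
    by rewrite /bump /= add1n -!natr1 opprD addrACA subrr addr0.
  over.
have -> : (bump 0 K.*2.+1)%:R - K.+1%:R = K.+1%:R :> R[i].
  by rewrite /bump /= add1n -addnn -!natr1 natrD; ring.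
by rewrite sub0r; ring.
Qed.

Lemma ccvg_inv_odd : ccvg (fun K => (K.*2.+1)%:R^-1) (0 : R[i]).
Proof.
have h := @ccvg_real R _ _ (@cvg_harmonic R).
have := @ccvg_subseq _ _ _ double _ h; rewrite (_ : (fun n => _) = (fun K => (K.*2.+1)%:R^-1)).
  by apply=> n; rewrite -addnn leq_addr.
by apply/funext => n /=; rewrite fmorphV rmorph_nat.
Qed.

(** In P(1 - q) / (M (1 - q))^(s+1), with M = 2K + 1, the numerator tends to P(0) = s! and M (1 - q)
    to -2 pi i x. *)
Lemma ccvg_cotsum_pole s x : upper_half_plane x ->
  ccvg (fun K => (K.*2.+1)%:R ^- s.+1 * cotsum s (x / (K.*2.+1)%:R)) (pole s x).
Proof.
move=> x0; have [P P0 hP] := @powsum_rational R s.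
have dbl n : (n <= n.*2)%N by rewrite -addnn leq_addr.
have h1 : ccvg (fun K => nome (x / (K.*2.+1)%:R)) 1.
  exact: (ccvg_subseq dbl (ccvg_nome_div x)).
have h2 : ccvg (fun K => (K.*2.+1)%:R * (1 - nome (x / (K.*2.+1)%:R))) (- (twopii * x)).
  exact: (ccvg_subseq dbl (ccvg_nome_slope x)).
have h3 : ccvg (fun K => P.[1 - nome (x / (K.*2.+1)%:R)] /
    ((K.*2.+1)%:R * (1 - nome (x / (K.*2.+1)%:R))) ^+ s.+1 -
    ((K.*2.+1)%:R^-1) ^+ s.+1 * ((s == 0%N)%:R / 2)) (P.[1 - 1] / (- (twopii * x)) ^+ s.+1 -
    0 ^+ s.+1 * ((s == 0%N)%:R / 2)).
  apply: ccvgB.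
    apply: ccvgM.
      by apply: ccvg_horner; apply: ccvgB => //; exact: ccvg_cst.
    apply: ccvgV; last exact: ccvgX.
    by rewrite expf_neq0// oppr_eq0 mulf_neq0 ?twopii_neq0// upper_neq0.
  by apply: ccvgM; [apply: ccvgX; exact: ccvg_inv_odd|exact: ccvg_cst].
move: h3; rewrite subrr P0 expr0n mul0r subr0; congr ccvg; apply/funext => K.
rewrite /cotsum hP; last by apply: cabs_nome_lt1; exact: upper_divn.
by rewrite exprMn invfM exprVn mulrBr; congr (_ - _); ring.
Qed.

Lemma cabs_1Bnome_div_ge z : upper_half_plane z -> exists2 B : R, 0 < B &
  forall (K : nat) (n : R), 2 * `|complex.Re z| <= K%:R -> `|n| <= K%:R ->
    cabs (1 - nome ((z + (n%:C)%C) / (K.*2.+1)%:R)) >=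
    B * (cabs (z + (n%:C)%C) / (K.*2.+1)%:R).
Proof.
move=> z0; have [c c0 hc] := cabs_1Bnome_ge (complex.Im z).
exists c => // K n hK hn; set M := K.*2.+1.
have M0 : 0 < M%:R :> R by rewrite ltr0n.
have -> : cabs (z + (n%:C)%C) / M%:R = cabs ((z + (n%:C)%C) / M%:R).
  by rewrite cabsM cabsV cabs_nat.
have -> : (z + (n%:C)%C) / M%:R = (((complex.Re z + n) / M%:R) +i* (complex.Im z / M%:R))%C.
  rewrite -(rmorph_nat (real_complex R)) -fmorphV; case: z {z0 hc hK} => a b.
  by apply/eqP; rewrite eq_complex /=; apply/andP; split; apply/eqP; ring.
have ME : M%:R = K%:R * 2 + 1 :> R by rewrite /M -natr1 -muln2 natrM.
have K0 : 0 <= K%:R :> R by [].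
apply: hc => /=.
- by rewrite /upper_half_plane /= divr_gt0.
- by rewrite ler_pdivrMr// ler_peMr ?(ltW z0)// ler1n.
- rewrite normrM normfV (gtr0_norm M0) ler_pdivrMr//.
  have := ler_normD (complex.Re z) n; rewrite ME; lra.
Qed.

(** The majorant needed by [tannery]. For s >= 1 each of the two terms is already O(j^-2). For s = 0
    each is only O(1/j), and the gain comes from pairing j with -j. *)
Lemma cotsum_pair_bound s z : upper_half_plane z -> exists2 B : R, 0 < B &
  forall K j : nat, 2 * `|complex.Re z| <= K%:R -> (j < K)%N ->
    cabs ((K.*2.+1)%:R ^- s.+1 * (cotsum s ((z + j.+1%:R) / (K.*2.+1)%:R) +
           cotsum s ((z - j.+1%:R) / (K.*2.+1)%:R))) <= B * j.+1%:R ^- 2.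
Proof.
move=> z0; have [c c0 hc] := cabs_1Bnome_div_ge z0.
have [d d0 hd] := cabs_lattice_ge z0.
have hdn (n : R) : d * `|n| <= cabs (z + (n%:C)%C).
  have := hd 1 n; rewrite rmorph1 mul1r normr1; apply: le_trans.
  by rewrite ler_pM2l// lerDr.
have natC (n : nat) : n%:R = ((n%:R : R)%:C)%C by rewrite rmorph_nat.
have natCN (n : nat) : - n%:R = ((- n%:R : R)%:C)%C by rewrite rmorphN rmorph_nat.
have wup (n : R) K : upper_half_plane ((z + (n%:C)%C) / (K.*2.+1)%:R).
  apply: upper_divn => //; move: z0; rewrite /upper_half_plane /=.
  by rewrite raddfD /= addr0.
have wlow (K j : nat) (n : R) : 2 * `|complex.Re z| <= K%:R -> (j < K)%N -> `|n| = j.+1%:R ->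
    c * d * j.+1%:R <= (K.*2.+1)%:R * cabs (1 - nome ((z + (n%:C)%C) / (K.*2.+1)%:R)).
  move=> hK jK hn; have M0 : 0 < (K.*2.+1)%:R :> R by rewrite ltr0n.
  have nK : `|n| <= K%:R by rewrite hn ler_nat.
  have := hc K n hK nK; rewrite mulrA ler_pdivrMr// [X in _ <= X]mulrC.
  by apply: le_trans; rewrite -mulrA ler_pM2l// -hn hdn.
case: s => [|s].
  have [B B0 hB] := ccvg_bounded (ccvg_nome_slope (2 * z)).
  exists (B / (c * d) ^+ 2); first by rewrite divr_gt0// exprn_gt0// mulr_gt0.
  move=> K j hK jK; set M := K.*2.+1.
  have M0 : 0 < M%:R :> R by rewrite ltr0n.
  have M0' : M%:R != 0 :> R[i] by rewrite pnatr_eq0.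
  set j1 : R := j.+1%:R; have j10 : 0 < j1 by rewrite ltr0n.
  pose w1 := (z + j.+1%:R) / M%:R; pose w2 := (z - j.+1%:R) / M%:R.
  have hw1 : upper_half_plane w1 by rewrite /w1 natC; exact: wup.
  have hw2 : upper_half_plane w2 by rewrite /w2 natCN; exact: wup.
  have P0 : forall q : R[i], cabs q < 1 -> powsum 0 q = (1 - q)^-1.
    move=> q q1; apply: (csum_unique (csum_powsum 0 q1)).
    have := csum_bin_geometric 0 q1; rewrite expr1; apply: eq_csum => r.
    by rewrite bin0 expr0.
  have n1 : 1 - nome w1 != 0 by rewrite subr_eq0 eq_sym nome_upper_neq1.
  have n2 : 1 - nome w2 != 0 by rewrite subr_eq0 eq_sym nome_upper_neq1.
  (* 1/(1 - q1) + 1/(1 - q2) - 1 = (1 - q1 q2) / ((1 - q1) (1 - q2)), and q1 q2 = e^(2 pi i 2z/M) is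
     free of j; hence M (1 - q1 q2) is bounded uniformly in j. *)
  have -> : cotsum 0 w1 + cotsum 0 w2 =
      (1 - nome (2 * z / M%:R)) / ((1 - nome w1) * (1 - nome w2)).
    rewrite /cotsum !P0 ?cabs_nome_lt1// eqxx.
    have -> : nome (2 * z / M%:R) = nome w1 * nome w2.
      by rewrite -nomeD; congr nome; rewrite /w1 /w2; ring.
    by rewrite (_ : true%:R = 1)//; field; rewrite n1 n2.
  have h1 := @wlow K j j1 hK jK (gtr0_norm j10).
  have h2 : c * d * j1 <= M%:R * cabs (1 - nome w2).
    have := @wlow K j (- j1) hK jK; rewrite normrN => /(_ (gtr0_norm j10)).
    by rewrite /w2 natCN.
  have h3 := hB K.*2; rewrite -/M in h3.
  move: h1; rewrite -[(j1%:C)%C]/(((j.+1%:R : R)%:C)%C) -natC -/w1 => h1.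
  have p1 : 0 < cabs (1 - nome w1) by rewrite cabs_gt0.
  have p2 : 0 < cabs (1 - nome w2) by rewrite cabs_gt0.
  rewrite cabsM cabsV cabsX cabs_nat expr1 cabsM cabsV cabsM.
  move: h3; rewrite cabsM cabs_nat => h3.
  set A := cabs (1 - nome (2 * z / M%:R)) in h3 *.
  set a1 := cabs (1 - nome w1) in h1 p1 *; set a2 := cabs (1 - nome w2) in h2 p2 *.
  have -> : M%:R^-1 * (A / (a1 * a2)) = (M%:R * A) / ((M%:R * a1) * (M%:R * a2)).
    by field; rewrite !gt_eqF.
  have cd : 0 < c * d by rewrite mulr_gt0.
  have -> : B / (c * d) ^+ 2 * j1 ^- 2 = B / ((c * d * j1) * (c * d * j1)).
    by field; rewrite !gt_eqF.
  have cdj : 0 < c * d * j1 by rewrite mulr_gt0.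
  apply: ler_pM => //.
  - by rewrite mulr_ge0 ?cabs_ge0.
  - by rewrite invr_ge0 !mulr_ge0 ?cabs_ge0.
  by rewrite lef_pV2 ?posrE ?mulr_gt0//; apply: ler_pM => //; exact: ltW.
have [P P0 hP] := @powsum_rational R s.+1.
have [B B0 hB] := cabs_horner_bounded P 2.
have cd : 0 < c * d by rewrite mulr_gt0.
exists (2 * B / (c * d) ^+ s.+2); first by rewrite divr_gt0 ?exprn_gt0// mulr_gt0.
move=> K j hK jK; set M := K.*2.+1.
have M0 : 0 < M%:R :> R by rewrite ltr0n.
set j1 : R := j.+1%:R; have j10 : 0 < j1 by rewrite ltr0n.
have j11 : 1 <= j1 by rewrite ler1n.
suff h (n : R) : `|n| = j1 -> cabs (M%:R ^- s.+2 * cotsum s.+1 ((z + (n%:C)%C) / M%:R)) <=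
    B / (c * d) ^+ s.+2 * j1 ^- 2.
  rewrite mulrDr (le_trans (ler_cabsD _ _))//.
  have -> : 2 * B / (c * d) ^+ s.+2 * j1 ^- 2 = B / (c * d) ^+ s.+2 * j1 ^- 2 +
     B / (c * d) ^+ s.+2 * j1 ^- 2 by ring.
  have h1 := h j1 (gtr0_norm j10).
  have h2 : `|- j1| = j1 by rewrite normrN gtr0_norm.
  have {}h2 := h _ h2.
  have E1 : (j1%:C)%C = j.+1%:R :> R[i] by rewrite /j1 rmorph_nat.
  have E2 : ((- j1)%:C)%C = - j.+1%:R :> R[i] by rewrite raddfN; congr (- _); exact: E1.
  by rewrite E1 in h1; rewrite E2 in h2; exact: (lerD h1 h2).
move=> hn; have hw := wup n K; rewrite -/M in hw.
rewrite /cotsum /= mul0r subr0 hP ?cabs_nome_lt1//.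
have {}hlow := wlow K j n hK jK hn; rewrite -/M -/j1 in hlow.
set q := nome _ in hlow *.
have q1 : cabs q < 1 by exact: cabs_nome_lt1.
have hp : cabs P.[1 - q] <= B.
  by apply: hB; have := ler_cabsD 1 (- q); rewrite cabsN cabs1; lra.
have n1 : 0 < cabs (1 - q) by rewrite cabs_gt0 subr_eq0 eq_sym nome_upper_neq1.
rewrite !cabsM !cabsV !cabsX cabs_nat mulrCA -invfM -exprMn -mulrA.
have Mq : 0 < M%:R * cabs (1 - q) by rewrite mulr_gt0.
have e1 : 0 < (M%:R * cabs (1 - q)) ^+ s.+2 by rewrite exprn_gt0.
have e2 : 0 < (c * d) ^+ s.+2 * j1 ^+ 2.
  by apply: mulr_gt0; apply: exprn_gt0.
apply: ler_pM => //; rewrite ?cabs_ge0 ?invr_ge0 ?(ltW e1)//.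
rewrite -invfM lef_pV2 ?posrE//.
apply: (@le_trans _ _ ((c * d * j1) ^+ s.+2)).
  by rewrite [leRHS]exprMn; apply: ler_wpM2l; rewrite ?ler_weXn2l ?exprn_ge0 ?(ltW cd).
rewrite lerXn2r ?nnegrE ?(ltW Mq)//.
by apply: mulr_ge0; apply: ltW.
Qed.

(* The distribution relation writes [cotsum s z] as a sum over residues modulo
   [2K+1]; letting K grow, only the polar parts survive. For s = 0 the limit is
   the partial fraction expansion of the cotangent. *)
Lemma lipschitz s z : upper_half_plane z ->
  csum (fun j => pole s (z + j.+1%:R) + pole s (z - j.+1%:R))
       (cotsum s z - pole s z).
Proof.
move=> z0; have [B B0 hB] := cotsum_pair_bound s z0.
have [K0 hK0] : exists K0 : nat, 2 * `|complex.Re z| <= K0%:R.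
  exists (Num.truncn (2 * `|complex.Re z|)).+1.
  by apply: ltW; rewrite truncnS_gt.
have zn (n : nat) : upper_half_plane (z + n%:R) by exact: (@upperD_int _ z n%:Z).
have znN (n : nat) : upper_half_plane (z - n%:R).
  by have := @upperD_int _ z (- n%:Z) z0; rewrite mulrNz.
pose F K j := (K.*2.+1)%:R ^- s.+1 * (cotsum s ((z + j.+1%:R) / (K.*2.+1)%:R) +
           cotsum s ((z - j.+1%:R) / (K.*2.+1)%:R)).
(* The shift by [K0] makes [cotsum_pair_bound] valid for every [K]; the terms beyond the residue
   range are set to 0, so that [tannery] sees full series. *)
pose u K j := if (j < K + K0)%N then F (K + K0)%N j else 0.
pose v j := pole s (z + j.+1%:R) + pole s (z - j.+1%:R).
have uB K j : cabs (u K j) <= B * j.+1%:R ^- 2.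
  rewrite /u; case: ifP => jK; last first.
    by rewrite cabs0 mulr_ge0 ?(ltW B0)// invr_ge0 sqr_ge0.
  by apply: hB => //; apply: le_trans hK0 _; rewrite ler_nat leq_addl.
have uv j : ccvg (fun K => u K j) (v j).
  apply: (@ccvg_eventually _ (fun K => F (K + K0)%N j) _ _ j.+1).
    by move=> K jK; rewrite /u (leq_trans jK)// leq_addr.
  apply: (@ccvg_subseq _ (fun K => F K j) _ (fun K => K + K0)%N).
    by move=> n; rewrite leq_addr.
  rewrite (_ : (fun K => F K j) = fun K =>
     (K.*2.+1)%:R ^- s.+1 * cotsum s ((z + j.+1%:R) / (K.*2.+1)%:R) +
     (K.*2.+1)%:R ^- s.+1 * cotsum s ((z - j.+1%:R) / (K.*2.+1)%:R)).
    by apply: ccvgD; exact: ccvg_cotsum_pole.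
  by apply/funext => K; rewrite /F mulrDr.
have hb := @is_cvg_series_cmul_inv_sqr B.
have vB j : cabs (v j) <= B * j.+1%:R ^- 2 by apply: ccvg_norm_le (uv j).
have [t ht] := csum_abs_cvg vB hb.
pose S K := \sum_(0 <= j < K + K0) u K j.
have hS K : csum (u K) (S K).
  by apply: csum_finite => j; rewrite /u ltnNge => ->.
have St := tannery hS ht uv uB hb.
suff -> : cotsum s z - pole s z = t by [].
apply: ccvg_unique St.
rewrite (_ : S = fun K => cotsum s z - ((K + K0).*2.+1)%:R ^- s.+1 * cotsum s (z / ((K + K0).*2.+1)%:R)).
  apply: ccvgB; first exact: ccvg_cst.
  apply: (@ccvg_subseq _ (fun K => (K.*2.+1)%:R ^- s.+1 * cotsum s (z / (K.*2.+1)%:R)) _ (fun K => K + K0)%N).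
    by move=> n; rewrite leq_addr.
  exact: ccvg_cotsum_pole.
apply/funext => K; rewrite (cotsum_distribution s (K + K0) z0).
rewrite (sum_symmetric (fun n => cotsum s ((z + n) / ((K + K0).*2.+1)%:R))) addr0.
rewrite mulrDr addrAC subrr add0r mulr_sumr /S !big_nat; apply: eq_bigr => j /= jK.
by rewrite /u jK.
Qed.

End Lipschitz.

(** * Lambert series and absolutely convergent double series *)

Section Lambert.
Context {R : realType}.
Implicit Types (z q : R[i]).

Lemma sigma_codivisors (s n : nat) : (0 < n)%N ->
  sigma s n = (\sum_(0 <= d < n | d.+1 %| n) (n %/ d.+1) ^ s)%N.
Proof.
move=> n0; rewrite /sigma.
have -> : (\sum_(d <- divisors n) d ^ s = \sum_(d <- divisors n) (n %/ d) ^ s)%N.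
  rewrite -(big_map (fun d => n %/ d)%N xpredT (fun d => d ^ s)%N).
  apply: perm_big; apply: uniq_perm; rewrite ?divisors_uniq//.
    rewrite map_inj_in_uniq ?divisors_uniq// => d e.
    rewrite -!dvdn_divisors// => dn en h.
    have ed : (d * (n %/ d) = n)%N by rewrite mulnC divnK.
    have ee : (e * (n %/ e) = n)%N by rewrite mulnC divnK.
    have nd0 : (0 < n %/ d)%N by move: n0; rewrite -{1}ed muln_gt0 => /andP[].
    by apply/eqP; rewrite -(eqn_pmul2r nd0) {2}h ed ee.
  move=> d; apply/idP/mapP => [|[e]]; rewrite -!dvdn_divisors//.
    move=> dn; exists (n %/ d)%N; first by rewrite -dvdn_divisors// dvdn_div.
    have ed : (d * (n %/ d) = n)%N by rewrite mulnC divnK.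
    have nd0 : (0 < n %/ d)%N by move: n0; rewrite -{1}ed muln_gt0 => /andP[].
    by rewrite -{1}ed mulnK.
  by move=> en ->; rewrite dvdn_div.
rewrite -(big_add1 _ _ 0 n.+1 (fun d => d %| n)%N (fun d => (n %/ d) ^ s)%N).
rewrite -[RHS]big_filter; apply: perm_big; apply: uniq_perm.
- exact: divisors_uniq.
- by rewrite filter_uniq// iota_uniq.
move=> d; rewrite -dvdn_divisors// mem_filter mem_index_iota.
case: (boolP (d %| n)%N) => //= dn.
by rewrite ltnS (dvdn_leq n0 dn) (dvdn_gt0 n0 dn).
Qed.

Lemma sigma1n (s : nat) : sigma s 1 = 1%N.
Proof. by rewrite /sigma /divisors /= big_seq1 exp1n. Qed.

(** Both series sum r^(s+1) q^(d r), one by d and the other by n = d r. The array [a d n] is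
    therefore indexed by the exponent n, with zeros where d + 1 does not divide n. *)
Lemma lambert (s : nat) z : upper_half_plane z -> exists L : R[i],
  csum (fun d => powsum s.+1 (nome (d.+1%:R * z))) L /\
  csum (fun n => (sigma s.+1 n.+1)%:R * nome z ^+ n.+1) L.
Proof.
move=> z0; set q := nome z.
have q1 : cabs q < 1 by exact: cabs_nome_lt1.
have q0 : 0 <= cabs q := cabs_ge0 q.
pose a (d n : nat) : R[i] := if (d.+1 %| n)%N then
   (n %/ d.+1)%:R ^+ s.+1 * (q ^+ d.+1) ^+ (n %/ d.+1) else 0.
have nz d : nome (d.+1%:R * z) = q ^+ d.+1 by rewrite nomeMn.
have hrow d : csum (a d) (powsum s.+1 (nome (d.+1%:R * z))).
  rewrite nz.
  have qd : cabs (q ^+ d.+1) < 1 by rewrite cabsX exprn_ilt1.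
  exact: (csum_stretch (ltn0Sn d) (csum_powsum s.+1 qd)).
pose T := limn (series (fun n => n%:R ^+ s.+1 * cabs q ^+ n)).
have hT := @is_cvg_series_pow_geometric R s.+1 _ q0 q1.
have hTn N : series (fun n => n%:R ^+ s.+1 * cabs q ^+ n) N <= T.
  apply: nondecreasing_cvgn_le => //; apply/nondecreasing_seqP => n.
  by rewrite /series/= big_nat_recr//= lerDl mulr_ge0 ?exprn_ge0.
have hb d M : cabs (series (a d) M) <= T * cabs q ^+ d.
  apply: (le_trans (ler_cabs_sum _ _)).
  rewrite -[leLHS]/(series (fun n => cabs (a d n)) M) (@series_multiples _ _ d.+1)//; last first.
    by move=> n /negbTE hn; rewrite /a hn cabs0.
  apply: (@le_trans _ _ (series (fun n => n%:R ^+ s.+1 * cabs q ^+ n) ((M + d) %/ d.+1)%N * cabs q ^+ d)).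
    rewrite /series /= mulr_suml; apply: ler_sum => r _.
    rewrite /a dvdn_mulr// mulKn// cabsM !cabsX cabs_nat.
    (* The factor |q|^d splits off because (d + 1) r >= d + r for r >= 1; the term r = 0 vanishes
       since the exponent s + 1 is positive. *)
    case: r => [|r]; first by rewrite !expr0n /= !mul0r.
    rewrite -mulrA ler_wpM2l ?exprn_ge0//.
    by rewrite -exprM -exprD ler_wiXn2l ?(ltW q1)//; nia.
  by rewrite ler_wpM2r ?exprn_ge0.
have cvb : cvgn (series (fun d => T * cabs q ^+ d)).
  by apply: is_cvg_geometric_series; rewrite ger0_norm.
have hrowb d : cabs (powsum s.+1 (nome (d.+1%:R * z))) <= T * cabs q ^+ d.
  by apply: ccvg_norm_le (hrow d) => M; exact: hb.
have [L hL] := csum_abs_cvg hrowb cvb.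
exists L; split => //.
suff : csum (fun n => if (0 < n)%N then (sigma s.+1 n)%:R * q ^+ n else 0) L.
  by move/csum_behead; rewrite subr0.
apply: csum_swap hrow _ hL hb cvb => n.
have [->|n0] := posnP n.
  apply: eq_csum csum0 => d; by rewrite /a dvdn0 div0n expr0n mul0r.
have -> : (sigma s.+1 n)%:R * q ^+ n = \sum_(0 <= d < n) a d n.
  rewrite sigma_codivisors// natr_sum mulr_suml big_mkcond /=.
  apply: eq_bigr => d _; rewrite /a; case: ifP => // dn.
  by rewrite natrX -exprM mulnC divnK.
apply: csum_finite => d nd; rewrite /a gtnNdvd//.
Qed.

Lemma csum_swap_inv_sqr (a : nat -> nat -> R[i]) (C : R) :
  (forall d n, cabs (a d n) <= C * d.+1%:R ^- 2 * n.+1%:R ^- 2) ->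
  exists Srow Scol S, [/\ forall d, csum (a d) (Srow d),
    forall n, csum (a^~ n) (Scol n), csum Srow S & csum Scol S].
Proof.
move=> ha.
have cvs (c : R) : cvgn (series (fun n : nat => c * (n.+1%:R ^- 2))).
  exact: is_cvg_series_cmul_inv_sqr.
have /choice[Srow hrow] d : exists t, csum (a d) t.
  exact: (csum_abs_cvg (ha d) (cvs _)).
have /choice[Scol hcol] n : exists t, csum (a^~ n) t.
  apply: (@csum_abs_cvg _ _ (fun d => C * n.+1%:R ^- 2 * d.+1%:R ^- 2)) => [d|]; last exact: cvs.
  by rewrite mulrAC; exact: ha.
pose T := limn (series (fun n : nat => (n.+1%:R ^- 2 : R))).
have C0 : 0 <= C.
  have := le_trans (cabs_ge0 _) (ha 0%N 0%N).
  by rewrite expr1n invr1 !mulr1.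
have hb d M : cabs (series (a d) M) <= C * T * d.+1%:R ^- 2.
  apply: (le_trans (ler_cabs_sum _ _)).
  apply: (@le_trans _ _ (C * d.+1%:R ^- 2 * series (fun n : nat => (n.+1%:R ^- 2 : R)) M)).
    by rewrite /series /= mulr_sumr; apply: ler_sum => n _; exact: ha.
  rewrite mulrAC ler_wpM2r ?invr_ge0 ?exprn_ge0// ler_wpM2l//.
  apply: nondecreasing_cvgn_le; last exact: is_cvg_series_inv_sqr.
  apply/nondecreasing_seqP => n.
  by rewrite /series/= big_nat_recr//= lerDl invr_ge0 exprn_ge0.
have [S hS] : exists t, csum Srow t.
  apply: (@csum_abs_cvg _ _ (fun d => C * T * d.+1%:R ^- 2)); last exact: cvs.
  by move=> d; apply: ccvg_norm_le (hrow d) => M; exact: hb.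
exists Srow, Scol, S; split => //.
exact: (csum_swap hrow hcol hS hb (@cvs _)).
Qed.

End Lambert.

(** * Bernoulli numbers as zeta values, through t / (e^t - 1) *)

Section Bernoulli.
Context {R : realType}.

Lemma size_bernoulli_seq n : size (bernoulli_seq n) = n.
Proof. by elim: n => //= n IH; rewrite size_rcons IH. Qed.

Lemma nth_bernoulli_seq n j : (j < n)%N ->
  (bernoulli_seq n)`_j = bernoulli_number j.
Proof.
elim: n => // n IH; rewrite ltnS leq_eqVlt => /predU1P[->//|jn].
by rewrite /= nth_rcons size_bernoulli_seq jn IH.
Qed.

Lemma bernoulli_numberE n : bernoulli_number n =
  ((n == 0%N)%:R - \sum_(j < n) 'C(n.+1, j)%:R * bernoulli_number j) / n.+1%:R.
Proof.
rewrite {1}/bernoulli_number /= nth_rcons size_bernoulli_seq ltnn eqxx.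
congr ((_ - _) / _); apply: eq_bigr => j _.
by rewrite nth_bernoulli_seq.
Qed.

Lemma bernoulli_unique (beta : nat -> R) :
  (forall n, \sum_(0 <= j < n.+1) 'C(n.+1, j)%:R * beta j = (n == 0%N)%:R) ->
  forall n, ratr (bernoulli_number n) = beta n.
Proof.
move=> h; elim/ltn_ind => n IH.
rewrite bernoulli_numberE fmorph_div /= rmorphB /= rmorph_nat raddf_sum /=.
have := h n; rewrite big_nat_recr//= big_mkord binSn.
under [X in _ - X]eq_bigr => j _ do rewrite rmorphM /= ratr_nat IH ?ltn_ord//.
move=> <-; rewrite addrAC subrr add0r ratr_nat mulrAC divff ?mul1r// pnatr_eq0.
Qed.

(** This turns real estimates near 0 into identities between coefficients. Writing Q = Q1 X + c,
    letting t tend to 0 forces c = 0, and Q1 satisfies the bound with n - 1. *)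
Lemma coef_poly_small (K : R) (n : nat) (Q : {poly R}) :
  (forall t, 0 < t -> t <= 1 -> `|Q.[t]| <= K * t ^+ n) ->
  forall i, (i < n)%N -> Q`_i = 0.
Proof.
elim: n Q => // n IH Q hQ.
have [Q1 [c QE]] : exists Q1 c, Q = Q1 * 'X + c%:P.
  by elim/poly_ind: Q {hQ} => [|Q1 c _]; [exists 0, 0; rewrite mul0r add0r|exists Q1, c].
pose B := \sum_(i < size Q1) `|Q1`_i|.
have B0 : 0 <= B by apply: sumr_ge0.
have hB t : 0 < t -> t <= 1 -> `|Q1.[t]| <= B.
  move=> t0 t1; rewrite horner_coef (le_trans (ler_norm_sum _ _ _))//.
  apply: ler_sum => i _; rewrite normrM ler_piMr// normrX gtr0_norm//.
  by rewrite exprn_ile1// ltW.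
have K0 : 0 <= K.
  by have := hQ 1 ltr01 (lexx 1); rewrite expr1n mulr1; apply: le_trans.
have c0 : c = 0.
  apply/eqP; rewrite -normr_le0; apply/ler_addgt0Pr => e e0; rewrite add0r.
  have KB : 0 < K + B + 1 by rewrite ltr_wpDl ?addr_ge0.
  pose t := Num.min 1 (e / (K + B + 1)).
  have t0 : 0 < t by rewrite lt_min ltr01 divr_gt0.
  have t1 : t <= 1 by rewrite ge_min lexx.
  have te : t * (K + B + 1) <= e by rewrite -ler_pdivlMr// ge_min lexx orbT.
  have hc : c = Q.[t] - Q1.[t] * t by rewrite QE !hornerE; ring.
  have h1 := hQ t t0 t1; have h2 := hB t t0 t1.
  have h3 : K * t ^+ n.+1 <= K * t.
    by rewrite ler_wpM2l// exprS ler_piMr ?(ltW t0)// exprn_ile1// ltW.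
  rewrite hc (le_trans (ler_normB _ _))// normrM (gtr0_norm t0).
  have h4 : `|Q1.[t]| * t <= B * t by rewrite ler_wpM2r// ltW.
  by move: te; rewrite !mulrDr mulr1 [t * K]mulrC [t * B]mulrC; lra.
have hQ1 t : 0 < t -> t <= 1 -> `|Q1.[t]| <= K * t ^+ n.
  move=> t0 t1; have := hQ t t0 t1; rewrite QE c0 !hornerE normrM (gtr0_norm t0).
  by rewrite exprSr mulrA ler_pM2r.
move=> [|i] hi; rewrite QE c0 addr0 coefMX//=.
exact: IH hQ1 _ hi.
Qed.

Lemma expR_taylor (n : nat) (t : R) : 0 <= t -> t <= 1 ->
  `|expR t - \sum_(i < n) t ^+ i / i`!%:R| <= expR 1 * t ^+ n.
Proof.
move=> t0 t1.
have cv (x : R) : series (exp_coeff x) @ \oo --> expR x by exact: is_cvg_series_exp_coeff.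
have nd (x : R) : 0 <= x -> nondecreasing_seq (series (exp_coeff x)).
  move=> x0; apply/nondecreasing_seqP => i.
  by rewrite /series/= big_nat_recr//= lerDl exp_coeff_ge0.
have le1 N : series (exp_coeff (1 : R)) N <= expR 1.
  rewrite -(cvg_lim (@Rhausdorff R) (cv 1)).
  by apply: nondecreasing_cvgn_le; [exact: nd|apply/cvg_ex; exists (expR 1)].
have Sn : \sum_(i < n) t ^+ i / i`!%:R = series (exp_coeff t) n.
  by rewrite /series/= big_mkord.
rewrite Sn ger0_norm; last first.
  rewrite subr_ge0 -(cvg_lim (@Rhausdorff R) (cv t)).
  by apply: nondecreasing_cvgn_le; [exact: nd|apply/cvg_ex; exists (expR t)].
have h : (fun N => series (exp_coeff t) (N + n)%N - series (exp_coeff t) n) @ \oo -->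
   expR t - series (exp_coeff t) n.
  apply: cvgB; last exact: cvg_cst.
  by rewrite (cvg_shiftn n (series (exp_coeff t))).
rewrite -(cvg_lim (@Rhausdorff R) h); apply: limr_le; first exact: cvgP h.
apply: nearW => N; rewrite sub_series_geq ?leq_addl// -{1}[n]add0n big_addn addnK.
apply: (@le_trans _ _ (series (exp_coeff (1 : R)) N * t ^+ n)); last first.
  by rewrite ler_wpM2r ?exprn_ge0.
rewrite /series /= mulr_suml; apply: ler_sum => i _.
change (t ^+ (i + n) / (i + n)`!%:R <= 1 ^+ i / i`!%:R * t ^+ n).
rewrite expr1n div1r exprD mulrAC ler_wpM2r ?exprn_ge0//.
apply: (@le_trans _ _ ((i + n)`!%:R^-1)).
  by rewrite ler_piMl ?invr_ge0// exprn_ile1.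
rewrite lef_pV2 ?posrE ?ltr0n ?fact_gt0// ler_nat.
elim: (n) => [|n' IH]; first by rewrite addn0.
by rewrite addnS factS (leq_trans IH)// leq_pmull.
Qed.

(** Minus the square of 2 pi i (j + 1), a pole of t / (e^t - 1). *)
Definition pole_sqr (j : nat) : R := (2 * pi * j.+1%:R) ^+ 2.

Lemma pole_sqr_ge j : j.+1%:R ^+ 2 <= pole_sqr j.
Proof.
rewrite /pole_sqr lerXn2r ?nnegrE// ?mulr_ge0 ?pi_ge0//.
by rewrite ler_peMl//; have := @pi_ge2 R; lra.
Qed.

Lemma pole_sqr_gt0 j : 0 < pole_sqr j.
Proof. by apply: lt_le_trans (pole_sqr_ge j); rewrite exprn_gt0. Qed.

Lemma pole_sqr_ge1 j : 1 <= pole_sqr j.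
Proof. by apply: le_trans (pole_sqr_ge j); rewrite exprn_ege1// ler1n. Qed.

(** For l > 0 this is zeta(2l) / (2 pi)^(2l). *)
Definition even_zeta (l : nat) : R := limn (series (fun j => pole_sqr j ^- l)).

Lemma cvg_even_zeta l : (0 < l)%N ->
  series (fun j => pole_sqr j ^- l) @ \oo --> even_zeta l.
Proof.
case: l => // l _.
apply: (@series_le_cvg _ _ (fun j : nat => (j.+1%:R ^- 2 : R))) => [j|j|j|].
- by rewrite invr_ge0 exprn_ge0// ltW// pole_sqr_gt0.
- by rewrite invr_ge0 exprn_ge0.
- rewrite lef_pV2 ?posrE; [|exact/exprn_gt0/pole_sqr_gt0|exact: exprn_gt0].
  by apply: le_trans (pole_sqr_ge j) _; rewrite ler_eXnr// pole_sqr_ge1.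
- exact: is_cvg_series_inv_sqr.
Qed.

Lemma series_pos_lim_gt0 (f : nat -> R) (l : R) : (forall j, 0 < f j) ->
  series f @ \oo --> l -> 0 < l.
Proof.
move=> f0 fl; apply: (lt_le_trans (f0 0%N)).
rewrite -(cvg_lim (@Rhausdorff R) fl).
have := @nondecreasing_cvgn_le _ (series f) _ (cvgP _ fl) 1%N.
rewrite [series f 1%N](_ : _ = f 0%N); last by rewrite /series /= big_nat1.
apply; apply/nondecreasing_seqP => n.
by rewrite /series/= big_nat_recr//= lerDl ltW.
Qed.

Lemma even_zeta_gt0 l : (0 < l)%N -> 0 < even_zeta l.
Proof.
move=> l0; apply: series_pos_lim_gt0 (cvg_even_zeta l0) => j.
by rewrite invr_gt0 exprn_gt0// pole_sqr_gt0.
Qed.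

Lemma powsum0E (q : R[i]) : cabs q < 1 -> powsum 0 q = (1 - q)^-1.
Proof.
move=> q1; apply: (csum_unique (csum_powsum 0 q1)).
have := csum_bin_geometric 0 q1; rewrite expr1; apply: eq_csum => r.
by rewrite bin0 expr0.
Qed.

Lemma sqr_twopii_nat j : (twopii * j.+1%:R) ^+ 2 = - ((pole_sqr j)%:C)%C :> R[i].
Proof.
rewrite /twopii /pole_sqr -(rmorph_nat (real_complex R)).
by apply/eqP; rewrite eq_complex /=; apply/andP; split; apply/eqP; ring.
Qed.

(** The case s = 0 of [lipschitz] at z = i t / (2 pi), where q = e^(-t) and the poles at j and -j
    combine into a real term. *)
Lemma cvg_coth (t : R) : 0 < t ->
  series (fun j => 2 * t / (t ^+ 2 + pole_sqr j)) @ \oo -->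
  ((1 - expR (- t))^-1 - 1 / 2 - t^-1).
Proof.
move=> t0; have pi0 := @pi_gt0 R.
have e2pi : 2 * pi * (t / (2 * pi)) = t.
  by rewrite mulrC divfK// mulf_neq0// lt0r_neq0.
pose z : R[i] := (0 +i* (t / (2 * pi)))%C.
have z0 : upper_half_plane z by rewrite /upper_half_plane /= divr_gt0// mulr_gt0.
have tz : - (twopii * z) = (t%:C)%C.
  rewrite /twopii /z; apply/eqP; rewrite eq_complex /=; apply/andP; split; apply/eqP; last by ring.
  by rewrite -[RHS]e2pi; ring.
have qz : nome z = ((expR (- t))%:C)%C.
  rewrite /z nomeE mulr0 cos0 sin0 !mulr0 mulr1; congr (expR _ +i* _)%C.
  by rewrite e2pi.
have P n : pole 0 (z + n) = (((t%:C)%C) - twopii * n)^-1.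
  by rewrite /pole fact0 div1r expr1 mulrDr opprD tz.
have E j : pole 0 (z + j.+1%:R) + pole 0 (z - j.+1%:R) =
    ((2 * t / (t ^+ 2 + pole_sqr j))%:C)%C.
  rewrite !P mulrN opprK.
  have h : ((t%:C)%C - twopii * j.+1%:R) * ((t%:C)%C + twopii * j.+1%:R) =
     ((t ^+ 2 + pole_sqr j)%:C)%C.
    by rewrite -subr_sqr sqr_twopii_nat opprK -rmorphXn -rmorphD.
  have h0 : t ^+ 2 + pole_sqr j != 0.
    by rewrite lt0r_neq0//; apply: addr_gt0; [exact: exprn_gt0|exact: pole_sqr_gt0].
  have h1 : ((t ^+ 2 + pole_sqr j)%:C)%C != 0 :> R[i].
    by rewrite -[0]/((0 : R)%:C)%C (inj_eq (@complexI R)).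
  have := h1; rewrite -h mulf_eq0 negb_or => /andP[n1 n2].
  rewrite rmorphM fmorphV /= -h rmorphM rmorph_nat /=.
  move: n1 n2; move: (twopii * _) (t%:C)%C => a T n1 n2.
  by field; rewrite n1 n2.
have := eq_csum E (lipschitz 0 z0).
have -> : cotsum 0 z - pole 0 z = (((1 - expR (- t))^-1 - 1 / 2 - t^-1)%:C)%C.
  rewrite /cotsum powsum0E; last exact: cabs_nome_lt1.
  have := P 0; rewrite addr0 mulr0 subr0 => ->.
  rewrite qz rmorphB [in RHS]rmorphB [in RHS]rmorphM /= !fmorphV /= rmorphB.
  by rewrite rmorph1 rmorph_nat.
rewrite (_ : series (fun j => 2 * t / (t ^+ 2 + pole_sqr j)) = fun n =>
    complex.Re (series (fun j => ((2 * t / (t ^+ 2 + pole_sqr j))%:C)%C) n)).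
  by move/ccvg_Re.
by apply/funext => n; rewrite /series/= raddf_sum.
Qed.

(** The candidate for B_i / i!: the Taylor coefficients of t / (e^t - 1) as predicted by the partial
    fractions. *)
Definition tcoef (i : nat) : R :=
  if i == 0%N then 1 else if i == 1%N then - (1 / 2)
  else if odd i then 0 else 2 * (-1) ^+ (i./2).-1 * even_zeta i./2.

(** With x = [pole_sqr j], each step replaces 1/(t^2 + x) by 1/x - t^2 / (x (t^2 + x)). The part 1/x
    sums to a zeta value and the rest is the next remainder W, a series of positive terms. *)
Lemma todd_expansion (L : nat) (t : R) : 0 < t -> exists W : R,
  series (fun j => t ^+ (2 * L.+1) / (pole_sqr j ^+ L * (t ^+ 2 + pole_sqr j)))
    @ \oo --> W /\
  t / (expR t - 1) = \sum_(i < 2 * L.+1) tcoef i * t ^+ i + 2 * (-1) ^+ L * W.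
Proof.
move=> t0.
have px j : t ^+ 2 + pole_sqr j != 0.
  by rewrite lt0r_neq0//; apply: addr_gt0; [exact: exprn_gt0|exact: pole_sqr_gt0].
have p0 j : pole_sqr j != 0 by rewrite gt_eqF// pole_sqr_gt0.
have et : expR t - 1 != 0 by rewrite subr_eq0 gt_eqF// expR_gt1.
have et0 : expR t != 0 by rewrite gt_eqF// expR_gt0.
have t0' : t != 0 by rewrite gt_eqF.
elim: L => [|L [W [hW IH]]].
  exists (t / 2 * ((1 - expR (- t))^-1 - 1 / 2 - t^-1)); split.
    rewrite (_ : series _ = fun n => t / 2 * series (fun j => 2 * t / (t ^+ 2 + pole_sqr j)) n).
      by apply: cvgMl_tmp; exact: cvg_coth.
    apply/funext => n; rewrite /series/= mulr_sumr; apply: eq_bigr => j _.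
    by rewrite muln1 expr0; field.
  rewrite muln1 !big_ord_recr big_ord0 /= /tcoef /= add0r !expr0 expr1 expRN.
  have e2 : 1 - (expR t)^-1 != 0 by rewrite subr_eq0 eq_sym invr_eq1 -subr_eq0.
  have -> : (1 - (expR t)^-1)^-1 = expR t / (expR t - 1).
    by rewrite -invf_div mulrBl divff// div1r.
  by field; rewrite et t0'.
exists (t ^+ (2 * L.+1) * even_zeta L.+1 - W); split.
  rewrite (_ : series _ = fun n => t ^+ (2 * L.+1) * series (fun j => pole_sqr j ^- L.+1) n -
     series (fun j => t ^+ (2 * L.+1) / (pole_sqr j ^+ L * (t ^+ 2 + pole_sqr j))) n).
    by apply: cvgB => //; apply: cvgMl_tmp; exact: cvg_even_zeta.
  apply/funext => n; rewrite /series/= mulr_sumr -sumrB; apply: eq_bigr => j _.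
  rewrite [(2 * L.+2)%N](_ : _ = 2 * L.+1 + 2)%N; last by lia.
  rewrite exprD (exprS (pole_sqr j)).
  have : pole_sqr j ^+ L != 0 by rewrite expf_neq0.
  move: (pole_sqr j ^+ L) (t ^+ (2 * L.+1)) => a b a0.
  move: (pole_sqr j) (px j) (p0 j) => x x1 x0.
  by field; rewrite x1 x0 a0.
rewrite IH [(2 * L.+2)%N](_ : _ = (2 * L.+1).+2)%N; last by lia.
have c1 : tcoef (2 * L.+1).+1 = 0 by rewrite /tcoef mul2n /= odd_double.
have c2 : tcoef (2 * L.+1) = 2 * (-1) ^+ L * even_zeta L.+1.
  by rewrite /tcoef mul2n /= odd_double /= doubleK.
move: c1 c2; move: (2 * L.+1)%N => n0 c1 c2.
by rewrite [in RHS]big_ord_recr [in RHS]big_ord_recr /= c1 c2 (exprS (-1)); ring.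
Qed.

Lemma todd_bound (L : nat) (t : R) : 0 < t ->
  `|t / (expR t - 1) - \sum_(i < 2 * L.+1) tcoef i * t ^+ i| <=
  2 * even_zeta L.+1 * t ^+ (2 * L.+1).
Proof.
move=> t0; have [W [hW ->]] := todd_expansion L t0.
have tpos j : 0 < t ^+ 2 + pole_sqr j.
  by apply: addr_gt0; [exact: exprn_gt0|exact: pole_sqr_gt0].
have W0 : 0 < W.
  apply: series_pos_lim_gt0 hW => j; rewrite divr_gt0 ?exprn_gt0//.
  by apply: mulr_gt0 => //; exact/exprn_gt0/pole_sqr_gt0.
rewrite addrAC subrr add0r !normrM normrX normrN1 expr1n mulr1 normr_nat gtr0_norm//.
rewrite -mulrA ler_pM2l//.
have h : series (fun j => t ^+ (2 * L.+1) * pole_sqr j ^- L.+1) @ \oo -->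
    t ^+ (2 * L.+1) * even_zeta L.+1.
  rewrite (_ : series _ = fun n => t ^+ (2 * L.+1) * series (fun j => pole_sqr j ^- L.+1) n).
    by apply: cvgMl_tmp; exact: cvg_even_zeta.
  by apply/funext => n; rewrite /series/= mulr_sumr.
rewrite mulrC; apply: ler_cvg_to hW h _; apply: nearW => n.
rewrite /series/=; apply: ler_sum => j _; rewrite ler_pM2l ?exprn_gt0//.
have pj := pole_sqr_gt0 j.
have pL : 0 < pole_sqr j ^+ L by exact: exprn_gt0.
rewrite lef_pV2 ?posrE; [|exact: mulr_gt0|exact: exprn_gt0].
by rewrite exprSr ler_pM2l// lerDr exprn_ge0// ltW.
Qed.

(** The truncations A of e^t - 1 and p of t / (e^t - 1) satisfy A p = t + O(t^n) for small t > 0,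
    with n > N + 1. So A p and X have the same coefficient at N + 1, which is the Bernoulli
    recurrence divided by (N + 1)!. *)
Lemma tcoef_recurrence (N : nat) :
  \sum_(0 <= j < N.+1) tcoef j / (N.+1 - j)`!%:R = (N == 0%N)%:R.
Proof.
pose n := (2 * N.+1)%N.
pose A : {poly R} := \poly_(i < n) (if i == 0%N then 0 else i`!%:R^-1).
pose p : {poly R} := \poly_(i < n) tcoef i.
pose Z := even_zeta N.+1.
have Z0 : 0 < Z by exact: even_zeta_gt0.
pose B := \sum_(i < n) `|tcoef i|.
pose e := expR (1 : R).
have e0 : 0 < e by exact: expR_gt0.
have hQ (t : R) : 0 < t -> t <= 1 -> `|(A * p - 'X).[t]| <= (e * (2 * Z) + e * B) * t ^+ n.
  move=> t0 t1.
  have et : expR t - 1 != 0 by rewrite subr_eq0 gt_eqF// expR_gt1.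
  have pE : p.[t] = \sum_(i < n) tcoef i * t ^+ i by rewrite horner_poly.
  have AE : A.[t] = \sum_(i < n) t ^+ i / i`!%:R - 1.
    rewrite horner_poly /n mulnS big_ord_recl [in RHS]big_ord_recl /= mul0r add0r fact0 divr1 expr0.
    by rewrite addrAC subrr add0r; apply: eq_bigr => i _; rewrite mulrC.
  have h1 := todd_bound N t0; rewrite -/n -pE -/Z in h1.
  have h2 := expR_taylor n (ltW t0) t1; rewrite -/e in h2.
  have hp : `|p.[t]| <= B.
    rewrite pE (le_trans (ler_norm_sum _ _ _))//; apply: ler_sum => i _.
    by rewrite normrM ler_piMr// normrX gtr0_norm// exprn_ile1// ltW.
  have he : `|expR t - 1| <= e.
    rewrite ger0_norm; last by rewrite subr_ge0 ltW// expR_gt1.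
    have : expR t <= e by rewrite ler_expR.
    by lra.
  have -> : (A * p - 'X).[t] = - ((expR t - 1) * (t / (expR t - 1) - p.[t])) -
      (expR t - \sum_(i < n) t ^+ i / i`!%:R) * p.[t].
    rewrite !hornerE AE; set S := \sum_(i < n) _; by field.
  rewrite (le_trans (ler_normB _ _))// normrN !normrM mulrDl.
  have tn : 0 <= t ^+ n by rewrite exprn_ge0// ltW.
  apply: lerD.
    by rewrite -mulrA; apply: ler_pM.
  by rewrite mulrAC; apply: ler_pM.
have Nn : (N.+1 < n)%N by rewrite /n; lia.
have := coef_poly_small hQ Nn; rewrite coefB coefX coefMr big_ord_recr /= subnn.
rewrite {2}/A coef_poly muln_gt0 /= mul0r addr0.
move/eqP; rewrite subr_eq0 => /eqP; rewrite -[N.+1 == 1%N]/(N == 0%N) => <-.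
rewrite big_mkord; apply: eq_bigr => j _; have jN := ltn_ord j.
rewrite /A /p !coef_poly.
have -> : (N.+1 - j < n)%N by apply: leq_ltn_trans Nn; exact: leq_subr.
have -> : (j < n)%N by apply: ltn_trans jN Nn.
by rewrite subn_eq0 leqNgt jN /= mulrC.
Qed.

Lemma bernoulli_tcoef n : ratr (bernoulli_number n) = n`!%:R * tcoef n.
Proof.
move: n; apply: bernoulli_unique => n.
have := tcoef_recurrence n => h.
have -> : (n == 0%N)%:R = n.+1`!%:R * (n == 0%N)%:R :> R.
  by case: n {h} => [|n]; rewrite ?fact0 ?mul1r// !mulr0.
rewrite -h mulr_sumr !big_nat; apply: eq_bigr => j /= jn.
rewrite -(bin_fact (ltnW jn)) !natrM.
have : (n.+1 - j)`!%:R != 0 :> R by rewrite pnatr_eq0 -lt0n fact_gt0.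
by move=> h1; field.
Qed.

Lemma bernoulli_even l : (0 < l)%N -> ratr (bernoulli_number l.*2) =
  l.*2`!%:R * (2 * (-1) ^+ l.-1 * even_zeta l).
Proof.
case: l => // l _; rewrite bernoulli_tcoef; congr (_ * _).
by rewrite /tcoef /= odd_double /= doubleK.
Qed.

End Bernoulli.

(** * The behaviour of E_k under z -> -1/z *)

Section Modularity.
Context {R : realType}.
Implicit Types (x y w z : R[i]).

Definition eis_const (k : nat) : R[i] :=
  - ratr (bernoulli_number k / (2 * k)%:R).

Lemma csum_eisenstein (s : nat) z : upper_half_plane z ->
  csum (fun n => (sigma s.+1 n.+1)%:R * nome z ^+ n.+1)
       (eisenstein s.+2 z - eis_const s.+2) /\
  csum (fun d => powsum s.+1 (nome (d.+1%:R * z)))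
       (eisenstein s.+2 z - eis_const s.+2).
Proof.
move=> z0; have [L [h1 h2]] := lambert s z0.
suff -> : eisenstein s.+2 z - eis_const s.+2 = L by [].
by rewrite /eisenstein /eis_const addrAC subrr add0r (csum_lim h2).
Qed.

Lemma poleM s x y : pole s (x * y) = pole s x / y ^+ s.+1.
Proof. by rewrite /pole mulrA -mulNr exprMn invfM mulrA. Qed.

Lemma poleN s x : odd s -> pole s (- x) = pole s x.
Proof.
move=> so; rewrite -mulrN1 poleM -signr_odd /= so.
by rewrite expr0 divr1.
Qed.

Lemma expr_double (x : R[i]) n : x ^+ n.*2 = (x ^+ 2) ^+ n.
Proof. by rewrite -mul2n exprM. Qed.

(** Euler's evaluation of zeta(2l + 2). It exhibits the constant term of E_k as the contribution of
    the lattice points (0, n) to the sum of [pole (k - 1)] at d z + n. *)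
Lemma csum_pole_nat l : csum (fun d => pole l.*2.+1 d.+1%:R) (eis_const l.+1.*2).
Proof.
have E d : pole l.*2.+1 d.+1%:R =
    ((l.*2.+1`!%:R * (-1) ^+ l.+1)%:C)%C * ((pole_sqr d ^- l.+1)%:C)%C :> R[i].
  rewrite /pole -doubleS expr_double sqrrN sqr_twopii_nat (exprNn ((pole_sqr d)%:C)%C) invfM.
  have -> : ((pole_sqr d)%:C)%C ^- l.+1 = ((pole_sqr d ^- l.+1)%:C)%C :> R[i].
    by rewrite fmorphV; congr (_^-1); apply/esym; exact: rmorphXn.
  have -> : (-1) ^- l.+1 = (((-1) ^+ l.+1)%:C)%C :> R[i].
    by rewrite rmorphXn rmorphN1 -exprVn invrN invr1.
  by rewrite [in RHS]rmorphM rmorph_nat mulrA.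
apply: (@eq_csum _ (fun d => ((l.*2.+1`!%:R * (-1) ^+ l.+1)%:C)%C * ((pole_sqr d ^- l.+1)%:C)%C)).
  by move=> d; rewrite E.
have -> : eis_const l.+1.*2 =
    ((l.*2.+1`!%:R * (-1) ^+ l.+1)%:C)%C * ((even_zeta l.+1)%:C)%C.
  rewrite /eis_const -(fmorph_rat (real_complex R)) -rmorphN -rmorphM /=.
  congr (_%:C)%C; rewrite fmorph_div /= bernoulli_even// ratr_nat /=.
  rewrite doubleS factS natrM natrM exprS.
  have : l.*2.+2%:R != 0 :> R by rewrite pnatr_eq0.
  by move=> h; field.
by apply: csumZ; apply: csum_real; exact: cvg_even_zeta.
Qed.

Lemma eis_const_neq0 l : eis_const l.+1.*2 != 0.
Proof.
rewrite /eis_const oppr_eq0 fmorph_eq0; apply: mulf_neq0; last first.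
  by rewrite invr_neq0// pnatr_eq0 -lt0n muln_gt0.
rewrite -(fmorph_eq0 (@ratr R)) /= bernoulli_even//.
rewrite mulf_neq0 ?pnatr_eq0 -?lt0n ?fact_gt0// mulf_neq0//; last first.
  by rewrite lt0r_neq0// even_zeta_gt0.
by rewrite mulf_neq0// signr_eq0.
Qed.

Definition pole_pair s z (d n : nat) : R[i] :=
  pole s (d.+1%:R * z + n.+1%:R) + pole s (d.+1%:R * z - n.+1%:R).

Lemma upperS z : upper_half_plane z -> upper_half_plane (- z^-1).
Proof.
case: z => a b; rewrite /upper_half_plane /= => b0.
by rewrite opprK mulr_gt0// invr_gt0 ltr_wpDl ?sqr_ge0// exprn_gt0.
Qed.

(** Inversion exchanges the two lattice coordinates; the sign it creates disappears because the
    exponent is even. *)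
Lemma pole_pairS l z d n : upper_half_plane z ->
  pole_pair l.*2.+1 (- z^-1) d n = z ^+ l.+1.*2 * pole_pair l.*2.+1 z n d.
Proof.
move=> z0; have z1 := upper_neq0 z0; rewrite /pole_pair doubleS.
have -> : d.+1%:R * (- z^-1) + n.+1%:R = (n.+1%:R * z - d.+1%:R) * z^-1 :> R[i].
  by field.
have -> : d.+1%:R * (- z^-1) - n.+1%:R = - ((n.+1%:R * z + d.+1%:R) * z^-1) :> R[i].
  by field.
rewrite poleN ?oddS ?odd_double// !poleM exprVn invrK -mulrDl mulrC.
by congr (_ * _); rewrite addrC.
Qed.

Lemma csum_pole_pair s z d : upper_half_plane z ->
  csum (pole_pair s z d) (cotsum s (d.+1%:R * z) - pole s (d.+1%:R * z)).
Proof. by move=> z0; apply: lipschitz; exact: upper_mulnl. Qed.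

(** The rows contain the points (d, n) with d and n both nonzero. The two constants removed from
    E_k(z) are the contributions of the axes (0, n) and (d, 0). *)
Lemma csum_pole_pair_rows l z : upper_half_plane z ->
  csum (fun d => cotsum l.*2.+1 (d.+1%:R * z) - pole l.*2.+1 (d.+1%:R * z))
   (eisenstein l.+1.*2 z - eis_const l.+1.*2 - eis_const l.+1.*2 / z ^+ l.+1.*2).
Proof.
move=> z0; have [_ h] := csum_eisenstein l.*2 z0.
rewrite doubleS; apply: csumD.
  by apply: eq_csum h => d; rewrite /cotsum /= mul0r subr0.
apply: csumN; rewrite mulrC; apply: eq_csum (csumZ _ (csum_pole_nat l)) => d.
by rewrite poleM mulrC.
Qed.

(** The columns at z are, up to z^k, the rows at -1/z, and the same two constants appear. Equality
    of the row and column totals is thus the modularity of E_k under inversion. *)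
Lemma csum_pole_pair_cols l z : upper_half_plane z ->
  exists Scol, (forall n, csum (fun d => pole_pair l.*2.+1 z d n) (Scol n)) /\
  csum Scol (eisenstein l.+1.*2 (- z^-1) / z ^+ l.+1.*2
             - eis_const l.+1.*2 - eis_const l.+1.*2 / z ^+ l.+1.*2).
Proof.
move=> z0; have z1 := upper_neq0 z0; have z0' := upperS z0.
have zk : z ^+ l.+1.*2 != 0 by rewrite expf_neq0.
exists (fun n => (z ^+ l.+1.*2)^-1 * (cotsum l.*2.+1 (n.+1%:R * - z^-1) - pole l.*2.+1 (n.+1%:R * - z^-1))).
split=> [n|].
  apply: eq_csum (csumZ _ (csum_pole_pair l.*2.+1 n z0')) => d.
  by rewrite pole_pairS// mulKf.
have := csumZ (z ^+ l.+1.*2)^-1 (csum_pole_pair_rows l z0').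
have -> : (- z^-1) ^+ l.+1.*2 = (z ^+ l.+1.*2)^-1.
  by rewrite (expr_double (- z^-1)) sqrrN -expr_double exprVn.
by congr csum; field.
Qed.

Lemma cabs_lattice_nat_ge z : upper_half_plane z -> exists2 c : R, 0 < c &
  forall (d n : nat) (e : R), `|e| <= 1 / 2 ->
    c * (d.+1%:R + n.+1%:R) <= cabs (d.+1%:R * z + n.+1%:R + (e%:C)%C) /\
    c * (d.+1%:R + n.+1%:R) <= cabs (d.+1%:R * z - n.+1%:R + (e%:C)%C).
Proof.
move=> z0; have [c c0 hc] := cabs_lattice_ge z0.
exists (c / 2); first by rewrite divr_gt0.
move=> d n e he.
have natC (m : nat) : m%:R = ((m%:R : R)%:C)%C by rewrite rmorph_nat.
have n1 : 1 <= n.+1%:R :> R by rewrite ler1n.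
have d1 : 1 <= d.+1%:R :> R by rewrite ler1n.
have H (b : R) : `|b| = n.+1%:R ->
    c / 2 * (d.+1%:R + n.+1%:R) <= cabs (d.+1%:R * z + ((b + e)%:C)%C).
  move=> hb; rewrite natC; apply: le_trans (hc _ _).
  rewrite -mulrA ler_pM2l// ger0_norm//.
  have : `|b| <= `|b + e| + `|e| by have := ler_normB (b + e) e; rewrite addrK.
  by rewrite hb; lra.
split.
  have := H n.+1%:R; rewrite normr_nat => /(_ erefl).
  by rewrite rmorphD rmorph_nat addrA.
have := H (- n.+1%:R); rewrite normrN normr_nat => /(_ erefl).
by rewrite rmorphD rmorphN rmorph_nat addrA.
Qed.

Lemma sqr_sum_ge (a b : R) : 1 <= a -> 1 <= b -> a ^+ 2 * b ^+ 2 <= (a + b) ^+ 4.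
Proof.
move=> a1 b1; rewrite -exprMn [(a + b) ^+ 4](exprM _ 2 2).
by rewrite lerXn2r ?nnegrE; nra.
Qed.

Lemma sqr_le_lattice_exp (d n m : nat) : (4 <= m)%N ->
  (d.+1%:R + n.+1%:R) ^- m <= d.+1%:R ^- 2 * n.+1%:R ^- 2 :> R.
Proof.
move=> m4; have n1 : 1 <= n.+1%:R :> R by rewrite ler1n.
have d1 : 1 <= d.+1%:R :> R by rewrite ler1n.
have dn : 0 < d.+1%:R + n.+1%:R :> R by rewrite addr_gt0// ltr0n.
rewrite -invfM lef_pV2 ?posrE; [|by apply: exprn_gt0|by apply: mulr_gt0; apply: exprn_gt0].
apply: le_trans (sqr_sum_ge d1 n1) _.
by rewrite ler_weXn2l//; lra.
Qed.

(** Each pole is O((d + n)^-k), which for k >= 4 is at most d^-2 n^-2 up to a constant; the row and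
    column totals then agree, and the axis terms cancel. *)
Lemma eisenstein_S_ge4 l z : upper_half_plane z ->
  eisenstein l.+2.*2 (- z^-1) = z ^+ l.+2.*2 * eisenstein l.+2.*2 z.
Proof.
move=> z0; have [c c0 hc] := cabs_lattice_nat_ge z0.
have zk : z ^+ l.+2.*2 != 0 by rewrite expf_neq0// upper_neq0.
pose s := l.+1.*2.+1; pose t := cabs twopii * c.
have tau0 : 0 < cabs (@twopii R) by rewrite cabs_gt0 twopii_neq0.
have t0 : 0 < t by rewrite mulr_gt0.
pose B : R := s`!%:R / t ^+ s.+1.
have B0 : 0 < B by rewrite divr_gt0 ?ltr0n ?fact_gt0// exprn_gt0.
have pb x (m : R) : 0 < m -> c * m <= cabs x -> cabs (pole s x) <= B * m ^- s.+1.
  move=> m0 hx; rewrite /pole cabsM cabs_nat cabsV cabsX cabsN cabsM /B.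
  rewrite -mulrA ler_pM2l ?ltr0n ?fact_gt0// -invfM -exprMn.
  have h0 : 0 < t * m by rewrite mulr_gt0.
  have h : t * m <= cabs (@twopii R) * cabs x by rewrite /t -mulrA ler_pM2l.
  rewrite lef_pV2 ?posrE; [|exact/exprn_gt0/(lt_le_trans h0)|exact: exprn_gt0].
  by rewrite lerXn2r ?nnegrE// ltW// (lt_le_trans h0).
have [|Srow [Scol [S [h1 h2 h3 h4]]]] := @csum_swap_inv_sqr R (pole_pair s z) (2 * B).
  move=> d n; have dn : 0 < d.+1%:R + n.+1%:R :> R by rewrite addr_gt0// ltr0n.
  have [] := hc d n 0; first by rewrite normr0.
  rewrite !addr0 => /(pb _ _ dn) b1 /(pb _ _ dn) b2.
  have b3 : B * (d.+1%:R + n.+1%:R) ^- s.+1 <= B * d.+1%:R ^- 2 * n.+1%:R ^- 2.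
    by rewrite -mulrA ler_pM2l// sqr_le_lattice_exp.
  have := ler_cabsD (pole s (d.+1%:R * z + n.+1%:R)) (pole s (d.+1%:R * z - n.+1%:R)).
  rewrite -/(pole_pair s z d n) => b4.
  by apply: (le_trans b4); apply: (le_trans (lerD (le_trans b1 b3) (le_trans b2 b3))); rewrite -!mulrA mulr2n mulrDl mul1r.
have hrow : csum Srow (eisenstein l.+2.*2 z - eis_const l.+2.*2 - eis_const l.+2.*2 / z ^+ l.+2.*2).
  apply: eq_csum (csum_pole_pair_rows l.+1 z0) => d.
  exact: (csum_unique (csum_pole_pair _ d z0) (h1 d)).
have [Scol' [h5 h6]] := csum_pole_pair_cols l.+1 z0.
have hcol := eq_csum (fun n => csum_unique (h5 n) (h2 n)) h6.
have := csum_unique hcol h4; rewrite (csum_unique h3 hrow) => /addIr/addIr h.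
by rewrite -[LHS](divfK zk) h mulrC.
Qed.

(* Comparison term for the conditionally convergent weight 2 sum: it telescopes
   along integer translates and agrees with [pole 1] up to O(x^-4). *)
Definition tele x : R[i] :=
  twopii ^- 2 * ((x - ((1 / 2)%:C)%C)^-1 - (x + ((1 / 2)%:C)%C)^-1).

Lemma pole_sub_tele x : let h := ((1 / 2)%:C)%C in
  x != 0 -> x - h != 0 -> x + h != 0 ->
  pole 1 x - tele x = twopii ^- 2 * (- 4^-1 / (x ^+ 2 * ((x - h) * (x + h)))).
Proof.
move=> h; rewrite /tele -/h /pole sqrrN exprMn (_ : 1`!%:R = 1)//.
have hE : h = 2^-1 by rewrite /h rmorphM rmorph1 mul1r fmorphV rmorph_nat.
have -> : 4^-1 = h ^+ 2 :> R[i] by rewrite hE; field.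
have : h + h = 1 by rewrite hE; field.
move: h {hE} => h h1 x0 x1 x2.
have -> : (x - h)^-1 - (x + h)^-1 = (h + h) / ((x - h) * (x + h)).
  by field; rewrite x1 x2.
by rewrite h1; field; rewrite x0 x1 x2 twopii_neq0.
Qed.

(** Removing the comparison array [Q] leaves [Rm] absolutely summable, with equal totals [S] by rows
    and by columns. The defect is thus the difference of the two iterated sums of [Q], both of which
    are computable. *)
Lemma eisenstein_S_2 z : upper_half_plane z ->
  eisenstein 2 (- z^-1) = z ^+ 2 * eisenstein 2 z - z / (2 * twopii).
Proof.
move=> z0; have [c c0 hc] := cabs_lattice_nat_ge z0.
have z1 := upper_neq0 z0.
have tau0 := @twopii_neq0 R.
pose hf : R[i] := ((1 / 2)%:C)%C.
have hf2 : hf = 2^-1 by rewrite /hf rmorphM rmorph1 mul1r fmorphV rmorph_nat.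
have nhalf : `|1 / 2| <= 1 / 2 :> R by rewrite ger0_norm.
have nhalfN : `|- (1 / 2)| <= 1 / 2 :> R by rewrite normrN.
have cpos d n : 0 < c * (d.+1%:R + n.+1%:R) by rewrite mulr_gt0// addr_gt0// ltr0n.
pose X1 (d n : nat) := d.+1%:R * z + n.+1%:R; pose X2 (d n : nat) := d.+1%:R * z - n.+1%:R.
pose Q d n := tele (X1 d n) + tele (X2 d n).
pose Rm d n := pole_pair 1 z d n - Q d n.
pose T := cabs ((@twopii R) ^- 2).
have rb x (m : R) : 0 < m -> m <= cabs x -> m <= cabs (x - hf) -> m <= cabs (x + hf) ->
    cabs (pole 1 x - tele x) <= T * m ^- 4.
  move=> m0 h1 h2 h3.
  have x0 : x != 0 by rewrite -cabs_gt0 (lt_le_trans m0).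
  have x1 : x - hf != 0 by rewrite -cabs_gt0 (lt_le_trans m0).
  have x2 : x + hf != 0 by rewrite -cabs_gt0 (lt_le_trans m0).
  have -> : pole 1 x - tele x = twopii ^- 2 * (- 4^-1 / (x ^+ 2 * ((x - hf) * (x + hf)))).
    exact: pole_sub_tele.
  rewrite (cabsM (twopii ^- 2)) ler_wpM2l ?cabs_ge0//.
  rewrite (cabsM (- 4^-1)) cabsN !cabsV cabs_nat (cabsM (x ^+ 2)) cabsX (cabsM (x - hf)).
  apply: (@le_trans _ _ (cabs x ^+ 2 * (cabs (x - hf) * cabs (x + hf)))^-1).
    rewrite ler_piMl ?invr_ge0 ?mulr_ge0 ?exprn_ge0 ?cabs_ge0//.
    by rewrite invf_le1// ler1n.
  rewrite lef_pV2 ?posrE; last 2 first.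
  - by rewrite !mulr_gt0 ?exprn_gt0// cabs_gt0.
  - by rewrite exprn_gt0.
  rewrite (exprD m 2 2); apply: ler_pM; rewrite ?exprn_ge0 ?(ltW m0)//.
    by rewrite lerXn2r ?nnegrE ?(ltW m0) ?cabs_ge0.
  by rewrite expr2; apply: ler_pM; rewrite ?(ltW m0).
have [|Srow [Scol [S [h1 h2 h3 h4]]]] := @csum_swap_inv_sqr R Rm (2 * T * c ^- 4).
  move=> d n; have [a1 a2] := hc d n _ nhalf; have [a3 a4] := hc d n _ nhalfN.
  have [] := hc d n 0; first by rewrite normr0.
  rewrite !addr0 => a5 a6; rewrite rmorphN in a3 a4.
  have b1 := rb _ _ (cpos d n) a5 a3 a1; have b2 := rb _ _ (cpos d n) a6 a4 a2.
  have -> : Rm d n = (pole 1 (X1 d n) - tele (X1 d n)) + (pole 1 (X2 d n) - tele (X2 d n)).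
    by rewrite /Rm /pole_pair /Q -/(X1 d n) -/(X2 d n); ring.
  apply: (le_trans (ler_cabsD _ _)); apply: (le_trans (lerD b1 b2)).
  have b3 : (c * (d.+1%:R + n.+1%:R)) ^- 4 <= c ^- 4 * (d.+1%:R ^- 2 * n.+1%:R ^- 2).
    rewrite exprMn invfM ler_wpM2l ?invr_ge0 ?exprn_ge0 ?(ltW c0)//.
    exact: sqr_le_lattice_exp.
  have b4 : T * (c * (d.+1%:R + n.+1%:R)) ^- 4 <= T * (c ^- 4 * (d.+1%:R ^- 2 * n.+1%:R ^- 2)).
    by rewrite ler_wpM2l// cabs_ge0.
  apply: le_trans (lerD b4 b4) _; rewrite le_eqVlt; apply/orP; left; apply/eqP.
  by ring.
pose E0 := eis_const 2; pose E := eisenstein 2 z - E0 - E0 / z ^+ 2.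
pose E' := eisenstein 2 (- z^-1) / z ^+ 2 - E0 - E0 / z ^+ 2.
have hrow : csum (fun d => cotsum 1 (d.+1%:R * z) - pole 1 (d.+1%:R * z)) E.
  exact: (csum_pole_pair_rows 0 z0).
have [Pcol [h5 h6]] := csum_pole_pair_cols 0 z0.
rewrite -/E0 -/E' in h6.
pose Qcol n := Pcol n - Scol n.
have hQcol n : csum (Q^~ n) (Qcol n).
  apply: (@eq_csum _ (fun d => pole_pair 1 z d n - Rm d n)) => [d|].
    by rewrite /Rm; ring.
  by apply: csumD; [exact: h5|apply: csumN; exact: h2].
have hQcolsum : csum Qcol (E' - S) by apply: csumD => //; apply: csumN.
pose a (N : nat) : R[i] := N%:R + hf.
(* The translates by -N, ..., N telescope, and the missing n = 0 is subtracted. The boundary terms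
   sit at the half-integer [a N]; they vanish in the limit for fixed d, but not after summation over
   d. *)
have Qpart d N : series (Q d) N = - tele (d.+1%:R * z) +
    twopii ^- 2 * ((d.+1%:R * z - a N)^-1 - (d.+1%:R * z + a N)^-1).
  elim: N => [|N IH].
    by rewrite /series/= big_geq// /tele /a -/hf add0r; ring.
  rewrite /series/= big_nat_recr//= -[X in X + _]/(series (Q d) N) IH.
  rewrite /Q /X1 /X2 /tele -/hf /a.
  have -> : d.+1%:R * z + N.+1%:R - hf = d.+1%:R * z + (N%:R + hf).
    by rewrite hf2 -natr1; field.
  have -> : d.+1%:R * z - N.+1%:R + hf = d.+1%:R * z - (N%:R + hf).
    by rewrite hf2 -natr1; field.
  by rewrite -!addrA -opprD; ring.
have awup N : upper_half_plane (- (a N / z)).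
  have -> : - (a N / z) = - z^-1 * (((N%:R + 1 / 2 : R)%:C)%C).
    by rewrite rmorphD rmorph_nat -/hf -/(a N); ring.
  by apply: upper_real_scale; [rewrite ltr_wpDl|exact: upperS].
pose w N := - (a N / z).
pose V N := - twopii * (cotsum 0 (w N) - pole 0 (w N)) / z.
have aneq N : a N != 0.
  have := upper_neq0 (awup N); rewrite oppr_eq0 mulf_eq0 negb_or.
  by case/andP.
have dzneq d N : d.+1%:R * z - a N != 0 /\ d.+1%:R * z + a N != 0.
  have w1 : upper_half_plane (w N + d.+1%:R) by exact: (@upperD_int _ (w N) d.+1%:Z (awup N)).
  have w2 : upper_half_plane (w N - d.+1%:R).
    by have := @upperD_int _ (w N) (- d.+1%:Z) (awup N); rewrite mulrNz.
  have -> : d.+1%:R * z - a N = z * (w N + d.+1%:R) by rewrite /w; field.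
  have -> : d.+1%:R * z + a N = - z * (w N - d.+1%:R) by rewrite /w; field.
  by rewrite !mulf_neq0 ?oppr_eq0// upper_neq0.
(* Divided by z, the boundary terms are the poles of the cotangent series at w = -a/z, summed over
   d. *)
have hV N : csum (fun d => (d.+1%:R * z - a N)^-1 - (d.+1%:R * z + a N)^-1) (V N).
  have := csumZ (- twopii / z) (lipschitz 0 (awup N)).
  rewrite /V mulrAC; apply: eq_csum => d; rewrite -/(w N).
  have [n1 n2] := dzneq d N.
  have -> : w N + d.+1%:R = (d.+1%:R * z - a N) / z by rewrite /w; field.
  have -> : w N - d.+1%:R = - (d.+1%:R * z + a N) / z by rewrite /w; field.
  rewrite /pole fact0 !expr1.
  by move: n1 n2; move: (d.+1%:R * z - a N) (d.+1%:R * z + a N) => u v u0 v0; field; rewrite u0 v0 z1 tau0.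
have hQrow : csum (fun d => - tele (d.+1%:R * z)) (E - S).
  suff Qr d : Srow d = cotsum 1 (d.+1%:R * z) - pole 1 (d.+1%:R * z) + tele (d.+1%:R * z).
    apply: (@eq_csum _ (fun d => cotsum 1 (d.+1%:R * z) - pole 1 (d.+1%:R * z) - Srow d)).
      by move=> d; rewrite Qr; ring.
    by apply: csumD => //; exact: csumN.
  apply: csum_unique (h1 d) _.
  apply: csumD; first exact: (csum_pole_pair 1 d z0).
  rewrite -[tele _]opprK; apply: csumN.
  rewrite /csum (_ : series (Q d) = fun N => - tele (d.+1%:R * z) +
    twopii ^- 2 * ((d.+1%:R * z - a N)^-1 - (d.+1%:R * z + a N)^-1)); last exact/funext/Qpart.
  have -> : ccvg (fun N => - tele (d.+1%:R * z) +
    twopii ^- 2 * ((d.+1%:R * z - a N)^-1 - (d.+1%:R * z + a N)^-1)) (- tele (d.+1%:R * z)) =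
   ccvg (fun N => - tele (d.+1%:R * z) +
    twopii ^- 2 * ((d.+1%:R * z - a N)^-1 - (d.+1%:R * z + a N)^-1)) (- tele (d.+1%:R * z) +
    twopii ^- 2 * (0 - 0)) by rewrite subr0 mulr0 addr0.
  apply: ccvgD; first exact: ccvg_cst.
  apply: ccvgM; first exact: ccvg_cst.
  have inv0 (b : R[i]) (sg : R[i]) : cabs sg = 1 -> ccvg (fun N => (b + sg * a N)^-1) 0.
    move=> sg1; apply: (@ccvg_eventually _ (fun N => (b + sg * a N)^-1) _ _ 0) => //.
    apply/ccvg_cabsP; apply/cvgrPdist_lt => e e0.
    exists (Num.truncn (e^-1 + cabs b)).+1 => // N /= hN.
    have hN' : e^-1 + cabs b < N%:R.
      apply: lt_le_trans (_ : (Num.truncn (e^-1 + cabs b)).+1%:R <= _); last by rewrite ler_nat.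
      by rewrite truncnS_gt.
    rewrite sub0r normrN sub0r cabsN cabsV ger0_norm ?invr_ge0 ?cabs_ge0//.
    have aN : N%:R <= cabs (sg * a N).
      rewrite cabsM sg1 mul1r; apply: le_trans (ler_Re_cabs _).
      have -> : a N = ((N%:R + 1 / 2 : R)%:C)%C by rewrite rmorphD rmorph_nat.
      by rewrite /= ger0_norm// ?addr_ge0// lerDl.
    have := lerB_cabs (sg * a N) (- b); rewrite opprK cabsN addrC => hb.
    have hx : e^-1 < cabs (b + sg * a N).
      rewrite (addrC b); apply: lt_le_trans hb.
      by rewrite addrC ltrBrDr; exact: lt_le_trans hN' aN.
    have hx0 : 0 < cabs (b + sg * a N) by apply: lt_trans hx; rewrite invr_gt0.
    by rewrite -[ltRHS]invrK ltf_pV2 ?posrE ?invr_gt0.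
  apply: ccvgB.
    have := inv0 (d.+1%:R * z) (-1); rewrite cabsN cabs1 => /(_ erefl).
    by congr ccvg; apply/funext => N; rewrite mulN1r.
  have := inv0 (d.+1%:R * z) 1; rewrite cabs1 => /(_ erefl).
  by congr ccvg; apply/funext => N; rewrite mul1r.
have hser N : series Qcol N = E - S + twopii ^- 2 * V N.
  have g1 : csum (fun d => \sum_(n <- index_iota 0 N) Q d n) (\sum_(n <- index_iota 0 N) Qcol n).
    by apply: csum_big => n _; exact: hQcol.
  apply: csum_unique g1 _.
  apply: (@eq_csum _ (fun d => - tele (d.+1%:R * z) +
    twopii ^- 2 * ((d.+1%:R * z - a N)^-1 - (d.+1%:R * z + a N)^-1))).
    by move=> d; rewrite -Qpart.
  by apply: csumD => //; apply: csumZ.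
have wbig : ccvg (fun N => nome (w N)) 0.
  pose y := complex.Im (- z^-1); have y0 : 0 < y := upperS z0.
  pose r := expR (- (2 * pi * y)).
  have r0 : 0 <= r by exact: expR_ge0.
  have r1 : r < 1 by rewrite expR_lt1 oppr_lt0 !mulr_gt0// pi_gt0.
  apply: (@ccvg0_cabs_le _ _ (GRing.exp r)) => [N|]; last by apply: cvg_expr; rewrite ger0_norm.
  rewrite cabs_nome /r -expRM_natl ler_expR mulrN lerN2.
  have -> : w N = - z^-1 * (((N%:R + 1 / 2 : R)%:C)%C).
    by rewrite /w rmorphD rmorph_nat -/hf -/(a N); ring.
  have -> : complex.Im (- z^-1 * (((N%:R + 1 / 2 : R)%:C)%C)) = y * (N%:R + 1 / 2).
    by rewrite /y; case: (- z^-1) => u v /=; ring.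
  have pi0 := @pi_gt0 R; have N0 : 0 <= N%:R :> R by [].
  have : 0 <= pi * y by rewrite mulr_ge0 ?ltW.
  by nra.
have winv : ccvg (fun N => (w N)^-1) 0.
  apply: (@ccvg0_cabs_le _ _ (fun N => (cabs z * 2) * (N.+1%:R^-1))) => [N|]; last first.
    rewrite -[X in _ --> X](mulr0 (cabs z * 2)); apply: cvgMl_tmp; exact: cvg_harmonic.
  rewrite /w invrN invf_div cabsN cabsM cabsV -mulrA ler_wpM2l ?cabs_ge0//.
  have -> : a N = ((N%:R + 1 / 2 : R)%:C)%C by rewrite rmorphD rmorph_nat.
  rewrite cabs_real ger0_norm ?addr_ge0//.
  have N0 : 0 <= N%:R :> R by [].
  have -> : 2 * N.+1%:R^-1 = (N.+1%:R / 2)^-1 :> R by rewrite invf_div.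
  have E1 : N.+1%:R = N%:R + 1 :> R by rewrite natr1.
  by rewrite E1 lef_pV2 ?posrE; [lra|lra|lra].
(* As Im w grows, q tends to 0, so [cotsum 0] tends to 1 - 1/2 and its pole to 0. This surviving 1/2
   is the source of the defect z / (2 twopii). *)
have hVlim : ccvg V (- twopii * (1 - 1 / 2 - 0) / z).
  apply: ccvgM; last exact: ccvg_cst.
  apply: ccvgM; first exact: ccvg_cst.
  apply: ccvgB.
    rewrite /cotsum; apply: ccvgB; last exact: ccvg_cst.
    rewrite -[X in ccvg _ X]invr1 -[X in X^-1]subr0.
    rewrite (_ : (fun N => _) = fun N => (1 - nome (w N))^-1).
      apply: ccvgV; first by rewrite subr0 oner_eq0.
      by apply: ccvgB => //; exact: ccvg_cst.
    by apply/funext => N; rewrite powsum0E//; exact: cabs_nome_lt1 (awup N).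
  rewrite -(mulr0 (- twopii)^-1).
  rewrite (_ : (fun N => _) = fun N => (- twopii)^-1 * (w N)^-1).
    by apply: ccvgM => //; exact: ccvg_cst.
  by apply/funext => N; rewrite /pole fact0 expr1 div1r -mulNr invfM.
have : csum Qcol (E - S + twopii ^- 2 * (- twopii * (1 - 1 / 2 - 0) / z)).
  rewrite /csum (_ : series Qcol = fun N => E - S + twopii ^- 2 * V N); last exact/funext/hser.
  by apply: ccvgD; [exact: ccvg_cst|apply: ccvgM => //; exact: ccvg_cst].
move=> /(csum_unique hQcolsum); rewrite /E' /E => hfin.
have {}hfin : eisenstein 2 (- z^-1) / z ^+ 2 = eisenstein 2 z + twopii ^- 2 * (- twopii * (1 - 1 / 2 - 0) / z).
  by move: hfin => /(congr1 (fun u => u + S + E0 / z ^+ 2 + E0)); rewrite !subrK => ->; ring.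
have -> : eisenstein 2 (- z^-1) = z ^+ 2 * (eisenstein 2 (- z^-1) / z ^+ 2).
  by rewrite mulrC divfK// expf_neq0.
rewrite hfin; move: (eisenstein 2 z) => F.
by field; rewrite z1 tau0.
Qed.

End Modularity.

(** * Transformation of E_k under SL2(Z) *)

Section ModularGroup.
Context {R : realType}.
Implicit Types (w z q : R[i]).

Lemma eisenstein_shift k z (n : int) : eisenstein k (z + n%:~R) = eisenstein k z.
Proof. by rewrite /eisenstein nomeD nome_int mulr1. Qed.

(** It vanishes unless k = 2, so that all weights share one transformation law. *)
Definition quasi_coef (k : nat) : R[i] := (k == 2%N)%:R / (2 * twopii).

Lemma eisenstein_S l z : upper_half_plane z ->
  eisenstein l.+1.*2 (- z^-1) =
  z ^+ l.+1.*2 * eisenstein l.+1.*2 z - quasi_coef l.+1.*2 * z.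
Proof.
case: l => [|l] z0; rewrite /quasi_coef.
  by rewrite eisenstein_S_2// eqxx mul1r [_^-1 * _]mulrC.
by rewrite eisenstein_S_ge4// mul0r mul0r subr0.
Qed.

Lemma upper_lin_neq0 (c d : int) z : upper_half_plane z ->
  (c != 0) || (d != 0) -> c%:~R * z + d%:~R != 0.
Proof.
move=> z0 cd; have [c0|c0] := eqVneq c 0.
  by rewrite c0 mul0r add0r intr_eq0; move: cd; rewrite c0 eqxx.
apply/eqP => /(congr1 (@complex.Im R)).
rewrite -!(rmorph_int (real_complex R)); case: z z0 => x y; rewrite /upper_half_plane /= => y0.
move=> /eqP; rewrite mul0r !addr0 mulf_eq0 intr_eq0 (negbTE c0) /=.
by rewrite gt_eqF.
Qed.

(** Euclid's algorithm on the first column: dividing a by c writes g z as m - 1/w, where w is the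
    image of z under a matrix whose lower left entry is a mod c. For c = 0 the matrix is a
    translation up to sign. *)
Lemma eisenstein_SL2 l (a b c d : int) z : a * d - b * c = 1 ->
  upper_half_plane z ->
  let j := c%:~R * z + d%:~R in
  upper_half_plane ((a%:~R * z + b%:~R) / j) /\
  eisenstein l.+1.*2 ((a%:~R * z + b%:~R) / j) =
    j ^+ l.+1.*2 * eisenstein l.+1.*2 z - quasi_coef l.+1.*2 * c%:~R * j.
Proof.
move=> + z0; have [n] := ubnP (absz c); elim: n a b c d => // n IH a b c d cn det j.
have [c0|c0] := eqVneq c 0.
  have ad : (a = 1 /\ d = 1) \/ (a = -1 /\ d = -1).
    move: det; rewrite c0 mulr0 subr0 => det1.
    have a1 : absz a = 1%N.
      by apply/eqP; rewrite -dvdz1; apply/dvdzP; exists d; rewrite mulrC; exact/esym.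
    have [a1'|a1'] : a = 1 \/ a = -1 by lia.
      by left; move: det1; rewrite a1'; lia.
    by right; move: det1; rewrite a1'; lia.
  rewrite /j c0 mul0r add0r mulr0 mul0r subr0.
  have -> : (a%:~R * z + b%:~R) / d%:~R = z + (b * d)%:~R.
    case: ad => -[-> ->]; first by rewrite divr1 mul1r mulr1.
    by rewrite !mulrNz mulN1r mulrN1 mulrNz invrN invr1 mulrN1 opprD opprK.
  rewrite eisenstein_shift; split; first exact: upperD_int.
  case: ad => -[_ ->]; first by rewrite expr1n mul1r.
  by rewrite mulrNz expr_double sqrrN !expr1n mul1r.
pose m := (a %/ c)%Z; pose a' := (a %% c)%Z; pose b' := b - m * d.
have aE : a = m * c + a' by exact: divz_eq.
have a'0 : 0 <= a' by exact: modz_ge0.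
have a'c : a' < `|c|%R by exact: ltz_mod.
have det' : - c * b' - (- d) * a' = 1 by rewrite /b'; nia.
have a'n : (absz a' < n)%N by lia.
pose j' : R[i] := a'%:~R * z + b'%:~R.
pose w : R[i] := ((- c)%:~R * z + (- d)%:~R) / j'.
have [w0 Ew] : upper_half_plane w /\ eisenstein l.+1.*2 w =
    j' ^+ l.+1.*2 * eisenstein l.+1.*2 z - quasi_coef l.+1.*2 * a'%:~R * j'.
  exact: IH _ _ _ _ a'n det'.
have j'0 : j' != 0.
  apply: upper_lin_neq0 => //; apply/negPn/negP; rewrite negb_or !negbK.
  by move=> /andP[/eqP e1 /eqP e2]; move: det'; rewrite e1 e2; lia.
have j0 : j != 0 by apply: upper_lin_neq0 => //; rewrite c0.
have wE : w = - (j / j').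
  by rewrite /w /j !mulrNz; field.
have gE : (a%:~R * z + b%:~R) / j = - w^-1 + m%:~R.
  rewrite wE invrN opprK invf_div; apply: (mulIf j0).
  rewrite divfK// mulrDl divfK// /j' /j /b' aE !(rmorphD, rmorphB, rmorphM) /=.
  by ring.
rewrite gE; split; first by apply: upperD_int; exact: upperS.
rewrite eisenstein_shift eisenstein_S// Ew mulrBr.
have -> : w ^+ l.+1.*2 * (j' ^+ l.+1.*2 * eisenstein l.+1.*2 z) =
    j ^+ l.+1.*2 * eisenstein l.+1.*2 z.
  rewrite mulrA; congr (_ * _).
  by rewrite wE (expr_double (- _)) sqrrN -expr_double -exprMn divfK.
rewrite -addrA; congr (_ + _); rewrite /quasi_coef.
case: l {IH Ew} => [|l]; last by rewrite !mul0r mulr0 !subr0.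
(* The determinant relation a' d - b' c = 1, rewritten through the two automorphy factors; it makes
   the weight 2 defects of the two steps add up. *)
have hk : a'%:~R * j - 1 = c%:~R * j'.
  have e1 : (a' * d - b' * c)%:~R = 1 :> R[i].
    by rewrite (_ : a' * d - b' * c = 1)//; nia.
  move: e1; rewrite rmorphB !rmorphM /= => e1.
  by rewrite -[X in _ - X]e1 /j /j'; ring.
rewrite wE; move: (_ / (2 * twopii)) => K.
rewrite -[1.*2]/2%N.
have -> : K * c%:~R * j = K * (j * (c%:~R * j') / j').
  by field.
rewrite -hk.
by field.
Qed.

(* The factorization diag(A D, 1) g = g' [A, B; 0, D] with g' in SL2(Z),
   written on coefficients. *)
Lemma eisenstein_slash l (A D : nat) (a b c d c' B d' : int) z :
  (0 < A)%N -> (0 < D)%N -> a * d - b * c = 1 -> c = A%:Z * c' ->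
  c' * B + D%:Z * d' = d -> upper_half_plane z ->
  let j := c%:~R * z + d%:~R in
  j ^- l.+1.*2 * eisenstein l.+1.*2 ((A * D)%:R * ((a%:~R * z + b%:~R) / j)) =
  D%:R ^- l.+1.*2 * eisenstein l.+1.*2 ((A%:R * z + B%:~R) / D%:R)
  - quasi_coef l.+1.*2 * (c%:~R / j) / (A * D)%:R.
Proof.
move=> A0 D0 det cE dE z0 j.
have A1 : A%:R != 0 :> R[i] by rewrite pnatr_eq0 -lt0n.
have D1 : D%:R != 0 :> R[i] by rewrite pnatr_eq0 -lt0n.
have j0 : j != 0.
  apply: upper_lin_neq0 => //; apply/negPn/negP; rewrite negb_or !negbK.
  by move=> /andP[/eqP e1 /eqP e2]; move: det; rewrite e1 e2; lia.
pose w := (A%:R * z + B%:~R) / D%:R.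
have w0 : upper_half_plane w.
  by apply: upper_divn => //; apply: upperD_int; exact: upper_mulnl.
have det' : (D%:Z * a) * d' - (A%:Z * b - a * B) * c' = 1.
  by rewrite -det cE -dE; ring.
have [_] := eisenstein_SL2 l det' w0.
set jj := c'%:~R * w + d'%:~R.
have jjE : jj = j / D%:R.
  rewrite /jj /w /j -dE cE !(rmorphD, rmorphM) /= -!pmulrn.
  by field.
have -> : ((D%:Z * a)%:~R * w + (A%:Z * b - a * B)%:~R) / jj =
    (A * D)%:R * ((a%:~R * z + b%:~R) / j).
  rewrite jjE /w !(rmorphD, rmorphB, rmorphM) /= -!pmulrn ?natrM.
  by field; rewrite D1 j0.
move=> ->; rewrite -/w jjE mulrBr; congr (_ - _).
  by rewrite exprMn exprVn -(mulrA (j ^+ _)) mulKf ?expf_neq0.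
rewrite /quasi_coef.
case: l => [|l]; last by rewrite !mul0r mulr0.
rewrite cE rmorphM /= -pmulrn natrM.
move: (_ / (2 * twopii)) => K.
by field; rewrite A1 D1 j0.
Qed.

(** The expansion of E_k after substituting xi q^l for q. *)
Definition eis_coef (k l : nat) (xi : R[i]) (n : nat) : R[i] :=
  if n == 0%N then eis_const k
  else if (l %| n)%N then (sigma k.-1 (n %/ l))%:R * xi ^+ (n %/ l) else 0.

Lemma csum_eis_coef s (l : nat) xi q w : (0 < l)%N -> upper_half_plane w ->
  nome w = xi * q ^+ l ->
  csum (fun n => eis_coef s.+2 l xi n * q ^+ n) (eisenstein s.+2 w).
Proof.
move=> l0 w0 qw; have [h _] := csum_eisenstein s w0.
pose u n := if n == 0%N then eis_const s.+2 else (sigma s.+1 n)%:R * nome w ^+ n.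
have hu : csum u (eisenstein s.+2 w).
  have := @csum_recl _ u _ h; congr csum.
  by rewrite /u eqxx addrC subrK.
apply: eq_csum (csum_stretch l0 hu) => n; rewrite /eis_coef /u.
have [->|n0] := posnP n; first by rewrite dvdn0 div0n eqxx expr0 mulr1.
case: ifP => [ln|_]; last by rewrite mul0r.
rewrite gtn_eqF ?divn_gt0 ?(dvdn_leq n0 ln)// qw exprMn -exprM [(l * _)%N]mulnC divnK//.
by rewrite mulrA.
Qed.

End ModularGroup.

(** * Integral 2 x 2 matrices and their action on cusps *)

Section Matrices2.
Implicit Types (A B g : 'M[int]_2).

Lemma mulmx2E A B i j : (A *m B) i j = A i 0 * B 0 j + A i 1 * B 1 j.
Proof.
rewrite mxE big_ord_recl big_ord1; congr (_ + A i _ * B _ j); exact/val_inj.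
Qed.

Lemma ord2P (i : 'I_2) : i = 0 \/ i = 1.
Proof. by case: i => [[|[|//]] h]; [left|right]; exact/val_inj. Qed.

Lemma det2E A : \det A = A 0 0 * A 1 1 - A 0 1 * A 1 0.
Proof.
rewrite (expand_det_row _ 0) big_ord_recl big_ord1.
rewrite /cofactor !det_mx11 !mxE /= expr0 expr1 mul1r mulN1r mulrN.
by congr (A 0 _ * A _ _ - A 0 _ * A _ _); exact/val_inj.
Qed.

Definition mx2 (a b c d : int) : 'M[int]_2 :=
  \matrix_(i, j) (if i == 0 then (if j == 0 then a else b)
                  else (if j == 0 then c else d)).

Lemma mx2E a b c d : (mx2 a b c d 0 0 = a) * (mx2 a b c d 0 1 = b) *
  (mx2 a b c d 1 0 = c) * (mx2 a b c d 1 1 = d).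
Proof. by rewrite !mxE. Qed.

Lemma eq_mx2 A B : A 0 0 = B 0 0 -> A 0 1 = B 0 1 -> A 1 0 = B 1 0 ->
  A 1 1 = B 1 1 -> A = B.
Proof.
by move=> h1 h2 h3 h4; apply/matrixP => i j; case: (ord2P i) => ->; case: (ord2P j) => ->.
Qed.

Lemma translationE h : translation h = mx2 1 h%:Z 0 1.
Proof.
by apply: eq_mx2; rewrite mx2E !mxE /= ?mulr0 ?mulr1 ?addr0 ?add0r.
Qed.

Lemma det_translation h : \det (translation h) = 1.
Proof. by rewrite translationE det2E !mx2E mulr1 mulr0 subr0. Qed.

Lemma invmx2 g : SL2Z g -> invmx g = mx2 (g 1 1) (- g 0 1) (- g 1 0) (g 0 0).
Proof.
rewrite /SL2Z /= => dg.
have gu : g \in unitmx by rewrite unitmxE dg unitr1.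
set h := mx2 _ _ _ _.
have gh : g *m h = 1%:M.
  move: dg; rewrite det2E => dg.
  by apply: eq_mx2; rewrite mulmx2E !mx2E !mxE /=; lia.
by rewrite -[h](mulKmx gu) gh mulmx1.
Qed.

Lemma det_invmx g : SL2Z g -> \det (invmx g) = 1.
Proof.
by move=> sg; rewrite invmx2// det2E !mx2E; move: sg; rewrite /SL2Z /= det2E; lia.
Qed.

Lemma conj_translation10 g h : SL2Z g ->
  (g *m translation h *m invmx g) 1 0 = - (h%:Z * g 1 0 ^+ 2).
Proof.
by move=> sg; rewrite invmx2// translationE !(mulmx2E, mx2E) expr2; ring.
Qed.

Lemma SL2Z_conj_translation g h : SL2Z g -> SL2Z (g *m translation h *m invmx g).
Proof.
by move=> sg; rewrite /SL2Z /= !det_mulmx det_translation det_invmx// sg !mulr1.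
Qed.

Lemma cusp_act_None g g' : g 0 0 = g' 0 0 -> g 1 0 = g' 1 0 ->
  cusp_act g None = cusp_act g' None.
Proof. by rewrite /cusp_act => -> ->. Qed.

Lemma cusp_act_mul g g' : SL2Z g -> SL2Z g' ->
  cusp_act g' (cusp_act g None) = cusp_act (g' *m g) None.
Proof.
rewrite /SL2Z /= => sg sg'; rewrite /cusp_act !mulmx2E.
have [c0|c0] := eqVneq (g 1 0) 0.
  move: sg; rewrite det2E c0 mulr0 subr0 => ad.
  have a0 : g 0 0 != 0 by apply/eqP => a0; move: ad; rewrite a0 mul0r.
  rewrite !mulr0 !addr0 mulf_eq0 (negbTE a0) orbF; case: ifP => // _.
  rewrite !rmorphM /= -mulf_div divff ?mulr1// intr_eq0//.
have c0' : (g 1 0)%:~R != 0 :> rat by rewrite intr_eq0.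
have -> : (g' 1 0)%:~R * ((g 0 0)%:~R / (g 1 0)%:~R) + (g' 1 1)%:~R =
    (g' 1 0 * g 0 0 + g' 1 1 * g 1 0)%:~R / (g 1 0)%:~R :> rat.
  by rewrite rmorphD !rmorphM /=; field.
rewrite mulf_eq0 invr_eq0 (negbTE c0') orbF intr_eq0; case: ifPn => // h0.
have h0' : (g' 1 0 * g 0 0 + g' 1 1 * g 1 0)%:~R != 0 :> rat by rewrite intr_eq0.
congr Some; move: h0'; rewrite !rmorphD !rmorphM /=.
move: ((g' 1 0)%:~R * _ + _) => v v0.
by field; rewrite v0 c0'.
Qed.

Lemma cusp_lift (r : cusp) : exists2 g, SL2Z g & cusp_act g None = r.
Proof.
case: r => [x|]; last first.
  exists 1%:M; first by rewrite /SL2Z /= det1.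
  by rewrite /cusp_act !mxE.
have [[u v] /= uv] : exists w : int * int, w.1 * numq x + w.2 * denq x = 1.
  have := coprime_num_den x; rewrite -[coprime _ _]/(coprimez (numq x) (denq x)).
  by move=> /coprimezP[[u v] /= h]; exists (u, v).
exists (mx2 (numq x) (- v) (denq x) u).
  by rewrite /SL2Z /= det2E !mx2E; lia.
by rewrite /cusp_act !mx2E denq_eq0 divq_num_den.
Qed.

End Matrices2.

(** * Cusps of Gamma0(p^m): levels, widths and their number *)

Section PrimePowerCusps.
Variables (p m : nat).
Hypothesis p_pr : prime p.
Implicit Types (c d : int) (g : 'M[int]_2).

(* [cusp_level c e]: p^e is the gcd of c and p^m. *)
Definition cusp_level (c : int) (e : nat) : Prop :=
  (e <= m)%N /\ exists u : int, c = (p ^ e)%:Z * u /\ ((e < m)%N -> coprimez u p%:Z).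

Lemma cusp_level_ex c : exists e, cusp_level c e.
Proof.
have [->|c0] := eqVneq c 0.
  by exists m; split => //; exists 0; rewrite mulr0 ltnn.
have c1 : (0 < absz c)%N by rewrite absz_gt0.
have [h|h] := leqP m (logn p (absz c)).
  exists m; split=> //; rewrite ltnn.
  have /dvdzP[u ->] : ((p ^ m)%:Z %| c)%Z.
    by rewrite dvdzE /= pfactor_dvdn.
  by exists u; rewrite mulrC.
exists (logn p (absz c)); split; first exact: ltnW.
have /dvdzP[u cE] : ((p ^ logn p (absz c))%:Z %| c)%Z by rewrite dvdzE /= pfactor_dvdnn.
exists u; split => [|_]; first by rewrite mulrC.
rewrite coprimez_sym /coprimez; apply/eqP.
have : ~~ (p %| absz u)%N.
  apply/negP => /dvdnP[t ut].
  have : (p ^ (logn p (absz c)).+1 %| absz c)%N.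
    have cE' : absz c = (absz u * p ^ logn p (absz c))%N by rewrite {1}cE abszM.
    by rewrite {2}cE' ut -mulnA -expnS dvdn_mull.
  by rewrite pfactor_dvdn// ltnn.
by rewrite -prime_coprime// => /eqP h1; rewrite /gcdz /= h1.
Qed.

Lemma coprimez_exp (u : int) t : coprimez u p%:Z -> coprimez u (p ^ t)%:Z.
Proof. by move=> h; rewrite coprimezE /= coprimeXr// -coprimezE. Qed.

(** Conjugating a translation by h gives the lower left entry -h c^2, where c = p^e u with u prime
    to p if e < m. The subtraction is truncated: the width is 1 as soon as 2e >= m. *)
Lemma cusp_width_level g e : SL2Z g -> cusp_level (g 1 0) e ->
  cusp_width (p ^ m) g (p ^ (m - e.*2)).
Proof.
move=> sg [em [u [cE cu]]].
have p0 := prime_gt0 p_pr.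
have E h : Gamma0 (p ^ m) (g *m translation h *m invmx g) <->
    ((p ^ m)%:Z %| h%:Z * (g 1%R 0%R) ^+ 2)%Z.
  split=> [[_]|h1]; first by rewrite conj_translation10// rpredN.
  by split; [exact: SL2Z_conj_translation|rewrite conj_translation10// rpredN].
have cc h : h%:Z * g 1 0 ^+ 2 = (h * p ^ e.*2)%:Z * u ^+ 2.
  have e2 : (p ^ e.*2 = p ^ e * p ^ e)%N by rewrite -addnn expnD.
  by rewrite cE e2 !PoszM; ring.
split.
  split; first by rewrite expn_gt0 p0.
  apply/E; rewrite cc dvdz_mulr// dvdzE /= -expnD dvdn_exp2l//.
  by lia.
move=> j [j0 /E]; rewrite cc => hj.
have [h|h] := leqP m e.*2.
  by rewrite (_ : m - e.*2 = 0)%N ?expn0//; lia.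
have em' : (e < m)%N by lia.
move: hj; rewrite Gauss_dvdzl; last first.
  rewrite coprimez_sym coprimezE abszX coprimeXl// -[coprime _ _]/(coprimez u (p ^ m)%:Z).
  exact/coprimez_exp/cu.
rewrite dvdzE /= -{1}(subnK (ltnW h)) expnD dvdn_pmul2r ?expn_gt0 ?p0//.
exact: dvdn_leq.
Qed.

(** This is gcd(p^e, p^(m-e)); its totient counts the cusps of level e. *)
Definition key_modulus e := (p ^ minn e (m - e))%N.

(** The classical invariant (e, x) of a cusp: for a lower row (c, d) with c = p^e u, x is the class
    of d / u. It does not change when (c, d) changes sign. *)
Definition cusp_key (c d : int) (k : nat * nat) : Prop :=
  cusp_level c k.1 /\ exists u : int, [/\ c = (p ^ k.1)%:Z * u,
    (k.1 < m)%N -> coprimez u p%:Z, (k.2 < key_modulus k.1)%N,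
    coprime (key_modulus k.1) k.2 & ((key_modulus k.1)%:Z %| k.2%:Z * u - d)%Z].

Lemma cusp_key_ex c d : coprimez c d -> exists k, cusp_key c d k.
Proof.
move=> cd; have [e he] := cusp_level_ex c; have [em [u [cE cu]]] := he.
set M := key_modulus e.
have M0 : (0 < M)%N by rewrite expn_gt0 prime_gt0.
have uM : coprimez u M%:Z.
  have [h|h] := ltnP e m; first exact/coprimez_exp/cu.
  by rewrite /M /key_modulus (_ : minn e (m - e) = 0)%N ?coprimezE ?coprimen1//; lia.
have [[s t] /= st] := coprimezP _ _ uM.
pose x := (d * s %% M%:Z)%Z.
have x0 : 0 <= x by apply: modz_ge0; rewrite -lt0n.
have xM : x < M%:Z by rewrite -[M%:Z]gez0_abs// ltz_mod// -lt0n.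
have hx : (M%:Z %| x * u - d)%Z.
  have -> : x * u - d = - ((d * s %/ M%:Z)%Z * u + d * t) * M%:Z.
    have e1 := divz_eq (d * s) M%:Z; rewrite -/x in e1.
    have -> : x = d * s - (d * s %/ M%:Z)%Z * M%:Z.
      by apply: (addrI ((d * s %/ M%:Z)%Z * M%:Z)); rewrite -e1; ring.
    have su : s * u = 1 - t * M%:Z by rewrite -st; ring.
    move: ((d * s %/ M%:Z)%Z) => q.
    have -> : (d * s - q * M%:Z) * u - d = d * (s * u) - q * M%:Z * u - d by ring.
    by rewrite su; ring.
  exact: dvdz_mull.
exists (e, absz x); split => //=; exists u; split => //=; rewrite -/M.
- by lia.
- have [h|h] := posnP (minn e (m - e)).
    by rewrite /M /key_modulus h expn0 coprime1n.
  rewrite /M /key_modulus coprimeXl// prime_coprime//; apply/negP => px.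
  have pd : (p%:Z %| d)%Z.
    have : (p%:Z %| x * u - d)%Z.
      by apply: dvdz_trans hx; rewrite dvdzE /= /M /key_modulus -{1}(expn1 p) dvdn_exp2l.
    move=> h1; have -> : d = x * u - (x * u - d) by ring.
    by apply: rpredB => //; apply: dvdz_mulr; rewrite dvdzE.
  have pc : (p%:Z %| c)%Z.
    have e0 : (0 < e)%N by move: h; rewrite leq_min => /andP[].
    by rewrite cE dvdz_mulr// dvdzE /= -{1}(expn1 p) dvdn_exp2l.
  have : (p%:Z %| gcdz c d)%Z by rewrite dvdz_gcd pc pd.
  rewrite (eqP cd) dvdzE /= dvdn1; move: (prime_gt1 p_pr); lia.
- by rewrite gez0_abs.
Qed.

(** The equivalence is sought as g' T^n g^-1, with T the unit translation, and n must make its lower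
    left entry divisible by p^m. Equal keys give u' d = u d' modulo [key_modulus e]. If m <= 2e, n =
    0 works; otherwise the modulus is p^e, and an inverse of u u' modulo p^(m-2e) yields n. *)
Lemma cusp_key_equiv g g' k : SL2Z g -> SL2Z g' ->
  cusp_key (g 1 0) (g 1 1) k -> cusp_key (g' 1 0) (g' 1 1) k ->
  cusp_equiv (p ^ m) (cusp_act g None) (cusp_act g' None).
Proof.
case: k => e x sg sg' [[em _] [u [cE cu _ _ du]]] [_ [u' [cE' cu' _ _ du']]].
have {}cE : g 1 0 = (p ^ e)%:Z * u := cE.
have {}cE' : g' 1 0 = (p ^ e)%:Z * u' := cE'.
have {}cu : (e < m)%N -> coprimez u p%:Z := cu.
have {}cu' : (e < m)%N -> coprimez u' p%:Z := cu'.
set M := key_modulus e.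
have {}du : (M%:Z %| x%:Z * u - g 1%R 1%R)%Z := du.
have {}du' : (M%:Z %| x%:Z * u' - g' 1%R 1%R)%Z := du'.
have hM : (M%:Z %| u' * g 1%R 1%R - u * g' 1%R 1%R)%Z.
  have -> : u' * g 1 1 - u * g' 1 1 = u * (x%:Z * u' - g' 1 1) - u' * (x%:Z * u - g 1 1) by ring.
  by rewrite rpredB// dvdz_mull.
have [n hn] : exists n : int, ((p ^ m)%:Z %|
    g' 1%R 0%R * g 1%R 1%R + (g' 1%R 0%R * n + g' 1%R 1%R) * - g 1%R 0%R)%Z.
  have [h|h] := leqP m e.*2.
    exists 0; rewrite mulr0 add0r cE cE'.
    have -> : (p ^ e)%:Z * u' * g 1 1 + g' 1 1 * - ((p ^ e)%:Z * u) =
       (u' * g 1 1 - u * g' 1 1) * (p ^ e)%:Z by ring.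
    have -> : (p ^ m)%:Z = M%:Z * (p ^ e)%:Z.
      rewrite -PoszM /M /key_modulus -expnD; congr (Posz (p ^ _)).
      have em1 : (e <= m)%N := em.
      by rewrite (minn_idPr _) ?subnK// leq_subLR addnn.
    by apply: dvdz_mul.
  have em' : (e < m)%N by lia.
  have Me : M = (p ^ e)%N by rewrite /M /key_modulus; congr expn; lia.
  have /dvdzP[y hy] : ((p ^ e)%:Z %| u' * g 1%R 1%R - u * g' 1%R 1%R)%Z by rewrite -Me.
  have uu : coprimez (u * u') (p ^ (m - e.*2))%:Z.
    by apply: coprimez_exp; rewrite coprimezMl cu// cu'.
  have [[s t] /= st] := coprimezP _ _ uu.
  exists (y * s); rewrite cE cE'.
  have -> : (p ^ m)%:Z = (p ^ e)%:Z * (p ^ e)%:Z * (p ^ (m - e.*2))%:Z.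
    by rewrite -!PoszM -!expnD addnn subnKC// ltnW.
  apply/dvdzP; exists (y * t).
  have -> : (p ^ e)%:Z * u' * g 1 1 + ((p ^ e)%:Z * u' * (y * s) + g' 1 1) * - ((p ^ e)%:Z * u)
    = (p ^ e)%:Z * (u' * g 1 1 - u * g' 1 1) - (p ^ e)%:Z * (p ^ e)%:Z * y * (s * (u * u')) by ring.
  have -> : s * (u * u') = 1 - t * (p ^ (m - e.*2))%:Z by rewrite -st; ring.
  by rewrite hy; ring.
pose T := mx2 1 n 0 1.
have sT : \det T = 1 by rewrite det2E !mx2E mulr1 mulr0 subr0.
have gu : g \in unitmx by rewrite unitmxE (sg : \det g = 1) unitr1.
have sga : SL2Z (g' *m T *m invmx g).
  by rewrite /SL2Z /= !det_mulmx sT det_invmx// (sg' : \det g' = 1) !mulr1.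
exists (g' *m T *m invmx g).
  split => //; rewrite invmx2// /T !(mulmx2E, mx2E).
  by move: hn; rewrite mulr1 mulr0 addr0 mulr1.
rewrite cusp_act_mul// mulmxKV//; apply: cusp_act_None.
  by rewrite mulmx2E /T !mx2E mulr1 mulr0 addr0.
by rewrite mulmx2E /T !mx2E mulr1 mulr0 addr0.
Qed.

Lemma SL2Z_coprime g : SL2Z g -> coprimez (g 1 0) (g 1 1).
Proof.
rewrite /SL2Z /= det2E => h; apply/coprimezP; exists (- g 0 1, g 0 0) => /=.
by rewrite -h; ring.
Qed.

Definition cusp_keys : seq (nat * nat) :=
  [seq (e, x) | e <- iota 0 m.+1,
                x <- [seq x <- iota 0 (key_modulus e) | coprime (key_modulus e) x]].

Lemma size_cusp_keys :
  size cusp_keys = (\sum_(0 <= e < m.+1) totient (key_modulus e))%N.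
Proof.
rewrite size_allpairs_dep sumnE big_map; apply: eq_bigr => e _.
rewrite size_filter totient_count_coprime -sum1_count big_mkcond /=.
by rewrite /index_iota subn0; apply: eq_bigr => x _; case: coprime.
Qed.

Lemma cusp_representatives_keys (rs : seq cusp) : cusp_representatives (p ^ m) rs ->
  exists (G : cusp -> 'M[int]_2) (K : cusp -> nat * nat),
  [/\ forall r, SL2Z (G r) /\ cusp_act (G r) None = r,
      forall r, cusp_key (G r 1 0) (G r 1 1) (K r),
      {in rs &, injective K} & {subset map K rs <= cusp_keys}].
Proof.
move=> [_ inj _].
have /choice[GK hGK] : forall r : cusp, exists gk : 'M[int]_2 * (nat * nat),
    [/\ SL2Z gk.1, cusp_act gk.1 None = r & cusp_key (gk.1 1 0) (gk.1 1 1) gk.2].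
  move=> r; have [g sg gr] := cusp_lift r.
  by have [k hk] := cusp_key_ex (SL2Z_coprime sg); exists (g, k).
exists (fun r => (GK r).1), (fun r => (GK r).2); split.
- by move=> r; have [] := hGK r.
- by move=> r; have [] := hGK r.
- move=> r s rr ss e; apply: inj => //.
  have [sg gr h] := hGK r; have [sg' gs h'] := hGK s; rewrite e in h.
  by have := cusp_key_equiv sg sg' h h'; rewrite gr gs.
- move=> _ /mapP[r _ ->]; have [_ _ [[em _] [u [_ _ xM xc _]]]] := hGK r.
  case: (GK r).2 em xM xc => e x /= em xM xc.
  apply/allpairsPdep; exists e, x; split => //; first by rewrite mem_iota.
  by rewrite mem_filter xc mem_iota.
Qed.

Lemma cusp_representatives_size (rs : seq cusp) : cusp_representatives (p ^ m) rs ->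
  (size rs <= \sum_(0 <= e < m.+1) totient (key_modulus e))%N.
Proof.
move=> h; have [G [K [_ _ Kinj Ksub]]] := cusp_representatives_keys h.
have [ur _ _] := h.
by rewrite -size_cusp_keys -(size_map K) uniq_leq_size// map_inj_in_uniq.
Qed.

(** Multiplying on the left by h in Gamma0(p^m) changes the lower left entry by the factor h_11,
    prime to p if m > 0, and by a multiple of p^m; the level is unchanged. *)
Lemma cusp_representative_level (rs : seq cusp) g e :
  cusp_representatives (p ^ m) rs -> SL2Z g -> cusp_level (g 1 0) e ->
  exists r g', [/\ r \in rs, SL2Z g', cusp_act g' None = r & cusp_level (g' 1 0) e].
Proof.
move=> [_ _ surj] sg [em [u [cE cu]]].
have [r rrs [h [sh hN] hr]] := surj (cusp_act g None).
exists r, (h *m g); split => //.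
- by rewrite /SL2Z /= det_mulmx (sg : \det g = 1) (sh : \det h = 1) mulr1.
- by rewrite -cusp_act_mul.
split => //; have /dvdzP[w hw] := hN.
exists (w * (p ^ (m - e))%:Z * g 0 0 + h 1 1 * u); split.
  rewrite mulmx2E hw cE (_ : (p ^ m)%:Z = (p ^ e)%:Z * (p ^ (m - e))%:Z); first by ring.
  by rewrite -PoszM -expnD subnKC.
move=> em'; have {}cu := cu em'.
have hp : coprimez (h 1 1) p%:Z.
  move: sh; rewrite /SL2Z /= det2E => sh; apply/coprimezP.
  exists (h 0 0, - h 0 1 * w * (p ^ m.-1)%:Z) => /=.
  rewrite -sh hw (_ : (p ^ m)%:Z = (p ^ m.-1)%:Z * p%:Z); first by ring.
  by rewrite -PoszM -expnSr prednK// (leq_ltn_trans _ em').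
have hup : coprimez (h 1 1 * u) p%:Z by rewrite coprimezMl hp.
have [[s t] /= st] := coprimezP _ _ hup.
apply/coprimezP; exists (s, t - s * w * (p ^ (m - e).-1)%:Z * g 0 0) => /=.
rewrite -st (_ : (p ^ (m - e))%:Z = (p ^ (m - e).-1)%:Z * p%:Z); first by ring.
by rewrite -PoszM -expnSr prednK// subn_gt0.
Qed.

(** The two end terms have minimum 0, and without them every minimum drops by one: a recursion from
    m to m - 2. *)
Lemma sum_key_modulus_step (F : nat -> nat) n :
  (\sum_(0 <= e < n.+3) F (minn e (n.+2 - e)) =
   F 0 + F 0 + \sum_(0 <= e < n.+1) F (minn e (n - e)).+1)%N.
Proof.
rewrite big_nat_recl// min0n big_nat_recr//= (_ : minn n.+2 (n.+2 - n.+2) = 0)%N; last by lia.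
have -> : (\sum_(0 <= i < n.+1) F (minn i.+1 (n.+2 - i.+1)) =
    \sum_(0 <= e < n.+1) F (minn e (n - e)).+1)%N.
  by rewrite !big_nat; apply: eq_bigr => e he; congr F; lia.
by lia.
Qed.

Lemma cusp_count_le : (0 < m)%N -> (p ^ m)%N != 4%N ->
  (\sum_(0 <= e < m.+1) totient (key_modulus e) <= order_bound p m)%N.
Proof.
move=> m0 pm4; have p1 := prime_gt1 p_pr.
rewrite /key_modulus /order_bound (negbTE pm4) ifF; last first.
  by apply/negbTE; rewrite -(expn0 p) eqn_exp2l// -lt0n.
pose b n := (p ^ ((n - 1) %/ 2) * (p ^ ((n - 1) - 2 * ((n - 1) %/ 2)) + 1))%N.
(* For m = n + 2 the two end levels have one cusp each and the inner ones (p - 1) p^t, so the left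
   side is the cusp count. The induction uses b (n + 4) = p b (n + 2). *)
have G n : (p.-1 * (\sum_(0 <= e < n.+1) p ^ minn e (n - e)) + 2 = b n.+2)%N.
  have [k] := ubnP n; elim: k n => // k IH [|[|n]] nk.
  - by rewrite big_nat1 /b /= expn0 expn1; lia.
  - by rewrite big_nat_recr// big_nat1 /b /= expn0 expn1; lia.
  rewrite (sum_key_modulus_step (fun t => p ^ t)%N) expn0.
  under eq_bigr do rewrite expnS.
  rewrite -big_distrr /=.
  have : b n.+4 = (p * b n.+2)%N.
    rewrite /b !subn1 /= (_ : n.+3 %/ 2 = (n.+1 %/ 2).+1)%N; last by lia.
    rewrite expnS -mulnA; congr (_ * (_ * (p ^ _ + 1)))%N; lia.
  move=> ->; rewrite -IH; last by lia.
  move: (\sum_(0 <= e < n.+1) _)%N => S.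
  by case: (p) p1 => // q _ /=; nia.
case: m m0 {pm4} => [//|[|n]] _.
  by rewrite big_nat_recr// big_nat1 min0n (_ : minn 1 (1 - 1) = 0)%N//.
rewrite -/(b n.+2) -G (sum_key_modulus_step (fun t => totient (p ^ t))) expn0.
rewrite addnC leq_add// big_distrr /=; apply: leq_sum => e _.
by rewrite totient_pfactor.
Qed.

Lemma cusp_count_two : m = 2%N -> (\sum_(0 <= e < m.+1) totient (key_modulus e) = p.+1)%N.
Proof.
rewrite /key_modulus => ->; rewrite (sum_key_modulus_step (fun t => totient (p ^ t)) 0).
rewrite big_nat1 expn0 totient_pfactor//= expn0 muln1.
by rewrite (_ : totient 1 = 1)%N//; have := prime_gt0 p_pr; lia.
Qed.

End PrimePowerCusps.

(** * Expansions of f at the cusps and their first coefficients *)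

Section CuspExpansions.
Context {R : realType}.
Variables (p m l : nat) (co : nat -> rat).
Hypothesis p_pr : prime p.
Let k := l.+1.*2.

Lemma ratr_natX (n j : nat) : ratr (n%:R ^+ j) = n%:R ^+ j :> R[i].
Proof. by rewrite rmorphXn /= ratr_nat. Qed.

(** The p-adic exponent of h A / D, where h is the width and (A z + B) / D the argument of the i-th
    term: that term is a series in the p^lexp-th power of q_h. For m > 0 and i <= m it is 0 exactly
    when i = m and 2e <= m, or i = 0 and 2e >= m; only these indices reach the coefficient of
    q_h. *)
Definition lexp (e i : nat) : nat := (m - e.*2 + minn i e - (i - e))%N.

Definition cusp_coef (e : nat) (B : nat -> nat) (n : nat) : R[i] :=
  \sum_(0 <= i < m.+1) ratr (co i) * ((p ^ (i - e))%:R ^- k *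
    eis_coef k (p ^ lexp e i) (nome ((B i)%:R / (p ^ (i - e))%:R)) n).

(** For i > e, B is d / u modulo p^(i-e). If p divided B with e > 0, it would divide both c and d;
    so B is prime to p, which makes e^(2 pi i B / p^(i-e)) a primitive root of unity. *)
Lemma hecke_factor (c d : int) e i : coprimez c d -> cusp_level p m c e ->
  (i <= m)%N -> exists B : nat,
  ((e < i)%N -> (0 < e)%N -> ~~ (p %| B)%N) /\
  exists c' d' : int, c = (p ^ minn i e)%:Z * c' /\
    c' * B%:Z + (p ^ (i - e))%:Z * d' = d.
Proof.
move=> cd [em [u [cE cu]]] im.
have [ie|ei] := leqP i e.
  exists 0%N; split=> //; exists ((p ^ (e - i))%:Z * u), d; split.
    by rewrite mulrA -PoszM -expnD (subnKC ie).
  by rewrite mulr0 add0r (eqP ie) expn0 mul1r.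
have {}cu : coprimez u p%:Z by apply: cu; exact: leq_trans ei im.
set D := (p ^ (i - e))%N.
have D0 : (0 < D)%N by rewrite expn_gt0 prime_gt0.
have [[s t] /= st] := coprimezP _ _ (coprimez_exp (i - e) cu).
rewrite -/D in st.
pose q := (s * d %/ D%:Z)%Z; pose x := (s * d %% D%:Z)%Z.
have sdE : s * d = q * D%:Z + x by exact: divz_eq.
have x0 : 0 <= x by apply: modz_ge0; rewrite -lt0n.
have xB : (absz x)%:Z = x by rewrite gez0_abs.
exists (absz x); split.
  move=> _ e0; apply/negP => px.
  have pD : (p%:Z %| D%:Z)%Z.
    by rewrite dvdzE /= /D -{1}(expn1 p) dvdn_exp2l// subn_gt0.
  have psd : (p%:Z %| s * d)%Z.
    by rewrite sdE; apply: rpredD; [exact: dvdz_mull|rewrite dvdzE].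
  have pc : (p%:Z %| c)%Z by rewrite cE dvdz_mulr// dvdzE /= -{1}(expn1 p) dvdn_exp2l.
  have : (p%:Z %| gcdz c d)%Z.
    rewrite dvdz_gcd pc /=.
    have -> : d = u * (s * d) + t * D%:Z * d by rewrite -[LHS]mul1r -st; ring.
    by apply: rpredD; [exact: dvdz_mull|apply: dvdz_mulr; exact: dvdz_mull].
  by rewrite (eqP cd) dvdzE /= dvdn1; move: (prime_gt1 p_pr); lia.
exists u, (t * d + u * q); split; first by [].
rewrite xB (_ : x = s * d - q * D%:Z); last by rewrite sdE; ring.
by rewrite -[RHS]mul1r -st; ring.
Qed.

Lemma cusp_expansion_at (f : R[i] -> R[i]) g e :
  (forall z, upper_half_plane z ->
    f z = \sum_(0 <= i < m.+1) ratr (co i) * eisenstein k ((p ^ i)%:R * z)) ->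
  (k = 2%N -> \sum_(0 <= i < m.+1) co i / (p ^ i)%:R = 0) ->
  SL2Z g -> cusp_level p m (g 1 0) e ->
  exists B : nat -> nat,
  (forall i, (i <= m)%N -> (e < i)%N -> (0 < e)%N -> ~~ (p %| B i)%N) /\
  cusp_expansion (p ^ m) k f g (cusp_coef e B).
Proof.
move=> fE co_quasi sg he; have p0 := prime_gt0 p_pr.
have /choice[B hB] : forall i : nat, exists B : nat, (i <= m)%N ->
   ((e < i)%N -> (0 < e)%N -> ~~ (p %| B)%N) /\
   exists c' d' : int, g 1 0 = (p ^ minn i e)%:Z * c' /\
     c' * B%:Z + (p ^ (i - e))%:Z * d' = g 1 1.
  move=> i; have [im|im] := leqP i m; last by exists 0%N.
  by have [B h] := hecke_factor (SL2Z_coprime sg) he im; exists B.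
exists B; split; first by move=> i /hB[].
exists (p ^ (m - e.*2))%N; first exact: cusp_width_level.
move=> z z0; apply: ccvgE; rewrite -[ccvg _ _]/(csum _ _).
set h := (p ^ (m - e.*2))%N.
have h0 : (0 < h)%N by rewrite expn_gt0 p0.
move: (sg); rewrite /SL2Z /= det2E => det.
pose W i := ((p ^ minn i e)%:R * z + (B i)%:R) / (p ^ (i - e))%:R : R[i].
set j := (g 1 0)%:~R * z + (g 1 1)%:~R.
have [gz _] := eisenstein_SL2 l det z0.
have -> : slash k f g z = \sum_(0 <= i < m.+1) ratr (co i) *
    ((p ^ (i - e))%:R ^- k * eisenstein k (W i)).
  rewrite /slash -/j fE// mulr_sumr.
  have E i : (i < m.+1)%N -> j ^- k * (ratr (co i) * eisenstein k ((p ^ i)%:R *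
       (((g 0 0)%:~R * z + (g 0 1)%:~R) / j))) =
      ratr (co i) * ((p ^ (i - e))%:R ^- k * eisenstein k (W i)) -
      quasi_coef k * ((g 1 0)%:~R / j) * (ratr (co i) / (p ^ i)%:R).
    rewrite ltnS => im; have [_ [c' [d' [cE dE]]]] := hB i im.
    have -> : (p ^ i = p ^ minn i e * p ^ (i - e))%N.
      by rewrite -expnD; congr expn; lia.
    rewrite mulrCA (eisenstein_slash l _ _ det cE dE z0) ?expn_gt0 ?p0//.
    by rewrite -/k -/j -/(W i) mulrBr; congr (_ - _); ring.
  transitivity (\sum_(0 <= i < m.+1)
     (ratr (co i) * ((p ^ (i - e))%:R ^- k * eisenstein k (W i)) -
      quasi_coef k * ((g 1 0)%:~R / j) * (ratr (co i) / (p ^ i)%:R))).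
    by apply: eq_big_nat => i /andP[_ im]; exact: E im.
  (* The weight 2 defects share the factor c / j and add up with the weights [co i / (p ^ i)%:R],
     whose sum is 0. *)
  rewrite sumrB -mulr_sumr.
  suff -> : quasi_coef k * ((g 1 0)%:~R / j) * (\sum_(0 <= i < m.+1) ratr (co i) / (p ^ i)%:R) = 0.
    by rewrite subr0.
  have [k2|k2] := eqVneq k 2%N; last by rewrite /quasi_coef (negbTE k2) !mul0r.
  rewrite (_ : \sum_(0 <= i < m.+1) _ = ratr (\sum_(0 <= i < m.+1) co i / (p ^ i)%:R)).
    by rewrite co_quasi// rmorph0 mulr0.
  rewrite rmorph_sum; apply: eq_bigr => i _.
  by rewrite fmorph_div /= ratr_nat.
have Wz i : upper_half_plane (W i).
  apply: upper_divn; first by rewrite expn_gt0 p0.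
  by apply: (@upperD_int _ _ (B i)%:Z); apply: upper_mulnl => //; rewrite expn_gt0 p0.
have H i : i \in index_iota 0 m.+1 -> csum (fun n => ratr (co i) * ((p ^ (i - e))%:R ^- k *
    (eis_coef k (p ^ lexp e i) (nome ((B i)%:R / (p ^ (i - e))%:R)) n * nome (z / h%:R) ^+ n)))
    (ratr (co i) * ((p ^ (i - e))%:R ^- k * eisenstein k (W i))).
  rewrite mem_index_iota => /andP[_]; rewrite ltnS => im.
  apply: csumZ; apply: csumZ; apply: csum_eis_coef => //; first by rewrite expn_gt0 p0.
  rewrite -nomeMn -nomeD; congr nome; rewrite /W mulrDl addrC; congr (_ + _).
  have hL : (p ^ minn i e * h = p ^ lexp e i * p ^ (i - e))%N.
    rewrite /h -!expnD; congr expn; rewrite /lexp; move: he => [em _]; lia.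
  have D0 : (p ^ (i - e))%:R != 0 :> R[i] by rewrite pnatr_eq0 -lt0n expn_gt0 p0.
  have h0' : h%:R != 0 :> R[i] by rewrite pnatr_eq0 -lt0n.
  apply: (mulIf D0); rewrite divfK//; apply: (mulIf h0').
  rewrite mulrAC -natrM hL natrM.
  by field.
apply: eq_csum (csum_big H) => n; rewrite /cusp_coef mulr_suml.
by apply: eq_bigr => i _; rewrite !mulrA.
Qed.

Lemma cusp_order_le (f : R[i] -> R[i]) g a n : SL2Z g -> cusp_expansion (p ^ m) k f g a -> a n != 0 ->
  (cusp_order (p ^ m) k f (cusp_act g None) <= n%:R%:E)%E.
Proof.
move=> sg ga an; apply: ereal_inf_lbound; exists n => //=.
by exists g, a.
Qed.

Lemma cusp_coef0 e B : cusp_coef e B 0%N =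
  ratr (\sum_(0 <= i < m.+1) co i / (p ^ (i - e))%:R ^+ k) * eis_const k.
Proof.
rewrite /cusp_coef rmorph_sum mulr_suml; apply: eq_bigr => i _.
by rewrite /eis_coef eqxx fmorph_div /= ratr_natX mulrA.
Qed.

Lemma cusp_coef1 e B : cusp_coef e B 1%N =
  \sum_(0 <= i < m.+1) (if lexp e i == 0%N then
    ratr (co i) * ((p ^ (i - e))%:R ^- k * nome ((B i)%:R / (p ^ (i - e))%:R)) else 0).
Proof.
apply: eq_bigr => i _; rewrite /eis_coef /= dvdn1.
have -> : (p ^ lexp e i == 1)%N = (lexp e i == 0)%N.
  by rewrite -(expn0 p) eqn_exp2l// prime_gt1.
case: ifP => [/eqP ->|_]; last by rewrite !mulr0.
by rewrite expn0 divn1 sigma1n mul1r expr1.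
Qed.

Lemma co_div_neq0 i e (x : R[i]) : co i != 0 -> x != 0 ->
  ratr (co i) * ((p ^ (i - e))%:R ^- k * x) != 0.
Proof.
move=> c0 x0; rewrite mulf_neq0 ?fmorph_eq0// mulf_neq0// invr_neq0// expf_neq0//.
by rewrite pnatr_eq0 -lt0n expn_gt0 prime_gt0.
Qed.

Hypothesis m0 : (0 < m)%N.
Hypothesis co_first : co 0%N != 0.
Hypothesis co_last : co m != 0.

Lemma cusp_coef1_mid e (B : nat -> nat) : m = e.*2 -> cusp_coef e B 1%N =
  ratr (co 0%N) + ratr (co m) * ((p ^ e)%:R ^- k * nome ((B m)%:R / (p ^ e)%:R)).
Proof.
move=> me; have e0 : (0 < e)%N by lia.
rewrite cusp_coef1 big_nat_recr//= big_ltn//=.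
rewrite big_nat big1 ?addr0; last first.
  by move=> i /andP[i0 im]; rewrite ifF//; apply/negbTE; rewrite /lexp; lia.
rewrite ifT; last by rewrite /lexp; apply/eqP; lia.
rewrite ifT; last by rewrite /lexp; apply/eqP; lia.
rewrite (_ : m - e = e)%N; last by lia.
by rewrite sub0n expn0 expr1n !invr1 mul1r !mulr1 nome_nat mulr1.
Qed.

(* A rational (more generally real) value of a root of unity is a sign. *)
Lemma nome_frac_rational (b d : nat) (x : rat) : (0 < d)%N ->
  nome (b%:R / d%:R) = ratr x :> R[i] -> (d %| 2 * b)%N.
Proof.
move=> d0 hx; rewrite -(@nome_frac_eq1 R)// natrM -mulrA nomeMn hx.
have : cabs (nome (b%:R / d%:R : R[i])) = 1.
  rewrite cabs_nome (_ : complex.Im _ = 0) ?mulr0 ?oppr0 ?expR0//.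
  by rewrite -!(rmorph_nat (real_complex R)) -fmorphV -rmorphM.
rewrite hx -(fmorph_rat (real_complex R)) cabs_real => h.
rewrite -rmorphXn -[1]/((1 : R)%:C)%C (inj_eq (@complexI R)).
by rewrite -real_normK ?num_real// h expr1n.
Qed.

Lemma cusp_coef1_neq0 e (B : nat -> nat) : (e <= m)%N ->
  (e.*2 = m -> (p ^ m)%N != 4%N) ->
  (forall i, (i <= m)%N -> (e < i)%N -> (0 < e)%N -> ~~ (p %| B i)%N) ->
  cusp_coef e B 1%N != 0.
Proof.
move=> em pm4 hB.
have [h|h|h] := ltngtP e.*2 m.
- rewrite cusp_coef1 big_nat_recr//= big_nat big1 ?add0r; last first.
    by move=> i /andP[_ im]; rewrite ifF//; apply/negbTE; rewrite /lexp; lia.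
  rewrite ifT; last by rewrite /lexp; apply/eqP; lia.
  by apply: co_div_neq0 => //; exact: nome_neq0.
- rewrite cusp_coef1 big_nat_recl//= big_nat big1 ?addr0; last first.
    by move=> i /andP[_ im]; rewrite ifF//; apply/negbTE; rewrite /lexp; lia.
  rewrite ifT; last by rewrite /lexp; apply/eqP; lia.
  by apply: co_div_neq0 => //; exact: nome_neq0.
have e0 : (0 < e)%N by lia.
have pe0 : (0 < p ^ e)%N by rewrite expn_gt0 prime_gt0.
have pe1 : (p ^ e)%:R ^+ k != 0 :> R[i] by rewrite expf_neq0// pnatr_eq0 -lt0n.
have cm0 : ratr (co m) != 0 :> R[i] by rewrite fmorph_eq0.
rewrite cusp_coef1_mid//; apply/eqP => h0.
have hx : nome ((B m)%:R / (p ^ e)%:R) = ratr (- (co 0%N * (p ^ e)%:R ^+ k / co m)) :> R[i].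
  rewrite rmorphN rmorphM /= fmorphV /= rmorphM /= ratr_natX.
  have -> : ratr (co 0%N) = - (ratr (co m) * ((p ^ e)%:R ^- k * nome ((B m)%:R / (p ^ e)%:R))) :> R[i].
    by apply/eqP; rewrite -addr_eq0 h0.
  by move: (nome _) ((p ^ e)%:R ^+ k) pe1 => x y y0; field; rewrite y0 cm0.
(* So p^e divides [2 * B m]; as [B m] is prime to p, it divides 2, which leaves only p^m = 4. *)
have := nome_frac_rational pe0 hx.
have pB : ~~ (p %| B m)%N by apply: hB => //; lia.
rewrite Gauss_dvdl; last by rewrite coprimeXl// prime_coprime.
move=> pe2; have p2 : p = 2%N.
  have : (p %| 2)%N by apply: dvdn_trans pe2; rewrite -{1}(expn1 p) dvdn_exp2l.
  by rewrite dvdn_prime2// => /eqP.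
have e1 : e = 1%N.
  have := dvdn_leq (isT : 0 < 2)%N pe2; rewrite p2 -{2}(expn1 2) leq_exp2l//; lia.
by move: (pm4 h); rewrite p2 -h e1.
Qed.

(* For p^m = 4 the coefficient of q may vanish at the cusp 1/2; this forces all
   three coefficients up to scaling. *)
Lemma cusp_coef_four (B : nat -> nat) : p = 2%N -> m = 2%N -> ~~ (2 %| B 2%N)%N ->
  cusp_coef 1 B 1%N = 0 -> cusp_coef 1 B 0%N = 0 ->
  [/\ co 2%N = co 0%N * 2 ^+ k, co 1%N = - (2 * co 0%N) & cusp_coef 1 B 2%N != 0].
Proof.
move=> p2 m2 B2 h1 h0.
have k2 : 2 ^+ k != 0 :> R[i] by rewrite expf_neq0.
have xi : nome ((B 2%N)%:R / 2) = -1 :> R[i].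
  have : nome ((B 2%N)%:R / 2) ^+ 2 - 1 = 0 :> R[i].
    by rewrite -nomeMn mulrC divfK ?pnatr_eq0// nome_nat subrr.
  move/eqP; rewrite subr_sqr_1 mulf_eq0 => /orP[|].
    by rewrite subr_eq0 nome_frac_eq1// (negbTE B2).
  by rewrite addr_eq0 => /eqP.
have c2 : co 2%N = co 0%N * 2 ^+ k.
  move: h1; rewrite cusp_coef1_mid ?m2// p2 expn1 xi mulrN1 mulrN => /eqP.
  rewrite subr_eq0 => /eqP h.
  apply: (fmorph_inj (@ratr R[i])); rewrite rmorphM /= h ratr_natX.
  by rewrite divfK.
have c1 : co 1%N = - (2 * co 0%N).
  move/eqP: h0; rewrite cusp_coef0 mulf_eq0 (negbTE (eis_const_neq0 _)) orbF fmorph_eq0.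
  rewrite m2 p2 big_nat_recr//= big_nat_recr//= big_nat1 /= expn0 expn1 expr1n !divr1 c2.
  have k2' : 2 ^+ k != 0 :> rat by rewrite expf_neq0.
  rewrite mulfK// => /eqP h.
  by apply: (addrI (co 0%N)); apply: (addIr (co 0%N)); rewrite h; ring.
split=> //.
have L0 : lexp 1 0 = 0%N by rewrite /lexp m2.
have L1 : lexp 1 1 = 1%N by rewrite /lexp m2.
have L2 : lexp 1 2 = 0%N by rewrite /lexp m2.
have s2 : sigma l.*2.+1 2 = (1 + 2 ^ l.*2.+1)%N.
  by rewrite /sigma (_ : divisors 2 = [:: 1; 2]%N)// !big_cons big_nil exp1n addn0.
have kE : 2 ^+ k = 2 * 2 ^+ l.*2.+1 :> R[i] by rewrite -exprS.
rewrite /cusp_coef m2 p2 big_nat_recr//= big_nat_recr//= big_nat1 /eis_coef /= L0 L1 L2.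
rewrite sub0n subnn -[(2 - 1)%N]/1%N !expn0 !expn1 !dvd1n dvdnn !divn1 divnn.
rewrite -[(0 < 2)%N]/true s2 sigma1n xi sqrrN !expr1n !invr1 !mul1r !mulr1 !nome_nat.
rewrite expr1n !mulr1 c2 c1 natrD natrX rmorphM /= ratr_natX rmorphN /= rmorphM /= ratr_nat.
(* Here sigma(2) = 1 + 2^(k-1) occurs for i = 0 and i = 2, and sigma(1) for i = 1: the coefficient
   is co 0 (2 (1 + 2^(k-1)) - 2) = co 0 2^k. *)
have -> : ratr (co 0%N) * (1 + 2 ^+ l.*2.+1) + - (2 * ratr (co 0%N)) +
    ratr (co 0%N) * 2 ^+ k * (2 ^- k * (1 + 2 ^+ l.*2.+1)) = ratr (co 0%N) * 2 ^+ k :> R[i].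
  by rewrite mulrA mulfK// kE; ring.
by rewrite mulf_neq0// fmorph_eq0.
Qed.

End CuspExpansions.

(** * The coefficients c_i of an element of the Eisenstein space *)

Section EisensteinSpace.
Context {R : realType}.
Implicit Types (f : R[i] -> R[i]) (p m k : nat).

Lemma perm_divisors_pfactor p m : prime p ->
  perm_eq (divisors (p ^ m)) [seq (p ^ i)%N | i <- index_iota 0 m.+1].
Proof.
move=> pp; apply: uniq_perm; first exact: divisors_uniq.
  rewrite map_inj_uniq ?iota_uniq// => i j /eqP.
  by rewrite eqn_exp2l ?prime_gt1// => /eqP.
move=> d; rewrite -dvdn_divisors ?expn_gt0 ?prime_gt0//.
apply/(dvdn_pfactor _ _ pp)/mapP => -[i im ->]; exists i => //.
  by rewrite mem_index_iota.
by move: im; rewrite mem_index_iota.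
Qed.

Lemma sum_divisors_pfactor p m (F : nat -> R[i]) : prime p ->
  \sum_(d <- divisors (p ^ m)) F d = \sum_(0 <= i < m.+1) F (p ^ i)%N.
Proof.
by move=> pp; rewrite (perm_big _ (perm_divisors_pfactor m pp)) big_map.
Qed.

Lemma sum_proper_divisors_pfactor p m (F : nat -> R[i]) : prime p ->
  \sum_(d <- [seq d <- divisors (p ^ m) | (1 < d)%N]) F d =
  \sum_(0 <= i < m) F (p ^ i.+1)%N.
Proof.
move=> pp; rewrite big_filter big_mkcond sum_divisors_pfactor// big_nat_recl//=.
rewrite add0r; apply: eq_bigr => i _.
by rewrite ifT// -(expn0 p) ltn_exp2l// prime_gt1.
Qed.

(** This gives weight 2 the same shape as the other weights, at the price of one linear relation. If
    an end coefficient vanished, f would be old for the divisor d = p. *)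
Lemma eis_space_coefs p m k f : prime p -> eis_space k (p ^ m) f ->
  exists co : nat -> rat,
  [/\ forall z, upper_half_plane z ->
        f z = \sum_(0 <= i < m.+1) ratr (co i) * eisenstein k ((p ^ i)%:R * z),
      k = 2%N -> \sum_(0 <= i < m.+1) co i / (p ^ i)%:R = 0 &
      (0 < m)%N -> ~ old_eis k (p ^ m) f -> co 0%N != 0 /\ co m != 0].
Proof.
move=> pp; have p0 := prime_gt0 pp; have p1 := prime_gt1 pp.
have pN0 n : (p ^ n)%:R != 0 :> rat by rewrite pnatr_eq0 -lt0n expn_gt0 p0.
have rM (x y : rat) : ratr (x * y) = ratr x * ratr y :> R[i] by exact: rmorphM.
have rN (x : rat) : ratr (- x) = - ratr x :> R[i] by exact: rmorphN.
have old m' : (0 < m')%N -> [/\ (1 < p)%N, (p %| p ^ m')%N & (p ^ m' %/ p = p ^ m'.-1)%N].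
  case: m' => // n _; split => //; first by rewrite expnS dvdn_mulr.
  by rewrite expnS mulKn.
rewrite /eis_space; have [->|k2] := eqVneq k 2%N.
  move=> [c hc].
  (* Every generator contributes to E_2(z), hence the sum at i = 0. *)
  pose co i := if i is 0 then \sum_(0 <= j < m) c (p ^ j.+1)%N
               else - ((p ^ i)%:R * c (p ^ i)%N).
  have fE z : upper_half_plane z ->
      f z = \sum_(0 <= i < m.+1) ratr (co i) * eisenstein 2 ((p ^ i)%:R * z).
    move=> z0; rewrite hc// sum_proper_divisors_pfactor// big_nat_recl//= expn0 mul1r.
    rewrite rmorph_sum mulr_suml -big_split /=; apply: eq_bigr => i _.
    rewrite rmorphN rmorphM /= ratr_nat.
    move: (ratr (c _)) (eisenstein 2 z) (eisenstein 2 _) => C u v; ring.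
  exists co; split => //.
    move=> _; rewrite big_nat_recl//= expn0 divr1 -big_split /= big1// => i _.
    by rewrite mulNr mulrAC divff// mul1r subrr.
  move=> m0 nold; have [d1 d2 d3] := old m m0; split; apply/eqP => c0; apply: nold.
    (* The c(p^j) now sum to 0, so c(p) E_2(p z) is minus the sum of the c(p^j) E_2(p z) with j >=
       2. This rewrites f as g(p z), where g has the coefficients p c(p d). *)
    exists p; split => //; right; rewrite d3.
    exists (fun w => \sum_(d <- [seq d <- divisors (p ^ m.-1) | (1 < d)%N])
        ratr (p%:R * c (p * d)%N) * (eisenstein 2 w - d%:R * eisenstein 2 (d%:R * w))).
      by exists (fun d => p%:R * c (p * d)%N).
    move=> z z0; have c0' : \sum_(0 <= j < m) c (p ^ j.+1)%N = 0 := c0.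
    have [n mE] : exists n, m = n.+1 by exists m.-1; rewrite prednK.
    rewrite fE// big_nat_recl// [co 0%N]c0 rmorph0 mul0r add0r /=.
    rewrite sum_proper_divisors_pfactor// mE /= big_nat_recl//=.
    move: c0'; rewrite mE big_nat_recl//= expn1 => c0'.
    have c1 : c p = - \sum_(0 <= j < n) c (p ^ j.+2)%N.
      by apply/eqP; rewrite -addr_eq0 c0'.
    rewrite c1 !rmorphN rmorphM rmorphN /= mulrN opprK rmorph_sum /= ratr_nat.
    rewrite mulr_sumr mulr_suml -big_split /=; apply: eq_bigr => i _.
    have -> : (p ^ i.+1)%:R * (p%:R * z) = (p ^ i.+2)%:R * z.
      by rewrite mulrA -natrM -expnSr.
    rewrite rN !rM !ratr_nat -expnS.
    move: (ratr (c _)) (eisenstein 2 (p%:R * z)) (eisenstein 2 _) => C u v.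
    by rewrite (expnS p i.+1) !natrM; ring.
  exists p; split => //; left; rewrite d3 /eis_space eqxx; exists c => z z0.
  rewrite hc// !sum_proper_divisors_pfactor//.
  have [n mE] : exists n, m = n.+1 by exists m.-1; rewrite prednK.
  have cm : c (p ^ m)%N = 0.
    move/eqP: c0; rewrite {1}mE /= -mE oppr_eq0 mulf_eq0 (negbTE (pN0 _)).
    by move/eqP.
  rewrite mE /= big_nat_recr//= -mE cm.
  by rewrite rmorph0 mul0r addr0.
move=> [c hc]; pose co i := c (p ^ i)%N.
have fE z : upper_half_plane z ->
    f z = \sum_(0 <= i < m.+1) ratr (co i) * eisenstein k ((p ^ i)%:R * z).
  by move=> z0; rewrite (hc z z0) (sum_divisors_pfactor m _ pp); reflexivity.
exists co; split => //; first by move=> k2'; rewrite k2' eqxx in k2.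
move=> m0 nold; have [d1 d2 d3] := old m m0; split; apply/eqP => c0; apply: nold.
  exists p; split => //; right; rewrite d3.
  exists (fun w => \sum_(d <- divisors (p ^ m.-1)) ratr (c (p * d)%N) * eisenstein k (d%:R * w)).
    rewrite /eis_space (negbTE k2).
    exists (fun d => c (p * d)%N) => w _.
    reflexivity.
  move=> z z0; rewrite (fE z z0) (big_nat_recl m 0 _ (leq0n m)) c0 rmorph0 mul0r add0r.
  rewrite (sum_divisors_pfactor m.-1 _ pp) (prednK m0); apply: eq_bigr => i _.
  by rewrite /co expnS mulrA -natrM mulnC.
exists p; split => //; left; rewrite d3 /eis_space (negbTE k2); exists c => z z0.
rewrite (fE z z0) (sum_divisors_pfactor m.-1 _ pp) (prednK m0).
by rewrite (big_nat_recr m 0 _ (leq0n m)) /= c0 rmorph0 mul0r addr0; reflexivity.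
Qed.

Lemma sum_ereal_le (T : eqType) (rs : seq T) (F : T -> \bar R) (o : T -> nat) :
  (forall r, r \in rs -> (F r <= (o r)%:R%:E)%E) ->
  (\sum_(r <- rs) F r <= (\sum_(r <- rs) o r)%N%:R%:E)%E.
Proof.
elim: rs => [|r rs IH] h; first by rewrite !big_nil.
rewrite !big_cons natrD EFinD leeD ?h ?mem_head// IH// => s hs.
by apply: h; rewrite in_cons hs orbT.
Qed.

End EisensteinSpace.

(** * Summation of the orders over the cusps *)

Theorem theorem1p1 (R : realType) (p m k : nat) (f : R[i] -> R[i])
    (rs : seq cusp) (p_prime : prime p) (k_ge2 : (2 <= k)%N)
    (k_even : ~~ odd k) (f_prim : prim_eis k (p ^ m) f)
    (f_nonzero : exists2 z, upper_half_plane z & f z != 0)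
    (rs_cusps : cusp_representatives (p ^ m) rs) :
  (\sum_(r <- rs) cusp_order (p ^ m) k f r < (order_bound p m)%:R%:E)%E.
Proof.
have p0 := prime_gt0 p_prime; have p1 := prime_gt1 p_prime.
have [l kE] : exists l, k = l.+1.*2.
  by exists (k./2.-1); move: (odd_double_half k); rewrite (negbTE k_even); lia.
move: f_prim => [f_eis f_new].
have [co [fE co_quasi co_ends]] := eis_space_coefs p_prime f_eis.
subst k.
have [G [K [hG hK Kinj Ksub]]] := cusp_representatives_keys p_prime rs_cusps.
have [ur _ _] := rs_cusps.
have szrs := cusp_representatives_size p_prime rs_cusps.
have level r : cusp_level p m (G r 1 0) (K r).1 by have [] := hK r.
suff : exists o : cusp -> nat,
    (forall r, r \in rs -> (cusp_order (p ^ m) l.+1.*2 f r <= (o r)%:R%:E)%E) /\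
    (\sum_(r <- rs) o r < order_bound p m)%N.
  by move=> [od [ho sumo]]; apply: le_lt_trans (sum_ereal_le ho) _; rewrite lte_fin ltr_nat.
have const_order g e : SL2Z g -> cusp_level p m (g 1 0) e ->
    \sum_(0 <= i < m.+1) co i / (p ^ (i - e))%:R ^+ l.+1.*2 != 0 ->
    (cusp_order (p ^ m) l.+1.*2 f (cusp_act g None) <= 0%:R%:E)%E.
  move=> sg he S0; have [B [_ hB]] := cusp_expansion_at p_prime fE co_quasi sg he.
  apply: (cusp_order_le sg hB).
  by rewrite cusp_coef0 mulf_neq0 ?eis_const_neq0// fmorph_eq0.
(* At level 1 nothing is old, since no d > 1 divides 1; there [co 0] is nonzero because f is. *)
have [m0|m0] := posnP m.
  exists (fun=> 0%N); split; last by rewrite big1// m0 /order_bound expn0 eqxx.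
  move=> r _; have [sg gr] := hG r; rewrite -gr.
  apply: const_order sg (level r) _; rewrite m0 big_nat1 sub0n expn0 expr1n divr1.
  apply/eqP => c0; have [z z0] := f_nonzero.
  by rewrite fE// m0 big_nat1 c0 rmorph0 mul0r eqxx.
have [co0 com] := co_ends m0 f_new.
have ord1 r : (p ^ m)%N != 4%N -> (cusp_order (p ^ m) l.+1.*2 f r <= 1%:R%:E)%E.
  move=> pm4; have [sg gr] := hG r; rewrite -gr.
  have [B [hB1 hB]] := cusp_expansion_at p_prime fE co_quasi sg (level r).
  apply: (cusp_order_le sg hB).
  by apply: (cusp_coef1_neq0 l p_prime m0 co0 com) => //; have [] := level r.
have [pm4|pm4] := eqVneq (p ^ m)%N 4%N; last first.
  have [r0 r0rs or0] : exists2 r0, r0 \in rs &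
      (cusp_order (p ^ m) l.+1.*2 f r0 <= 0%:R%:E)%E.
    (* Up to [eis_const] this is the constant term at level e. Since i - e is truncated, only the
       index i = m distinguishes e = m.-1 from e = m. *)
    pose S e := \sum_(0 <= i < m.+1) co i / (p ^ (i - e))%:R ^+ l.+1.*2.
    have [e em Se] : exists2 e, (e <= m)%N & S e != 0.
      have [Sm|] := eqVneq (S m) 0; last by exists m.
      exists m.-1; first exact: leq_pred.
      apply/eqP => Sm1; move/eqP: com; apply.
      have h : S m - S m.-1 = co m * (1 - (p%:R ^+ l.+1.*2)^-1).
        rewrite /S [in X in _ - X]big_nat_recr//= big_nat_recr//= subnn expn0 expr1n divr1.
        rewrite (_ : m - m.-1 = 1)%N; last by lia.
        rewrite expn1 (_ : \sum_(0 <= i < m) co i / (p ^ (i - m))%:R ^+ l.+1.*2 =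
           \sum_(0 <= i < m) co i / (p ^ (i - m.-1))%:R ^+ l.+1.*2); first by ring.
        rewrite !big_nat; apply: eq_bigr => i /= im.
        by rewrite (_ : i - m = i - m.-1)%N//; lia.
      have : co m * (1 - (p%:R ^+ l.+1.*2)^-1) = 0 by rewrite -h Sm Sm1 subrr.
      move/eqP; rewrite mulf_eq0 => /orP[/eqP//|].
      rewrite subr_eq0 eq_sym invr_eq1 => /eqP h1.
      have : (1 : rat) < p%:R ^+ l.+1.*2 by rewrite exprn_egt1// ltr1n.
      by rewrite h1 ltxx.
    pose g0 := mx2 1 0 (p ^ e)%:Z 1.
    have sg0 : SL2Z g0 by rewrite /SL2Z /= det2E !mx2E; lia.
    have lg0 : cusp_level p m (g0 1 0) e.
      split => //; exists 1; rewrite mx2E mulr1; split => // _.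
      by rewrite coprimezE coprime1n.
    have [r [g [rrs sg gr lg]]] := cusp_representative_level rs_cusps sg0 lg0.
    by exists r => //; rewrite -gr; exact: const_order lg Se.
  (* One order is at most 0 and the others at most 1, so the sum is strictly below the number of
     cusps. *)
  exists (fun r => (r != r0) : nat); split.
    by move=> r _; case: eqVneq => [->//|_]; exact: ord1.
  apply: leq_trans (cusp_count_le p_prime m0 pm4); apply: leq_trans szrs.
  rewrite (_ : (\sum_(r <- rs) (r != r0))%N = count (predC (pred1 r0)) rs); last first.
    by rewrite -sum1_count [RHS]big_mkcond; apply: eq_bigr => r _ /=; case: (r == r0).
  rewrite -(count_predC (pred1 r0)).
  by rewrite -[X in (X < _)%N]add0n ltn_add2r -has_count has_pred1.
have [p2 m2] : p = 2%N /\ m = 2%N.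
  have p2 : p = 2%N.
    have : (p %| 2 ^ 2)%N by rewrite -[(2 ^ 2)%N]pm4 -{1}(expn1 p) dvdn_exp2l.
    by rewrite Euclid_dvdX// dvdn_prime2// andbT => /eqP.
  by split => //; apply/eqP; rewrite -(eqn_exp2l _ _ (isT : 1 < 2)%N) -{1}p2 pm4.
have bound4 : order_bound p m = 4%N by rewrite /order_bound pm4.
have size3 : (size rs <= 3)%N.
  by apply: leq_trans szrs _; rewrite (cusp_count_two p_prime m2) p2.
rewrite bound4.
have le_order r (n n' : nat) : (n <= n')%N ->
    (cusp_order (p ^ m) l.+1.*2 f r <= n%:R%:E)%E ->
    (cusp_order (p ^ m) l.+1.*2 f r <= n'%:R%:E)%E.
  by move=> nn' h; apply: le_trans h _; rewrite lee_fin ler_nat.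
have ord_off r : (K r).1 != 1%N -> (cusp_order (p ^ m) l.+1.*2 f r <= 1%:R%:E)%E.
  move=> e1; have [sg gr] := hG r; rewrite -gr.
  have [B [hB1 hB]] := cusp_expansion_at p_prime fE co_quasi sg (level r).
  apply: (cusp_order_le sg hB).
  apply: (cusp_coef1_neq0 l p_prime m0 co0 com) => //; first by have [] := level r.
  by rewrite m2 => e2; move: e1; lia.
have ord_mid r : (K r).1 = 1%N -> (cusp_order (p ^ m) l.+1.*2 f r <= 1%:R%:E)%E \/
    [/\ co 2%N = co 0%N * 2 ^+ l.+1.*2, co 1%N = - (2 * co 0%N) &
        (cusp_order (p ^ m) l.+1.*2 f r <= 2%:R%:E)%E].
  move=> e1; have [sg gr] := hG r.
  have lr : cusp_level p m (G r 1 0) 1 by have := level r; rewrite e1.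
  have [B [hB1 hB]] := cusp_expansion_at p_prime fE co_quasi sg lr.
  have [h1|h1] := eqVneq (cusp_coef p m l co 1 B 1%N) (0 : R[i]); last first.
    by left; rewrite -gr; exact: (cusp_order_le sg hB).
  have [h0|h0] := eqVneq (cusp_coef p m l co 1 B 0%N) (0 : R[i]); last first.
    by left; apply: (le_order _ 0%N) => //; rewrite -gr; exact: (cusp_order_le sg hB).
  have B2 : ~~ (2 %| B 2%N)%N by have := hB1 2%N; rewrite m2 p2; exact.
  have [c2 c1 h2] := cusp_coef_four p_prime m0 co0 com p2 m2 B2 h1 h0.
  by right; split => //; rewrite -gr; exact: (cusp_order_le sg hB).
(* In the ratio 1 : -2 : 2^k order 2 may occur at level 1, but the constant terms at levels 0 and 2
   are then multiples of co 0 (2^k - 1) / 2^k and co 0 (2^k - 1), both nonzero. *)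
have [bad|good] := boolP ((co 2%N == co 0%N * 2 ^+ l.+1.*2) && (co 1%N == - (2 * co 0%N))).
  have /andP[/eqP c2 /eqP c1] := bad.
  have k2 : 2 ^+ l.+1.*2 != 0 :> rat by rewrite expf_neq0.
  have k1 : (1 : rat) < 2 ^+ l.+1.*2 by rewrite exprn_egt1// ltr1n.
  have k1' : (2 ^+ l.+1.*2 : rat) - 1 != 0 by rewrite subr_eq0 gt_eqF.
  (* The key modulus at level 1 is 2, and 1 is the only residue prime to 2: at most one cusp is
     charged 2. *)
  have K11 r : r \in rs -> (K r).1 = 1%N -> K r = (1, 1)%N.
    move=> rrs; have : K r \in cusp_keys p m by apply: Ksub; rewrite map_f.
    case/allpairsPdep => e [x [_ + ->]] /= e1.
    rewrite e1 mem_filter mem_iota /key_modulus m2 p2 /= => /andP[].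
    by case: x => [|[|x]].
  exists (fun r => if K r == (1, 1)%N then 2 else 0)%N; split.
    move=> r rrs; have [e1|e1] := eqVneq (K r).1 1%N.
      rewrite K11// eqxx; have [h|[_ _ //]] := ord_mid r e1.
      exact: (le_order _ 1%N).
    case: ifP => _; first exact: (le_order _ 1%N) (ord_off _ e1).
    have [sg gr] := hG r; rewrite -gr; apply: const_order sg (level r) _.
    rewrite m2 p2 big_nat_recr//= big_nat_recr//= big_nat1 c1 c2.
    have [em _] := level r; rewrite m2 in em.
    have [-> |->] : (K r).1 = 0%N \/ (K r).1 = 2%N by case: (K r).1 e1 em => [|[|[|]]]//; [left|right].
      rewrite !subn0 expn0 expn1 expr1n divr1 -[(2 ^ 2)%:R]/(4%:R).
      have -> : (4%:R : rat) ^+ l.+1.*2 = 2 ^+ l.+1.*2 * 2 ^+ l.+1.*2.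
        by rewrite -exprMn -natrM.
      have -> : co 0%N + - (2 * co 0%N) / 2 ^+ l.+1.*2 +
         co 0%N * 2 ^+ l.+1.*2 / (2 ^+ l.+1.*2 * 2 ^+ l.+1.*2) =
         co 0%N * (2 ^+ l.+1.*2 - 1) / 2 ^+ l.+1.*2.
        by move: (2 ^+ _) k2 => y y0; field.
      by rewrite !mulf_neq0 ?invr_neq0.
    rewrite subnn -[(0 - 2)%N]/0%N -[(1 - 2)%N]/0%N expn0 expr1n !divr1.
    have -> : co 0%N - 2 * co 0%N + co 0%N * 2 ^+ l.+1.*2 =
        co 0%N * (2 ^+ l.+1.*2 - 1) by ring.
    by rewrite mulf_neq0.
  rewrite -(big_map K xpredT (fun x => if x == (1, 1)%N then 2 else 0)%N).
  have uK : uniq (map K rs) by rewrite map_inj_in_uniq.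
  suff h : (\sum_(x <- map K rs) (if x == (1, 1) then 2 else 0) <= 2)%N.
    exact: leq_ltn_trans h _.
  elim: (map K rs) uK => [|x s IH] /=; first by rewrite big_nil.
  rewrite big_cons => /andP[xs us]; case: eqP => [x11|_]; last exact: IH.
  rewrite big_seq big1 ?addn0// => y ys; case: eqP => // y11.
  by rewrite -x11 in y11; rewrite -y11 ys in xs.
exists (fun=> 1%N); split; last by rewrite sum1_size.
move=> r _; have [e1|e1] := eqVneq (K r).1 1%N; last exact: ord_off.
have [//|[c2 c1 _]] := ord_mid r e1.
by move: good; rewrite c2 c1 !eqxx.
Qed.
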